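(* Let $X = \mathbb{P}^2$ be the complex projective plane with homogeneous coordinates $(z_0:z_1:z_2)$, let $L = \mathcal{O}_{\mathbb{P}^2}(1)$, and let $h$ be the singular hermitian metric on $L$, with non-negative curvature current, induced by the linear system of lines passing through $(1:0:0)$, i.e. the metric with plurisubharmonic weight $\phi = \frac{1}{2}\log(|z_1|^2+|z_2|^2)$. Then there is no dominant rational map $f: \mathbb{P}^2 \dashrightarrow Y$ with connected fibers onto a normal projective variety $Y$ satisfying all of the following: (a) $f$ is almost holomorphic; (b) $(L,h)$ is numerically trivial on every very general fiber $F$ of $f$, i.e. $(L,h).C = 0$ for every irreducible curve $C \subset F$; (c) for every very general point $x \in \mathbb{P}^2$ and every irreducible curve $C \subset \mathbb{P}^2$ through $x$ with $\dim f(C) > 0$, one has $(L,h).C > 0$.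
   Context: Let $(L,h)$ be a line bundle with a singular hermitian metric on a smooth projective variety $X$ with non-negative curvature current, locally $h = e^{-2\phi}$ with $\phi$ plurisubharmonic. The multiplier ideal sheaf $\mathcal{I}(h^m) = \mathcal{I}(m\phi)$ is the sheaf of germs of holomorphic functions $g$ such that $|g|^2 e^{-2m\phi}$ is locally integrable. Let $C \subset X$ be an irreducible curve such that the natural morphism $\mathcal{I}(h^m) \otimes \mathcal{O}_C \to \mathcal{O}_C$ is an isomorphism at the generic point of $C$ for every $m \geq 0$. Then $$(L,h).C := \limsup_{m \to \infty} \frac{\dim H^0\big(C, (\mathcal{O}_C(mL) \otimes \mathcal{I}(h^m))/\mathrm{tor}\big)}{m},$$ where $\mathrm{tor}$ denotes the torsion part of $\mathcal{O}_C(mL) \otimes \mathcal{I}(h^m)$. For the metric $h$ in the claim this is defined for every irreducible curve $C \subset \mathbb{P}^2$. For a rational map $f: X \dashrightarrow Y$ of normal projective varieties, let $X^0 \subset X$ be the maximal open subset on which $f$ is holomorphic; $f$ is almost holomorphic if some fibers of $f|_{X^0}$ are compact. For a curve $C$ meeting $X^0$, $f(C)$ denotes the (closure of the) image $f(C \cap X^0)$. *)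

(* Defs.v *)
From HB Require Import structures.
From mathcomp Require Import all_boot all_order all_algebra complex.
From mathcomp Require Import all_classical all_reals all_analysis.
From mathcomp Require Import generic_quotient.
From mathcomp Require Import -(notations) mpoly.

Set Implicit Arguments.
Unset Strict Implicit.
Unset Printing Implicit Defensive.
Import Order.TTheory GRing.Theory Num.Theory.
Import numFieldNormedType.Exports.

Local Open Scope classical_set_scope.
Local Open Scope ring_scope.

(* R[i]^o is R[i] with its structure of normed space over itself. *)

Section ProjectiveSpace.
Variables (R : realType) (n : nat).

Definition nonzero_vec : set 'rV[R[i]^o]_n.+1 := [set v | v != 0].

Definition proportional (u v : nonzero_vec) : bool :=
  `[< exists a : R[i], a != 0 /\ val v = a *: val u >].

Lemma proportional_equiv : equiv_class_of proportional.
Proof.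
split.
- by move=> u; apply/asboolP; exists 1; split; rewrite ?oner_neq0 ?scale1r.
- suff sym u v : proportional u v -> proportional v u.
    by move=> u v; apply/idP/idP; exact: sym.
  move=> /asboolP[a [a0 uv]]; apply/asboolP; exists a^-1.
  by split; rewrite ?invr_neq0// uv scalerA mulVf// scale1r.
- move=> v u w /asboolP[a [a0 uv]] /asboolP[b [b0 vw]]; apply/asboolP.
  by exists (b * a); split; rewrite ?mulf_neq0// vw uv scalerA.
Qed.

Definition proj_rel := EquivRelPack proportional_equiv.

(* P^n(C) with the quotient of the Euclidean topology of C^(n+1) \ 0. *)
Definition projspace : Type := quotient_topology {eq_quot proj_rel}%qT.
HB.instance Definition _ := Topological.on projspace.

Definition hcoord (x : projspace) : 'rV[R[i]^o]_n.+1 := val (repr x).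

Definition represents (x : projspace) (v : 'rV[R[i]^o]_n.+1) : Prop :=
  exists a : R[i], a != 0 /\ v = a *: hcoord x.

Definition cone (U : set projspace) : set 'rV[R[i]^o]_n.+1 :=
  [set v | exists2 x, U x & represents x v].

Definition pval (p : mpoly n.+1 R[i]) (x : projspace) : R[i] :=
  meval (fun i => hcoord x 0 i) p.

Definition homog (d : nat) (p : mpoly n.+1 R[i]) : Prop :=
  p \is ishomog1 d mdeg.

Definition zclosed (A : set projspace) : Prop :=
  exists S : set (mpoly n.+1 R[i]),
    (forall p, S p -> exists d, homog d p) /\
    A = [set x | forall p, S p -> pval p x = 0].

Definition zclosure (A : set projspace) : set projspace :=
  \bigcap_(B in [set B | zclosed B /\ A `<=` B]) B.

Definition zirreducible (A : set projspace) : Prop :=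
  A !=set0 /\
  forall B D, zclosed B -> zclosed D -> A `<=` B `|` D -> A `<=` B \/ A `<=` D.

Definition projective_variety (Y : set projspace) : Prop :=
  zclosed Y /\ zirreducible Y.

(* Krull dimension of A for the Zariski topology; the value is -oo on set0. *)
Definition zdim (A : set projspace) : \bar R :=
  ereal_sup [set (k%:R)%:E | k in [set k : nat |
    exists Z : nat -> set projspace,
      (forall i, (i <= k)%N -> projective_variety (Z i) /\ Z i `<=` A) /\
      (forall i, (i < k)%N -> Z i `<` Z i.+1)]].

Definition irreducible_curve (C : set projspace) : Prop :=
  projective_variety C /\ zdim C = 1%:E.

(* The local ring of Y at y is integrally closed in the function field of Y.  *)
(* Elements of the function field are quotients of forms of equal degree, and *)
(* two of them are equal iff they agree where the denominators do not vanish. *)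
Definition normal_at (Y : set projspace) (y : projspace) : Prop :=
  forall (d : nat) (G H : mpoly n.+1 R[i]),
  homog d G -> homog d H -> (exists2 x, Y x & pval H x != 0) ->
  forall (k : nat) (e : 'I_k -> nat) (A B : 'I_k -> mpoly n.+1 R[i]),
  (forall i, [/\ homog (e i) (A i), homog (e i) (B i) & pval (B i) y != 0]) ->
  (forall x, Y x -> pval H x != 0 -> (forall i, pval (B i) x != 0) ->
     (pval G x / pval H x) ^+ k +
     \sum_(i < k)
       pval (A i) x / pval (B i) x * (pval G x / pval H x) ^+ i = 0) ->
  exists (d' : nat) (G' H' : mpoly n.+1 R[i]),
    [/\ homog d' G', homog d' H', pval H' y != 0 &
        forall x, Y x -> pval G x * pval H' x = pval G' x * pval H x].

Definition normal_variety (Y : set projspace) : Prop :=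
  projective_variety Y /\ forall y, Y y -> normal_at Y y.

Definition generally (Y : set projspace) (Q : projspace -> Prop) : Prop :=
  exists Z : set projspace,
    [/\ zclosed Z, Z `<` Y & forall y, Y y -> ~ Z y -> Q y].

Definition very_generally (Y : set projspace) (Q : projspace -> Prop) : Prop :=
  exists Z : nat -> set projspace,
    (forall i, zclosed (Z i) /\ Z i `<` Y) /\
    forall y, Y y -> (forall i, ~ Z i y) -> Q y.

End ProjectiveSpace.

Section RationalMap.
Variables (R : realType) (n N : nat).

(* A representative (F_0 : ... : F_N) of a rational map P^n ---> P^N; the     *)
(* notions below do not depend on the representative.                         *)
Record rational_map := RationalMap {
  rm_deg : nat;
  rm_poly : 'I_N.+1 -> mpoly n.+1 R[i];
  rm_homog : forall j, homog rm_deg (rm_poly j);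
  rm_neq0 : exists j, rm_poly j != 0 }.

Definition rm_eval (f : rational_map) (x : projspace R n) : 'rV[R[i]^o]_N.+1 :=
  \row_j pval (rm_poly f j) x.

(* Near each point, g composed with the projection from C^(n+1) \ 0 lifts to  *)
(* a holomorphic map with values in C^(N+1) \ 0.                              *)
Definition holomorphic_map
    (U : set (projspace R n)) (g : projspace R n -> projspace R N) : Prop :=
  forall x, U x -> exists G : 'rV[R[i]^o]_n.+1 -> 'rV[R[i]^o]_N.+1,
    \forall v \near hcoord x,
      differentiable G v /\
      forall y, represents y v -> represents (g y) (G v).

Definition holomorphic_extension (f : rational_map)
    (U : set (projspace R n)) (g : projspace R n -> projspace R N) : Prop :=
  [/\ open U, holomorphic_map U g &
      forall x, U x -> rm_eval f x != 0 -> represents (g x) (rm_eval f x)].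

(* f is holomorphic at x, with value y; the points x for which such a y       *)
(* exists form the maximal open subset X^0 on which f is holomorphic.         *)
Definition rm_value (f : rational_map)
    (x : projspace R n) (y : projspace R N) : Prop :=
  exists U g, [/\ holomorphic_extension f U g, U x & g x = y].

Definition rm_fiber (f : rational_map) (y : projspace R N)
    : set (projspace R n) :=
  [set x | rm_value f x y].

Definition rm_image (f : rational_map) (C : set (projspace R n))
    : set (projspace R N) :=
  zclosure [set y | exists2 x, C x & rm_value f x y].

Definition dominant_onto (f : rational_map) (Y : set (projspace R N)) : Prop :=
  rm_image f setT = Y.

(* Only the general fibre of f on X^0 is required to be connected.  For Y     *)
(* normal this is equivalent to the connectedness of every fibre of the       *)
(* closure of the graph of f over Y.  Special fibres on X^0 may be            *)
(* disconnected by the removal of points of indeterminacy.                    *)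
Definition connected_fibers (f : rational_map)
    (Y : set (projspace R N)) : Prop :=
  generally Y (fun y => connected (rm_fiber f y)).

(* Nonemptiness excludes points of Y that are not values of f. *)
Definition almost_holomorphic (f : rational_map) : Prop :=
  exists y, rm_fiber f y !=set0 /\ compact (rm_fiber f y).

End RationalMap.

Section IntersectionNumber.
Variable R : realType.

Local Notation vec := 'rV[R[i]^o]_3.
Local Notation P2 := (projspace R 2).

Definition abs2 (z : R[i]) : R := complex.Re z ^+ 2 + complex.Im z ^+ 2.

(* Sections of O(k) over the open set U of P^2: holomorphic functions on the  *)
(* cone over U that are homogeneous of degree k.                              *)
Definition O_section (k : nat) (U : set P2) (g : vec -> R[i]^o) : Prop :=
  [/\ open U,
      forall v, cone U v -> differentiable g v &
      forall v (a : R[i]), cone U v -> a != 0 -> g (a *: v) = a ^+ k * g v].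

(* Germs are represented by functions and compared near x. *)
Definition O_germ (k : nat) (x : P2) (g : vec -> R[i]^o) : Prop :=
  exists2 U, U x & O_section k U g.

(* The affine chart z_i = 1, with C^2 identified with R^4. *)
Definition chart (i : 'I_3) (w : (R * R) * (R * R)) : vec :=
  \row_j match unlift i j with
         | None => 1
         | Some k => if k == 0 :> 'I_2 then (w.1.1 +i* w.1.2)%C
                     else (w.2.1 +i* w.2.2)%C
         end.

Definition leb4 :=
  ((@lebesgue_measure R \x @lebesgue_measure R) \x
   (@lebesgue_measure R \x @lebesgue_measure R))%E.

(* A singular metric h on O(1) is given by its weight phi in homogeneous      *)
(* coordinates: the weight in the trivialization z_i is phi on z_i = 1.       *)
Variable phi : vec -> \bar R.

Definition locally_L2 (m : nat) (x : P2) (g : vec -> R[i]^o) : Prop :=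
  forall i : 'I_3, hcoord x 0 i != 0 ->
  exists U : set P2, [/\ open U, U x &
    (\int[leb4]_(w in chart i @^-1` cone U)
       ((abs2 (g (chart i w)))%:E *
        expeR (- (2 * m)%:R%:E * phi (chart i w))) < +oo)%E].

(* OI_section and OI_germ: sections over U and germs at x of O(m) (x) I(h^m). *)
Definition OI_section (m : nat) (U : set P2) (g : vec -> R[i]^o) : Prop :=
  O_section m U g /\ forall x, U x -> locally_L2 m x g.

Definition OI_germ (m : nat) (x : P2) (g : vec -> R[i]^o) : Prop :=
  exists2 U, U x & OI_section m U g.

Variable C : set P2.

Definition ideal_germ (x : P2) (u : vec -> R[i]^o) : Prop :=
  O_germ 0 x u /\
  exists U : set P2, [/\ open U, U x & forall v, cone (U `&` C) v -> u v = 0].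

(* The stalk at x of O_C(m) (x) I(h^m) is M (x) (O_x / J) = M / JM, with M    *)
(* the module of OI_germs and J the ideal of C; this is the submodule JM.     *)
Definition ideal_OI_germ (m : nat) (x : P2) (g : vec -> R[i]^o) : Prop :=
  exists (k : nat) (u s : 'I_k -> vec -> R[i]^o),
    (forall j, ideal_germ x (u j) /\ OI_germ m x (s j)) /\
    exists U : set P2, [/\ open U, U x &
      forall v, cone U v -> g v = \sum_(j < k) u j v * s j v].

Definition nonzerodivisor_germ (x : P2) (a : vec -> R[i]^o) : Prop :=
  O_germ 0 x a /\
  forall b, O_germ 0 x b -> ideal_germ x (fun v => a v * b v) -> ideal_germ x b.

(* The class of g in M / JM is a torsion element over O_{C,x}. *)
Definition torsion_germ (m : nat) (x : P2) (g : vec -> R[i]^o) : Prop :=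
  OI_germ m x g /\
  exists a, nonzerodivisor_germ x a /\ ideal_OI_germ m x (fun v => a v * g v).

(* Global sections over C of (O_C(m) (x) I(h^m)) / tor, as families of germs  *)
(* that are locally induced by sections of O(m) (x) I(h^m).  Two families     *)
(* define the same section iff they differ by torsion germs.                  *)
Definition global_section (m : nat) (s : P2 -> vec -> R[i]^o) : Prop :=
  forall x, C x -> exists U g, [/\ U x, OI_section m U g &
    forall y, U y -> C y -> torsion_germ m y (fun v => s y v - g v)].

Definition zero_section (m : nat) (s : P2 -> vec -> R[i]^o) : Prop :=
  forall x, C x -> torsion_germ m x (s x).

(* The dimension of the space of global sections, that is, of families in     *)
(* global_section modulo those in zero_section.                               *)
Definition h0 (m : nat) : \bar R :=
  ereal_sup [set (k%:R)%:E | k in [set k : nat |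
    exists s : 'I_k -> P2 -> vec -> R[i]^o,
      (forall j, global_section m (s j)) /\
      forall c : 'I_k -> R[i],
        zero_section m (fun x v => \sum_(j < k) c j * s j x v) ->
        forall j, c j = 0]].

(* (O(1), h).C; the term for m = 0 is irrelevant. *)
Definition intersection_number : \bar R :=
  limn_esup (fun m => h0 m * (m%:R^-1)%:E)%E.

End IntersectionNumber.

(* The weight (1/2) log (|z_1|^2 + |z_2|^2), equal to -oo at (1 : 0 : 0). *)
Definition lines_weight (R : realType) (z : 'rV[R[i]^o]_3) : \bar R :=
  ((2^-1)%:E * lne (abs2 (z 0 1) + abs2 (z 0 2))%:E)%E.

(* Main.v *)
(* Let p = (1:0:0).  On a line l through p, parametrized by t with p at t = 0,
   a section of O(m) (x) I(h^m) has finite weighted L^2 norm near p, so by the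
   mean value inequality it is O(|t|^(m-2)) on l, while it is O(|t|^m) at
   infinity.  Dividing by t^(m-3) and applying Liouville's theorem shows that
   four values determine the section on l.  Hence h^0 <= 4 and (L,h).l = 0.
   The line z_0 = 0 avoids p, its monomials z_1^j z_2^(m-j) are sections, and
   its intersection number is at least 1.

   By (c) f is therefore constant on the very general line through p, and thus
   on every line through p as far as it is defined, because the minors of
   (f(v), f(v + l e_0)) are polynomials that vanish at very general v.  So the
   fibers of f are unions of lines through p off p, and a nonempty compact fiber
   contains p.  Then f is holomorphic at p and takes the same value on all lines
   through p, so f is constant and (b) applies to the line z_0 = 0. *)

From HB Require Import structures.
Require Import Defs.
From mathcomp Require Import -(notations) mpoly.
From mathcomp Require Import all_boot all_order all_algebra complex.
From mathcomp Require Import all_classical all_reals all_analysis.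
From mathcomp Require Import measurable_realfun generic_quotient ring lra.

Set Implicit Arguments.
Unset Strict Implicit.
Unset Printing Implicit Defensive.
Import Order.TTheory GRing.Theory Num.Theory.
Import numFieldNormedType.Exports.

Local Open Scope classical_set_scope.
Local Open Scope ring_scope.

(** * Green's theorem and Cauchy estimates *)

(** The mean value inequality rests on Green's theorem for forms that are continuous everywhere and
    closed off finitely many points. Divided differences of holomorphic functions are thus usable
    without removing their singularities, and the integral of dz / (z - c) is never computed: a
    lower bound for its contribution on each side of a rectangle suffices. The price is a list of
    exceptional points carried through the Liouville argument. The exponents follow. A polydisc of
    radius |t| in C^2 has volume of order |t|^4, hence the loss of 2 in O(|t|^(m-2)). Division by
    t^(m-2) would only give a bounded function near 0; division by t^(m-3) gives one that tends to 0
    and is therefore continuous. It grows like |t|^3, so four zeros must be divided out before it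
    decays like 1 / |t|. On the algebraic side, the translation v -> v + l e_0 is not homogeneous
    and does not act on the plane. The invariance of the fibers is obtained for the linear maps v ->
    v + l v_i e_0, which move points along the lines through p. *)

Section Bisection.
Variable R : realType.
Implicit Types (x y d : R).

Definition mid x y : R := (x + y) / 2.

(** Goursat's nested rectangles: a bad rectangle has a bad quarter, and the quarters shrink to a
    point at which the local hypothesis fails. All quarters keep the proportions of the initial
    rectangle, which is why the local hypothesis may assume them. *)
Lemma bisection_principle (good : R -> R -> R -> R -> Prop) (a b c d : R) :
  a < b -> c < d ->
  (forall x1 x2 y1 y2, x1 < x2 -> y1 < y2 ->
     a <= x1 -> x2 <= b -> c <= y1 -> y2 <= d ->
     good x1 (mid x1 x2) y1 (mid y1 y2) -> good (mid x1 x2) x2 y1 (mid y1 y2) ->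
     good x1 (mid x1 x2) (mid y1 y2) y2 -> good (mid x1 x2) x2 (mid y1 y2) y2 ->
     good x1 x2 y1 y2) ->
  (forall x y, a <= x <= b -> c <= y <= d -> exists2 e, 0 < e &
     forall x1 x2 y1 y2, x1 < x2 -> y1 < y2 ->
     a <= x1 -> x2 <= b -> c <= y1 -> y2 <= d ->
     (x2 - x1) * (d - c) = (y2 - y1) * (b - a) ->
     x1 <= x <= x2 -> y1 <= y <= y2 -> x2 - x1 < e -> y2 - y1 < e ->
     good x1 x2 y1 y2) ->
  good a b c d.
Proof.
move=> ab cd glue loc; apply: contrapT => bad0.
pose bad (r : R * R * (R * R)) := ~ good r.1.1 r.1.2 r.2.1 r.2.2.
pose sub (n : nat) (r : R * R * (R * R)) :=
  [/\ r.1.2 - r.1.1 = (b - a) / 2 ^+ n, r.2.2 - r.2.1 = (d - c) / 2 ^+ n &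
      [/\ a <= r.1.1, r.1.2 <= b, c <= r.2.1 & r.2.2 <= d]].
pose inc (r r' : R * R * (R * R)) :=
  [/\ r.1.1 <= r'.1.1, r'.1.2 <= r.1.2, r.2.1 <= r'.2.1 & r'.2.2 <= r.2.2].
have pos2 n : 0 < (2 : R) ^+ n by rewrite exprn_gt0.
have step n r : sub n r -> bad r -> exists r', [/\ sub n.+1 r', bad r' & inc r r'].
  case: r => [[x1 x2] [y1 y2]] [/= sx sy [ax xb cy yd]] br.
  have lx : x1 < x2 by rewrite -subr_gt0 sx divr_gt0// subr_gt0.
  have ly : y1 < y2 by rewrite -subr_gt0 sy divr_gt0// subr_gt0.
  apply: contrapT => nex; apply: br => /=.
  have half (u v w : R) : v - u = w / 2 ^+ n ->
     (mid u v - u = w / 2 ^+ n.+1) * (v - mid u v = w / 2 ^+ n.+1).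
    move=> uv.
    have -> : w / 2 ^+ n.+1 = (v - u) / 2.
      by rewrite uv exprSr invfM mulrA.
    by split; rewrite /mid; lra.
  have [hx1 hx2] := half _ _ _ sx; have [hy1 hy2] := half _ _ _ sy.
  have [mx1 mx2] : x1 < mid x1 x2 /\ mid x1 x2 < x2 by rewrite /mid; split; lra.
  have [my1 my2] : y1 < mid y1 y2 /\ mid y1 y2 < y2 by rewrite /mid; split; lra.
  apply: glue => //; apply: contrapT => bq; apply: nex.
  - exists ((x1, mid x1 x2), (y1, mid y1 y2)); split => //; split => //=; try lra.
    by split; lra.
  - exists ((mid x1 x2, x2), (y1, mid y1 y2)); split => //; split => //=; try lra.
    by split; lra.
  - exists ((x1, mid x1 x2), (mid y1 y2, y2)); split => //; split => //=; try lra.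
    by split; lra.
  - exists ((mid x1 x2, x2), (mid y1 y2, y2)); split => //; split => //=; try lra.
    by split; lra.
(* The depth is stored with the rectangle, so that the choice of a bad quarter becomes a function on
   [T]. *)
pose T := {nr : nat * (R * R * (R * R)) | sub nr.1 nr.2 /\ bad nr.2}.
have stepT (t : T) : {t' : T | (sval t').1 = (sval t).1.+1 /\ inc (sval t).2 (sval t').2}.
  apply: cid; case: t => -[n r] /= [sr br].
  by have [r' [sr' br' irr]] := step _ _ sr br; exists (exist _ (n.+1, r') (conj sr' br')).
have t0 : T.
  exists (0%N, ((a, b), (c, d))); split => //=.
  by split; rewrite ?expr0 ?divr1.
pose sq := fix sq n := if n is n'.+1 then sval (stepT (sq n')) else t0.
pose ri n := (sval (sq n)).2.
have sqn n : (sval (sq n)).1 = ((sval (sq 0%N)).1 + n)%N.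
  elim: n => [|n IH]; first by rewrite addn0.
  by rewrite /=; case: (svalP (stepT (sq n))) => -> _; rewrite IH addnS.
(* [t0] is opaque, so its depth [k0] is carried along; only [n <= k0 + n] matters. *)
set k0 := (sval (sq 0%N)).1 in sqn.
have subn n : sub (k0 + n)%N (ri n).
  by rewrite -sqn /ri; case: (svalP (sq n)).
have badn n : bad (ri n) by rewrite /ri; case: (svalP (sq n)).
have incn n : inc (ri n) (ri n.+1) by rewrite /ri /=; case: (svalP (stepT (sq n))).
have incnk n k : inc (ri n) (ri (n + k)%N).
  elim: k => [|k IH]; first by rewrite addn0; split.
  rewrite addnS; case: (incn (n + k)%N) => ? ? ? ?; case: IH => ? ? ? ?.
  by split; apply: le_trans; eassumption.
have ltx n : (ri n).1.1 < (ri n).1.2.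
  by case: (subn n) => s _ _; rewrite -subr_gt0 s divr_gt0// subr_gt0.
have lty n : (ri n).2.1 < (ri n).2.2.
  by case: (subn n) => _ s _; rewrite -subr_gt0 s divr_gt0// subr_gt0.
have crossx n k : (ri n).1.1 <= (ri k).1.2.
  case/orP: (leq_total n k) => /subnKC nk.
    by have := incnk n (k - n)%N; rewrite nk => -[h _ _ _]; rewrite (le_trans h)// ltW.
  by have := incnk k (n - k)%N; rewrite nk => -[_ h _ _]; rewrite (le_trans _ h)// ltW.
have crossy n k : (ri n).2.1 <= (ri k).2.2.
  case/orP: (leq_total n k) => /subnKC nk.
    by have := incnk n (k - n)%N; rewrite nk => -[_ _ h _]; rewrite (le_trans h)// ltW.
  by have := incnk k (n - k)%N; rewrite nk => -[_ _ _ h]; rewrite (le_trans _ h)// ltW.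
(* Nested intervals: the supremum of the left ends lies below every right end. *)
have key (u v : nat -> R) : (forall n k, u n <= v k) ->
    exists x, forall n, u n <= x <= v n.
  move=> uv; exists (sup (range u)) => n.
  have hs : has_sup (range u).
    by split; [exists (u 0%N), 0%N|exists (v 0%N) => _ [k _ <-]].
  rewrite (ub_le_sup hs.2) /=; last by exists n.
  by apply: ge_sup; [exact: hs.1|move=> _ [k _ <-]].
have [x xP] := key _ _ crossx; have [y yP] := key _ _ crossy.
have [||e e0 eP] := loc x y.
- have /andP[h1 h2] := xP 0%N; case: (subn 0%N) => _ _ [? ? ? ?].
  by rewrite (le_trans _ h1)//= (le_trans h2).
- have /andP[h1 h2] := yP 0%N; case: (subn 0%N) => _ _ [? ? ? ?].
  by rewrite (le_trans _ h1)//= (le_trans h2).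
have small w : 0 < w -> exists n0, forall n, (n0 <= n)%N -> w / 2 ^+ n < e.
  move=> w0; exists (Num.bound (w / e)) => n n0n.
  rewrite ltr_pdivrMr// mulrC -ltr_pdivrMr//.
  apply: (lt_le_trans (archi_boundP _)); first by rewrite divr_ge0// ltW.
  by rewrite -natrX ler_nat (leq_trans n0n)// ltnW// ltn_expl.
have [n1 h1] := small (b - a) ltac:(by rewrite subr_gt0).
have [n2 h2] := small (d - c) ltac:(by rewrite subr_gt0).
pose n := maxn n1 n2.
apply: (badn n); case: (subn n) => sx sy [? ? ? ?].
apply: eP => //; rewrite ?sx ?sy.
- by rewrite mulrAC [RHS]mulrAC; congr (_ / _); exact: mulrC.
- by apply: h1; rewrite (leq_trans (leq_maxl n1 n2))// leq_addl.
- by apply: h2; rewrite (leq_trans (leq_maxr n1 n2))// leq_addl.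
Qed.

End Bisection.

Section Green.
Variable R : realType.
Implicit Types (x y d e : R).
Local Notation mu := (@lebesgue_measure R).

Definition segint (h : R -> R) (a b : R) : R := \int[mu]_(x in `[a, b]) h x.

(** Continuity at the ends is two-sided, as for the slices of a function that is continuous in the
    plane at each point of a closed rectangle. *)
Definition cont_on (h : R -> R) (a b : R) : Prop :=
  forall x, a <= x <= b -> {for x, continuous h}.

Lemma cont_on_integrable h a b : cont_on h a b ->
  mu.-integrable `[a, b] (EFin \o h).
Proof.
move=> ch; apply: continuous_compact_integrable; first exact: segment_compact.
apply: continuous_in_subspaceT => x; rewrite inE /= in_itv /= => xab.
exact: ch.
Qed.

Lemma segint_split h a b c : cont_on h a b -> a <= c <= b ->
  segint h a b = segint h a c + segint h c b.
Proof.
move=> ch /andP[ac cb]; have ih := cont_on_integrable ch.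
rewrite /segint; have := @Rintegral_itvB R h (BLeft a) (BRight b) c ih.
rewrite !bnd_simp => /(_ ac cb) /eqP; rewrite subr_eq addrC => /eqP ->.
congr (_ + _); rewrite Rintegral_itv_obnd_cbnd//.
apply: integrableS ih => //; move=> x /=; rewrite !in_itv /= => /andP[cx ->].
by rewrite (le_trans ac)// ltW.
Qed.

Lemma segint_cst a b r : a <= b -> segint (fun=> r) a b = r * (b - a).
Proof.
move=> ab; rewrite /segint Rintegral_cst//= lebesgue_measure_itv/= lte_fin.
case: ltgtP ab => //= -> _; by rewrite subrr.
Qed.

Lemma cont_on_cst a b r : cont_on (fun=> r) a b.
Proof. by move=> x _; exact: cvg_cst. Qed.

Lemma cont_onB h1 h2 a b : cont_on h1 a b -> cont_on h2 a b ->
  cont_on (fun x => h1 x - h2 x) a b.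
Proof. by move=> c1 c2 x xab; apply: continuousB; [exact: c1|exact: c2]. Qed.

Lemma segintB h1 h2 a b : cont_on h1 a b -> cont_on h2 a b ->
  segint (fun x => h1 x - h2 x) a b = segint h1 a b - segint h2 a b.
Proof. by move=> c1 c2; rewrite /segint RintegralB//; exact: cont_on_integrable. Qed.

Lemma le_segint h1 h2 a b : cont_on h1 a b -> cont_on h2 a b ->
  (forall x, a <= x <= b -> h1 x <= h2 x) -> segint h1 a b <= segint h2 a b.
Proof.
move=> c1 c2 h12; apply: le_Rintegral => //; exact: cont_on_integrable.
Qed.

Lemma segint_diff_bound h1 h2 a b c e : a <= b -> cont_on h1 a b ->
  cont_on h2 a b -> (forall x, a <= x <= b -> `|h1 x - h2 x - c| <= e) ->
  `|segint h1 a b - segint h2 a b - c * (b - a)| <= e * (b - a).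
Proof.
move=> ab c1 c2 h12; have cc := cont_onB c1 c2.
rewrite -(segint_cst c ab) -(segint_cst e ab) -segintB// -segintB//;
  last exact: cont_on_cst.
apply: (le_trans (le_normr_Rintegral _ _)) => //=.
  by apply: cont_on_integrable; apply: cont_onB => //; exact: cont_on_cst.
apply: (@le_segint (fun x => `|h1 x - h2 x - c|)) => //; last exact: cont_on_cst.
move=> x xab; apply: (@continuous_comp _ _ _ (fun x => h1 x - h2 x - c) Num.norm).
  by apply: cont_onB xab => //; exact: cont_on_cst.
exact: norm_continuous.
Qed.

Lemma le_sqrtD (u v : R) : 0 <= u -> 0 <= v ->
  Num.sqrt (u + v) <= Num.sqrt u + Num.sqrt v.
Proof.
move=> u0 v0.
rewrite -(@ler_pXn2r _ 2)// ?nnegrE ?addr_ge0 ?sqrtr_ge0//.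
rewrite sqr_sqrtr ?addr_ge0// sqrrD !sqr_sqrtr// addrAC lerDl.
by rewrite mulrn_wge0// mulr_ge0 ?sqrtr_ge0.
Qed.

(** Increasing, with a vertical tangent at 0: an increment across 0 is at least the square root of
    the length of the step. *)
Definition signed_sqrt (t : R) : R :=
  if 0 <= t then Num.sqrt t else - Num.sqrt (- t).

Lemma signed_sqrt_homo : {homo signed_sqrt : u v / u <= v}.
Proof.
move=> u v uv; rewrite /signed_sqrt; case: ifPn => u0; case: ifPn => v0.
- exact: ler_wsqrtr.
- by move: v0; rewrite (le_trans u0 uv).
- by rewrite (@le_trans _ _ 0) ?oppr_le0 ?sqrtr_ge0.
- by rewrite lerN2 ler_wsqrtr// lerN2.
Qed.

Lemma signed_sqrt_jump (u v : R) : u <= 0 <= v ->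
  Num.sqrt (v - u) <= signed_sqrt v - signed_sqrt u.
Proof.
move=> /andP[u0 v0]; rewrite /signed_sqrt v0.
have [u0'|u0'] := leP 0 u.
  by have -> : u = 0 by [apply/eqP; rewrite eq_le u0 u0']; rewrite !subr0 sqrtr0 subr0.
by rewrite opprK le_sqrtD// oppr_ge0.
Qed.

(* Where the form is only continuous, its integral along the boundary of a    *)
(* square of side l is o(l); the increment sqrt l at the points of s is chosen *)
(* so that the product of two increments dominates this.                      *)
Definition jump_fun (s : seq R) (x : R) : R := x + \sum_(p <- s) signed_sqrt (x - p).

Lemma jump_fun_incr s x1 x2 : x1 <= x2 -> x2 - x1 <= jump_fun s x2 - jump_fun s x1.
Proof.
move=> x12; rewrite /jump_fun opprD addrACA lerDl -sumrB sumr_ge0// => p _.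
by rewrite subr_ge0 signed_sqrt_homo// lerB.
Qed.

Lemma jump_fun_jump s x1 x2 p : x1 <= x2 -> p \in s -> x1 <= p <= x2 ->
  Num.sqrt (x2 - x1) <= jump_fun s x2 - jump_fun s x1.
Proof.
move=> x12 ps /andP[xp px]; rewrite /jump_fun opprD addrACA -sumrB.
rewrite (big_rem p)//= addrCA; apply: (@le_trans _ _ (signed_sqrt (x2 - p) - signed_sqrt (x1 - p))).
  have -> : x2 - x1 = x2 - p - (x1 - p) by ring.
  by apply: signed_sqrt_jump; rewrite subr_le0 subr_ge0 xp.
rewrite lerDl addr_ge0 ?subr_ge0// sumr_ge0// => q _.
by rewrite subr_ge0 signed_sqrt_homo// lerB.
Qed.

Lemma dist_le x1 x2 x x' : x1 <= x <= x2 -> x1 <= x' <= x2 -> `|x' - x| <= x2 - x1.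
Proof.
by move=> /andP[? ?] /andP[? ?]; rewrite ler_norml; apply/andP; split; lra.
Qed.

Definition cont2 (P : R -> R -> R) x y : Prop :=
  forall e, 0 < e -> exists2 d : R, 0 < d & forall x' y',
    `|x' - x| < d -> `|y' - y| < d -> `|P x' y' - P x y| <= e.

(* dP = p dx + q dy at (x, y) *)
Definition diff2 (P : R -> R -> R) x y (p q : R) : Prop :=
  forall e, 0 < e -> exists2 d : R, 0 < d & forall x' y',
    `|x' - x| < d -> `|y' - y| < d ->
    `|P x' y' - P x y - (p * (x' - x) + q * (y' - y))| <=
      e * (`|x' - x| + `|y' - y|).

Lemma cont2_slicex P x y : cont2 P x y -> {for x, continuous (P^~ y)}.
Proof.
move=> cP; apply/cvgrPdist_le => e e0; have [d d0 dP] := cP e e0.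
near=> t; rewrite distrC; apply: dP; last by rewrite subrr normr0.
rewrite distrC; near: t; exact: cvgr_dist_lt.
Unshelve. all: by end_near. Qed.

Lemma cont2_slicey P x y : cont2 P x y -> {for y, continuous (P x)}.
Proof.
move=> cP; apply/cvgrPdist_le => e e0; have [d d0 dP] := cP e e0.
near=> t; rewrite distrC; apply: dP; first by rewrite subrr normr0.
rewrite distrC; near: t; exact: cvgr_dist_lt.
Unshelve. all: by end_near. Qed.

(** The integral of P dx + Q dy along the boundary, counterclockwise. *)
Definition circulation (P Q : R -> R -> R) (x1 x2 y1 y2 : R) : R :=
  segint (P^~ y1) x1 x2 - segint (P^~ y2) x1 x2 +
  (segint (Q x2) y1 y2 - segint (Q x1) y1 y2).

Variables (P Q : R -> R -> R) (a b c d : R) (S : seq (R * R)).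
Hypotheses (ab : a < b) (cd : c < d).
Hypothesis contP : forall x y, a <= x <= b -> c <= y <= d -> cont2 P x y.
Hypothesis contQ : forall x y, a <= x <= b -> c <= y <= d -> cont2 Q x y.
(** The coefficient [q] shared by the two differentials expresses P_y = Q_x. As in Goursat's
    theorem, the derivatives are not assumed continuous. *)
Hypothesis closed_form : forall x y, a <= x <= b -> c <= y <= d ->
  (x, y) \notin S -> exists p q r, diff2 P x y p q /\ diff2 Q x y q r.

Let contx (F : R -> R -> R) (cF : forall x y, a <= x <= b -> c <= y <= d -> cont2 F x y) x1 x2 y :
  a <= x1 -> x2 <= b -> c <= y <= d -> cont_on (F^~ y) x1 x2.
Proof.
move=> ax xb ycd x /andP[h1 h2]; apply: cont2_slicex; apply: cF => //.
by rewrite (le_trans ax)// (le_trans h2).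
Qed.

Let conty (F : R -> R -> R) (cF : forall x y, a <= x <= b -> c <= y <= d -> cont2 F x y) y1 y2 x :
  c <= y1 -> y2 <= d -> a <= x <= b -> cont_on (F x) y1 y2.
Proof.
move=> ax xb ycd y /andP[h1 h2]; apply: cont2_slicey; apply: cF => //.
by rewrite (le_trans ax)// (le_trans h2).
Qed.

(** A product of increments, hence additive under subdivision. It is at least the Euclidean area,
    and much larger on small rectangles around the points of [S]. *)
Let area (x1 x2 y1 y2 : R) : R :=
  (jump_fun (map fst S) x2 - jump_fun (map fst S) x1) *
  (jump_fun (map snd S) y2 - jump_fun (map snd S) y1).

(** The quotient (u + v)^2 / (u v) is scale invariant, so it has this value for every rectangle with
    the proportions of the initial one. *)
Let ratio := (b - a + (d - c)) ^+ 2 / ((b - a) * (d - c)).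

Let ratio_gt0 : 0 < ratio.
Proof.
have ba : 0 < b - a by rewrite subr_gt0.
have dc : 0 < d - c by rewrite subr_gt0.
by apply: divr_gt0; [apply: exprn_gt0; exact: addr_gt0|exact: mulr_gt0].
Qed.

Let shape (u v : R) : 0 < u -> 0 < v -> u * (d - c) = v * (b - a) ->
  (u + v) ^+ 2 = ratio * (u * v).
Proof.
move=> u0 v0 e; have ba : 0 < b - a by rewrite subr_gt0.
have dc : 0 < d - c by rewrite subr_gt0.
have -> : u = v * (b - a) / (d - c) by rewrite -e mulfK// gt_eqF.
by rewrite /ratio; field; rewrite !gt_eqF.
Qed.

Let small_regular x y e : a <= x <= b -> c <= y <= d -> 0 < e ->
  (x, y) \notin S -> exists2 g : R, 0 < g &
     forall x1 x2 y1 y2, x1 < x2 -> y1 < y2 ->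
     a <= x1 -> x2 <= b -> c <= y1 -> y2 <= d ->
     (x2 - x1) * (d - c) = (y2 - y1) * (b - a) ->
     x1 <= x <= x2 -> y1 <= y <= y2 -> x2 - x1 < g -> y2 - y1 < g ->
     `|circulation P Q x1 x2 y1 y2| <= e * area x1 x2 y1 y2.
Proof.
move=> xab ycd e0 nS; have [p [q [r [dP dQ]]]] := closed_form xab ycd nS.
(* The affine parts of P and Q contribute -q u v and q u v, which cancel. The remainders contribute
   at most 2 e' (u + v)^2 = e u v. *)
pose e' := e / (2 * ratio).
have e'0 : 0 < e' by rewrite /e' divr_gt0// mulr_gt0.
have [g1 g10 h1] := dP e' e'0; have [g2 g20 h2] := dQ e' e'0.
exists (Num.min g1 g2); first by rewrite lt_min g10.
move=> x1 x2 y1 y2 x12 y12 ax xb cy yd sh xx yy.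
rewrite !lt_min => /andP[sx1 sx2] /andP[sy1 sy2].
set u := x2 - x1; set v := y2 - y1.
have u0 : 0 < u by rewrite subr_gt0.
have v0 : 0 < v by rewrite subr_gt0.
have H (F : R -> R -> R) (s t g : R) : (forall x' y', `|x' - x| < g -> `|y' - y| < g ->
    `|F x' y' - F x y - (s * (x' - x) + t * (y' - y))| <=
      e' * (`|x' - x| + `|y' - y|)) -> u < g -> v < g ->
   forall x' y', x1 <= x' <= x2 -> y1 <= y' <= y2 ->
    `|F x' y' - F x y - (s * (x' - x) + t * (y' - y))| <= e' * (u + v).
  move=> hF ug vg x' y' x'm y'm.
  have hx : `|x' - x| <= u by exact: dist_le.
  have hy : `|y' - y| <= v by exact: dist_le.
  apply: (le_trans (hF _ _ _ _)); rewrite ?(le_lt_trans hx)// ?(le_lt_trans hy)//.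
  by rewrite ler_pM2l// lerD.
have {}h1 := H _ _ _ _ h1 sx1 sy1; have {}h2 := H _ _ _ _ h2 sx2 sy2.
have y1m : y1 <= y1 <= y2 by rewrite lexx ltW.
have y2m : y1 <= y2 <= y2 by rewrite lexx ltW.
have x1m : x1 <= x1 <= x2 by rewrite lexx ltW.
have x2m : x1 <= x2 <= x2 by rewrite lexx ltW.
have y1d : c <= y1 <= d by rewrite cy (le_trans _ yd)// ltW.
have y2d : c <= y2 <= d by rewrite yd andbT (le_trans cy)// ltW.
have x1b : a <= x1 <= b by rewrite ax (le_trans _ xb)// ltW.
have x2b : a <= x2 <= b by rewrite xb andbT (le_trans ax)// ltW.
have IP : `|segint (P^~ y1) x1 x2 - segint (P^~ y2) x1 x2 - (- q * v) * u| <=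
   (2 * (e' * (u + v))) * u.
  apply: segint_diff_bound; [exact: ltW|exact: contx|exact: contx|].
  move=> x' x'm; have k1 := h1 _ _ x'm y1m; have k2 := h1 _ _ x'm y2m.
  have -> : P x' y1 - P x' y2 - - q * v =
    (P x' y1 - P x y - (p * (x' - x) + q * (y1 - y))) -
    (P x' y2 - P x y - (p * (x' - x) + q * (y2 - y))) by rewrite /v; ring.
  by rewrite (le_trans (ler_normB _ _))// mulr2n mulrDl mul1r lerD.
have IQ : `|segint (Q x2) y1 y2 - segint (Q x1) y1 y2 - (q * u) * v| <=
   (2 * (e' * (u + v))) * v.
  apply: segint_diff_bound; [exact: ltW|exact: conty|exact: conty|].
  move=> y' y'm; have k1 := h2 _ _ x1m y'm; have k2 := h2 _ _ x2m y'm.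
  have -> : Q x2 y' - Q x1 y' - q * u =
    (Q x2 y' - Q x y - (q * (x2 - x) + r * (y' - y))) -
    (Q x1 y' - Q x y - (q * (x1 - x) + r * (y' - y))) by rewrite /u; ring.
  by rewrite (le_trans (ler_normB _ _))// mulr2n mulrDl mul1r lerD.
apply: (@le_trans _ _ (2 * (e' * (u + v)) * u + 2 * (e' * (u + v)) * v)).
  rewrite /circulation; apply: le_trans (lerD IP IQ).
  apply: le_trans (ler_normD _ _).
  by rewrite le_eqVlt; apply/orP; left; apply/eqP; congr `|_|; ring.
have -> : 2 * (e' * (u + v)) * u + 2 * (e' * (u + v)) * v = 2 * e' * (u + v) ^+ 2.
  by ring.
rewrite shape// /e'.
have -> : 2 * (e / (2 * ratio)) * (ratio * (u * v)) = e * (u * v).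
  by field; rewrite gt_eqF.
rewrite ler_pM2l// /area ler_pM//; try exact: ltW.
  by apply: jump_fun_incr; exact: ltW.
by apply: jump_fun_incr; exact: ltW.
Qed.

Let small_singular x y e : a <= x <= b -> c <= y <= d -> 0 < e ->
  (x, y) \in S -> exists2 g : R, 0 < g &
     forall x1 x2 y1 y2, x1 < x2 -> y1 < y2 ->
     a <= x1 -> x2 <= b -> c <= y1 -> y2 <= d ->
     (x2 - x1) * (d - c) = (y2 - y1) * (b - a) ->
     x1 <= x <= x2 -> y1 <= y <= y2 -> x2 - x1 < g -> y2 - y1 < g ->
     `|circulation P Q x1 x2 y1 y2| <= e * area x1 x2 y1 y2.
Proof.
(* Continuity bounds the circulation by 2 e' (u + v). Here u + v is the product of the square roots
   of [ratio], u and v, and the last two are bounded by the increments of the jump functions. *)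
move=> xab ycd e0 nS; pose e' := e / (2 * Num.sqrt ratio).
have sr0 : 0 < Num.sqrt ratio by rewrite sqrtr_gt0.
have e'0 : 0 < e' by rewrite /e' divr_gt0// mulr_gt0.
have [g1 g10 h1] := contP xab ycd e'0; have [g2 g20 h2] := contQ xab ycd e'0.
exists (Num.min g1 g2); first by rewrite lt_min g10.
move=> x1 x2 y1 y2 x12 y12 ax xb cy yd sh xx yy.
rewrite !lt_min => /andP[sx1 sx2] /andP[sy1 sy2].
set u := x2 - x1; set v := y2 - y1.
have u0 : 0 < u by rewrite subr_gt0.
have v0 : 0 < v by rewrite subr_gt0.
have H (F : R -> R -> R) (g : R) : (forall x' y', `|x' - x| < g -> `|y' - y| < g ->
    `|F x' y' - F x y| <= e') -> u < g -> v < g ->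
   forall x' y', x1 <= x' <= x2 -> y1 <= y' <= y2 -> `|F x' y' - F x y| <= e'.
  move=> hF ug vg x' y' x'm y'm.
  have hx : `|x' - x| <= u by exact: dist_le.
  have hy : `|y' - y| <= v by exact: dist_le.
  by apply: hF; rewrite ?(le_lt_trans hx)// ?(le_lt_trans hy).
have {}h1 := H _ _ h1 sx1 sy1; have {}h2 := H _ _ h2 sx2 sy2.
have y1m : y1 <= y1 <= y2 by rewrite lexx ltW.
have y2m : y1 <= y2 <= y2 by rewrite lexx ltW.
have x1m : x1 <= x1 <= x2 by rewrite lexx ltW.
have x2m : x1 <= x2 <= x2 by rewrite lexx ltW.
have y1d : c <= y1 <= d by rewrite cy (le_trans _ yd)// ltW.
have y2d : c <= y2 <= d by rewrite yd andbT (le_trans cy)// ltW.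
have x1b : a <= x1 <= b by rewrite ax (le_trans _ xb)// ltW.
have x2b : a <= x2 <= b by rewrite xb andbT (le_trans ax)// ltW.
have IP : `|segint (P^~ y1) x1 x2 - segint (P^~ y2) x1 x2 - 0 * u| <= (2 * e') * u.
  apply: segint_diff_bound; [exact: ltW|exact: contx|exact: contx|].
  move=> x' x'm; have k1 := h1 _ _ x'm y1m; have k2 := h1 _ _ x'm y2m.
  have -> : P x' y1 - P x' y2 - 0 = (P x' y1 - P x y) - (P x' y2 - P x y) by ring.
  by rewrite (le_trans (ler_normB _ _))// mulr2n mulrDl mul1r lerD.
have IQ : `|segint (Q x2) y1 y2 - segint (Q x1) y1 y2 - 0 * v| <= (2 * e') * v.
  apply: segint_diff_bound; [exact: ltW|exact: conty|exact: conty|].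
  move=> y' y'm; have k1 := h2 _ _ x1m y'm; have k2 := h2 _ _ x2m y'm.
  have -> : Q x2 y' - Q x1 y' - 0 = (Q x2 y' - Q x y) - (Q x1 y' - Q x y) by ring.
  by rewrite (le_trans (ler_normB _ _))// mulr2n mulrDl mul1r lerD.
move: IP IQ; rewrite !mul0r !subr0 => IP IQ.
apply: (@le_trans _ _ (2 * e' * u + 2 * e' * v)).
  by rewrite /circulation (le_trans (ler_normD _ _))// lerD.
rewrite -mulrDr.
have -> : u + v = Num.sqrt ratio * (Num.sqrt u * Num.sqrt v).
  rewrite -sqrtrM ?ltW// -sqrtrM ?ltW// -shape// sqrtr_sqr ger0_norm//.
  by rewrite addr_ge0// ltW.
have -> : 2 * e' * (Num.sqrt ratio * (Num.sqrt u * Num.sqrt v)) =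
   e * (Num.sqrt u * Num.sqrt v).
  by rewrite /e'; field; rewrite gt_eqF.
rewrite ler_pM2l// /area ler_pM ?sqrtr_ge0//.
- by apply: (@jump_fun_jump _ _ _ x) => //; [exact: ltW|exact: (map_f fst nS)].
- by apply: (@jump_fun_jump _ _ _ y) => //; [exact: ltW|exact: (map_f snd nS)].
Qed.

(** It suffices to bound the circulation by e times [area] for every e > 0. Both sides are
    compatible with subdivision, so bisection leaves small rectangles around one point, regular or
    in [S]. *)
Theorem green : circulation P Q a b c d = 0.
Proof.
have key e : 0 < e -> `|circulation P Q a b c d| <= e * area a b c d.
  move=> e0.
  pose good x1 x2 y1 y2 := `|circulation P Q x1 x2 y1 y2| <= e * area x1 x2 y1 y2.
  apply: (@bisection_principle R good) => //.
    move=> x1 x2 y1 y2 x12 y12 ax xb cy yd; rewrite /good.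
    set xm := mid x1 x2; set ym := mid y1 y2.
    have xmP : x1 <= xm <= x2 by rewrite /xm /mid; apply/andP; split; lra.
    have ymP : y1 <= ym <= y2 by rewrite /ym /mid; apply/andP; split; lra.
    have y1d : c <= y1 <= d by rewrite cy (le_trans _ yd)// ltW.
    have y2d : c <= y2 <= d by rewrite yd andbT (le_trans cy)// ltW.
    have x1b : a <= x1 <= b by rewrite ax (le_trans _ xb)// ltW.
    have x2b : a <= x2 <= b by rewrite xb andbT (le_trans ax)// ltW.
    have hx y : c <= y <= d -> segint (P^~ y) x1 x2 =
        segint (P^~ y) x1 xm + segint (P^~ y) xm x2.
      by move=> ?; apply: segint_split => //; exact: contx.
    have hy x : a <= x <= b -> segint (Q x) y1 y2 =
        segint (Q x) y1 ym + segint (Q x) ym y2.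
      by move=> ?; apply: segint_split => //; exact: conty.
    move=> g1 g2 g3 g4; apply: le_trans (_ : e * area x1 xm y1 ym + e * area xm x2 y1 ym +
       e * area x1 xm ym y2 + e * area xm x2 ym y2 <= _); last first.
      by rewrite /area le_eqVlt; apply/orP; left; apply/eqP; ring.
    have := lerD (lerD (lerD g1 g2) g3) g4; apply: le_trans.
    have norm4 (p q r s : R) : `|p + q + r + s| <= `|p| + `|q| + `|r| + `|s|.
      by rewrite (le_trans (ler_normD _ _))// lerD2r (le_trans (ler_normD _ _))// lerD2r ler_normD.
    apply: le_trans (norm4 _ _ _ _).
    rewrite le_eqVlt; apply/orP; left; apply/eqP; congr `|_|.
    by rewrite /circulation (hx y1)// (hx y2)// (hy x1)// (hy x2)//; ring.
  move=> x y xab ycd; have [xyS|xyS] := boolP ((x, y) \in S).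
    exact: small_singular.
  exact: small_regular.
apply/eqP; rewrite -normr_le0; apply/ler_addgt0Pl => e e0; rewrite addr0.
have A0 : 0 <= area a b c d.
  rewrite /area mulr_ge0//.
    by apply: le_trans (jump_fun_incr _ (ltW ab)); rewrite subr_ge0 ltW.
  by apply: le_trans (jump_fun_incr _ (ltW cd)); rewrite subr_ge0 ltW.
apply: (le_trans (key (e / (area a b c d + 1)) _)); first by rewrite divr_gt0// ltr_wpDl.
by rewrite mulrAC ler_pdivrMr ?ltr_wpDl// ler_pM2l// lerDl.
Qed.

End Green.

(** * Real-valued modulus and complex differentiability *)

Section ComplexModulus.
Variable R : realType.
Local Notation C := R[i].
Implicit Types (z w : C).

(** The norm of [R[i]] takes values in [R[i]]; its real part brings estimates into the ordered field
    [R]. *)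
Definition cabs z : R := complex.Re `|z|.

Lemma cabsE z : `|z| = (cabs z)%:C%C.
Proof. by rewrite /cabs normc_def. Qed.

Lemma cabs_ge0 z : 0 <= cabs z.
Proof. by rewrite -ler0c -cabsE. Qed.

Lemma cabs_eq0 z : (cabs z == 0) = (z == 0).
Proof. by rewrite -(normr_eq0 z) cabsE; apply/eqP/eqP => [->//|[]]. Qed.

Lemma cabs0 : cabs (0 : C) = 0. Proof. by apply/eqP; rewrite cabs_eq0. Qed.

Lemma cabs_gt0 z : (0 < cabs z) = (z != 0).
Proof. by rewrite lt_def cabs_ge0 andbT cabs_eq0. Qed.

Lemma cabsM z w : cabs (z * w) = cabs z * cabs w.
Proof. by apply: complexI; rewrite rmorphM/= -!cabsE normrM. Qed.

Lemma cabsV z : cabs z^-1 = (cabs z)^-1.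
Proof. by apply: complexI; rewrite fmorphV/= -!cabsE normfV. Qed.

Lemma cabsX z n : cabs (z ^+ n) = cabs z ^+ n.
Proof. by apply: complexI; rewrite rmorphXn/= -!cabsE normrX. Qed.

Lemma cabsN z : cabs (- z) = cabs z.
Proof. by rewrite /cabs normrN. Qed.

Lemma cabsB z w : cabs (z - w) = cabs (w - z).
Proof. by rewrite /cabs distrC. Qed.

Lemma cabs_real (x : R) : cabs x%:C%C = `|x|.
Proof. by rewrite /cabs normc_def /= expr0n addr0 sqrtr_sqr. Qed.

Lemma cabs1 : cabs (1 : C) = 1.
Proof. by rewrite /cabs normr1. Qed.

Lemma ler_cabsD z w : cabs (z + w) <= cabs z + cabs w.
Proof. by rewrite -lecR rmorphD/= -!cabsE ler_normD. Qed.

Lemma ler_cabsB z w : cabs (z - w) <= cabs z + cabs w.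
Proof. by rewrite (le_trans (ler_cabsD _ _))// cabsN. Qed.

Lemma ler_dist_cabs z w : `|cabs z - cabs w| <= cabs (z - w).
Proof.
rewrite ler_norml lerBlDr lerNl opprB lerBlDr; apply/andP; split.
  by rewrite cabsB (le_trans _ (ler_cabsD _ _))// subrK.
by rewrite (le_trans _ (ler_cabsD _ _))// subrK.
Qed.

Lemma abs2E z : abs2 z = cabs z ^+ 2.
Proof. by rewrite /abs2 /cabs normc_def/= sqr_sqrtr// addr_ge0 ?sqr_ge0. Qed.

Lemma ler_Re_cabs z : `|complex.Re z| <= cabs z.
Proof. by rewrite -sqrtr_sqr /cabs normc_def/= ler_wsqrtr// lerDl sqr_ge0. Qed.

Lemma ler_Im_cabs z : `|complex.Im z| <= cabs z.
Proof. by rewrite -sqrtr_sqr /cabs normc_def/= ler_wsqrtr// lerDr sqr_ge0. Qed.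

Lemma cabs_le_ReIm z : cabs z <= `|complex.Re z| + `|complex.Im z|.
Proof.
rewrite -(@ler_pXn2r _ 2)// ?nnegrE ?addr_ge0 ?cabs_ge0// -abs2E /abs2.
rewrite sqrrD !real_normK ?num_real// addrAC lerDl.
by rewrite mulrn_wge0// mulr_ge0.
Qed.

Lemma ReB z w : complex.Re (z - w) = complex.Re z - complex.Re w.
Proof. by case: z; case: w. Qed.

Lemma ImB z w : complex.Im (z - w) = complex.Im z - complex.Im w.
Proof. by case: z; case: w. Qed.

Lemma ReM z w : complex.Re (z * w) =
  complex.Re z * complex.Re w - complex.Im z * complex.Im w.
Proof. by case: z; case: w. Qed.

Lemma ImM z w : complex.Im (z * w) =
  complex.Re z * complex.Im w + complex.Im z * complex.Re w.
Proof. by case: z; case: w. Qed.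

Definition ccont (f : C -> C) z : Prop := forall e, 0 < e ->
  exists2 d : R, 0 < d & forall w, cabs (w - z) < d -> cabs (f w - f z) <= e.

Definition cdiff (f : C -> C) z (L : C) : Prop := forall e, 0 < e ->
  exists2 d : R, 0 < d & forall w, cabs (w - z) < d ->
    cabs (f w - f z - L * (w - z)) <= e * cabs (w - z).

Definition holo (f : C -> C) z : Prop := differentiable (f : C^o -> C^o) (z : C^o).

Lemma ltc_pos_real (e : C) : 0 < e -> exists2 d : R, 0 < d & e = d%:C%C.
Proof.
by case: e => a b; rewrite ltcE/= => /andP[/eqP -> a0]; exists a.
Qed.

Lemma continuous_ccont (f : C -> C) z :
  {for (z : C^o), continuous (f : C^o -> C^o)} <-> ccont f z.
Proof.
split=> [/cvgrPdist_le cf e e0|cf].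
  have /cf : 0 < (e%:C%C : C) by rewrite ltcR.
  case/nbhs_ballP => d /= /ltc_pos_real[r r0 ->] h; exists r => // w wz.
  rewrite -lecR -cabsE distrC; apply: h; rewrite -ball_normE /=.
  by rewrite distrC cabsE ltcR.
apply/(@cvgrPdist_le C C^o C^o (nbhs (z : C^o)) _ f (f z)) => e /ltc_pos_real[r r0 ->]; have [d d0 h] := cf r r0.
apply/nbhs_ballP; exists (d%:C%C : C) => /=; first by rewrite ltcR.
move=> w; rewrite -ball_normE /= => wz; rewrite distrC cabsE lecR.
by apply: h; rewrite -ltcR -cabsE distrC.
Qed.

Lemma holo_cdiff (f : C -> C) z : holo f z -> exists L, cdiff f z L.
Proof.
move=> df; exists ('D_1 (f : C^o -> C^o) z) => e e0.
have /derivable1_diffP /cvgrPdist_le/(_ (e%:C%C)) := df.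
rewrite ltcR => /(_ e0) /nbhs_ballP [d /= /ltc_pos_real[r r0 ->] h].
exists r => // w wz; have [->|wnz] := eqVneq w z.
  by rewrite !subrr mulr0 subr0 cabs0 mulr0.
have w0 : w - z != 0 by rewrite subr_eq0.
have := h (w - z); rewrite -ball_normE /= sub0r normrN cabsE ltcR => /(_ wz w0).
have -> : (w - z)%:A + (z : C^o) = w by rewrite -[(w - z)%:A]/((w - z) * 1) mulr1 subrK.
rewrite -[(w - z)^-1 *: _]/((w - z)^-1 * (f w - f z)).
set D := (X in X - _); rewrite -[X in `|X|](_ : (D * (w - z) - (f w - f z)) / (w - z) = _); last first.
  by rewrite mulrBl mulfK// [X in _ - X]mulrC.
rewrite cabsE lecR cabsM cabsV ler_pdivrMr ?cabs_gt0//.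
rewrite -opprB cabsN.
by have -> : D = 'D_1 (f : C^o -> C^o) z.
Qed.

Lemma cdiff_ccont f z L : cdiff f z L -> ccont f z.
Proof.
move=> df e e0; have [d d0 h] := df 1 ltr01.
have L0 : 0 < 1 + cabs L by rewrite ltr_pwDl// cabs_ge0.
exists (Num.min d (e / (1 + cabs L))); first by rewrite lt_min d0 divr_gt0.
move=> w; rewrite lt_min => /andP[wd we].
have -> : f w - f z = (f w - f z - L * (w - z)) + L * (w - z) by rewrite subrK.
rewrite (le_trans (ler_cabsD _ _))// cabsM.
apply: le_trans (lerD (h _ wd) (lexx _)) _; rewrite -mulrDl mulrC -ler_pdivlMr//.
exact: ltW.
Qed.

Lemma holo_ccont f z : holo f z -> ccont f z.
Proof. by case/holo_cdiff => L; exact: cdiff_ccont. Qed.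

Lemma holo_near f g z (r : R) : 0 < r -> (forall w, cabs (w - z) < r -> f w = g w) ->
  holo f z -> holo g z.
Proof.
move=> r0 fg /derivable1_diffP df; apply/derivable1_diffP.
apply: near_eq_derivable df.
apply/nbhs_ballP; exists (r%:C%C : C) => /=; first by rewrite ltcR.
by move=> w; rewrite -ball_normE /= => wz; apply: fg; rewrite -ltcR -cabsE distrC.
Qed.

Lemma holoM f g z : holo f z -> holo g z -> holo (fun w => f w * g w) z.
Proof. by move=> hf hg; exact: (@differentiableM C C^o f g). Qed.

Lemma holoB f g z : holo f z -> holo g z -> holo (fun w => f w - g w) z.
Proof. by move=> hf hg; exact: (@differentiableB C C^o C^o f g). Qed.

Lemma holo_cst c z : holo (fun=> c) z.
Proof. exact: differentiable_cst. Qed.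

Lemma holo_id z : holo id z.
Proof. exact: ex_diff. Qed.

Lemma holoX f n z : holo f z -> holo (fun w => f w ^+ n) z.
Proof.
move=> hf; elim: n => [|n IH]; first exact: holo_cst.
by under eq_fun do rewrite exprS; exact: holoM.
Qed.

Lemma holoV f z : f z != 0 -> holo f z -> holo (fun w => (f w)^-1) z.
Proof. by move=> f0 hf; exact: (@differentiableV C C^o f). Qed.

(** The divided difference at [a], completed by [L]. With [L] the derivative it is continuous at
    [a]; differentiability there is not established, so [a] joins the exceptional points. *)
Definition dquot (f : C -> C) (a L : C) (z : C) : C :=
  if z == a then L else (f z - f a) / (z - a).

Lemma dquotE f a L z : (z - a) * dquot f a L z = f z - f a.
Proof.
rewrite /dquot; case: eqVneq => [->|za]; first by rewrite !subrr mul0r.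
by rewrite mulrC divfK// subr_eq0.
Qed.

Lemma dquot_ccont f a L : cdiff f a L -> ccont (dquot f a L) a.
Proof.
move=> df e e0; have [d d0 h] := df e e0; exists d => // w wd.
have [->|wa] := eqVneq w a; first by rewrite subrr cabs0 ltW.
rewrite /dquot eqxx (negbTE wa).
have w0 : w - a != 0 by rewrite subr_eq0.
have -> : (f w - f a) / (w - a) - L = (f w - f a - L * (w - a)) / (w - a).
  by rewrite [RHS]mulrBl mulfK.
by rewrite cabsM cabsV ler_pdivrMr ?cabs_gt0//; exact: h.
Qed.

Lemma dquot_near f a L z : z != a -> forall w, cabs (w - z) < cabs (z - a) ->
  (f w - f a) * (w - a)^-1 = dquot f a L w.
Proof.
move=> za w wz; rewrite /dquot ifF//; apply/eqP => wa.
by move: wz; rewrite wa cabsB ltxx.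
Qed.

Lemma dquot_holo f a L z : z != a -> holo f z -> holo (dquot f a L) z.
Proof.
move=> za hf; apply: (holo_near _ (dquot_near f L za)).
  by rewrite cabs_gt0 subr_eq0.
apply: holoM; first by apply: holoB => //; exact: holo_cst.
apply: holoV; first by rewrite subr_eq0.
by apply: holoB; [exact: holo_id|exact: holo_cst].
Qed.

Lemma ccontM f g z : ccont f z -> ccont g z -> ccont (fun w => f w * g w) z.
Proof.
move=> /continuous_ccont cf /continuous_ccont cg; apply/continuous_ccont.
exact: (@cvgM C C^o (nbhs (z : C^o)) _ f g _ _ cf cg).
Qed.

Lemma ccontB f g z : ccont f z -> ccont g z -> ccont (fun w => f w - g w) z.
Proof.
move=> /continuous_ccont cf /continuous_ccont cg; apply/continuous_ccont.
exact: (@cvgB C C^o C^o (nbhs (z : C^o)) _ f g _ _ cf cg).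
Qed.

Lemma ccont_near f g z (r : R) : 0 < r -> (forall w, cabs (w - z) < r -> f w = g w) ->
  ccont f z -> ccont g z.
Proof.
move=> r0 fg cf e e0; have [d d0 h] := cf e e0.
exists (Num.min d r); first by rewrite lt_min d0.
move=> w; rewrite lt_min => /andP[wd wr]; rewrite -!fg ?subrr ?cabs0//.
exact: h.
Qed.

Lemma dquot_ccont' f a L z : z != a -> ccont f z -> ccont (dquot f a L) z.
Proof.
move=> za hf; apply: (ccont_near _ (dquot_near f L za)).
  by rewrite cabs_gt0 subr_eq0.
apply: ccontM; first by apply: ccontB => //; apply: holo_ccont; exact: holo_cst.
apply: holo_ccont; apply: holoV; first by rewrite subr_eq0.
by apply: holoB; [exact: holo_id|exact: holo_cst].
Qed.

Lemma ccont_eq0 f z : ccont f z -> (forall d, 0 < d ->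
  exists2 w, cabs (w - z) < d & f w = 0) -> f z = 0.
Proof.
move=> cf h; apply/eqP; rewrite -cabs_eq0 eq_le cabs_ge0 andbT.
apply/ler_addgt0Pl => e e0; rewrite addr0; have [d d0 hd] := cf e e0.
by have [w wd w0] := h d d0; have := hd w wd; rewrite w0 sub0r cabsN.
Qed.

End ComplexModulus.

(** * Mean value estimate along the boundary of a rectangle *)

Section CauchyRectangle.
Variable R : realType.
Local Notation C := R[i].
Implicit Types (z w : C) (f : C -> C).

Definition box (c : C) (r : R) (z : C) : Prop :=
  (complex.Re c - r <= complex.Re z <= complex.Re c + r) /\
  (complex.Im c - r <= complex.Im z <= complex.Im c + r).

Lemma cont2_real (F : C -> R) (x y : R) :
  (forall e, 0 < e -> exists2 d : R, 0 < d & forall w : C,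
     cabs (w - (x +i* y)%C) < d -> `|F w - F (x +i* y)%C| <= e) ->
  cont2 (fun x y => F (x +i* y)%C) x y.
Proof.
move=> h e e0; have [d d0 hd] := h e e0; exists (d / 2); first by rewrite divr_gt0.
move=> x' y' hx hy; apply: hd; rewrite (le_lt_trans (cabs_le_ReIm _))//=; lra.
Qed.

Lemma cont2_Re f x y : ccont f (x +i* y)%C -> cont2 (fun x y => complex.Re (f (x +i* y)%C)) x y.
Proof.
move=> cf; apply: (@cont2_real (fun z => complex.Re (f z))) => e e0.
have [d d0 h] := cf e e0; exists d => // w wd.
by rewrite -ReB (le_trans (ler_Re_cabs _))// h.
Qed.

Lemma cont2_Im f x y : ccont f (x +i* y)%C -> cont2 (fun x y => complex.Im (f (x +i* y)%C)) x y.
Proof.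
move=> cf; apply: (@cont2_real (fun z => complex.Im (f z))) => e e0.
have [d d0 h] := cf e e0; exists d => // w wd.
by rewrite -ImB (le_trans (ler_Im_cabs _))// h.
Qed.

Lemma cont2_cabs f x y : ccont f (x +i* y)%C -> cont2 (fun x y => cabs (f (x +i* y)%C)) x y.
Proof.
move=> cf; apply: (@cont2_real (fun z => cabs (f z))) => e e0.
have [d d0 h] := cf e e0; exists d => // w wd.
by rewrite (le_trans (ler_dist_cabs _ _))// h.
Qed.

(** These are the coefficients of Im (f dz) = Im f dx + Re f dy. The two mixed partial derivatives
    are both Re L, which is the closedness required by [green]. *)
Lemma cauchy_riemann f (x y : R) (L : C) : cdiff f (x +i* y)%C L ->
  diff2 (fun x y => complex.Im (f (x +i* y)%C)) x y (complex.Im L) (complex.Re L) /\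
  diff2 (fun x y => complex.Re (f (x +i* y)%C)) x y (complex.Re L) (- complex.Im L).
Proof.
move=> df; suff H e : 0 < e -> exists2 d : R, 0 < d & forall x' y',
    `|x' - x| < d -> `|y' - y| < d ->
    cabs (f (x' +i* y')%C - f (x +i* y)%C - L * ((x' - x) +i* (y' - y))%C) <=
      e * (`|x' - x| + `|y' - y|).
  split=> e e0; have [d d0 h] := H e e0; exists d => // x' y' hx hy;
    apply: le_trans (h x' y' hx hy).
    apply: le_trans (ler_Im_cabs _); rewrite !ImB ImM /= le_eqVlt; apply/orP; left.
    by apply/eqP; congr `|_ - _|; ring.
  apply: le_trans (ler_Re_cabs _); rewrite !ReB ReM /= le_eqVlt; apply/orP; left.
  by apply/eqP; congr `|_ - _|; ring.
move=> e0; have [d d0 h] := df e e0; exists (d / 2); first by rewrite divr_gt0.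
move=> x' y' hx hy; have hw : cabs ((x' +i* y')%C - (x +i* y)%C) <= `|x' - x| + `|y' - y|.
  exact: cabs_le_ReIm.
apply: (le_trans (h (x' +i* y')%C _)); first by rewrite (le_lt_trans hw)//; lra.
by rewrite ler_pM2l.
Qed.

Lemma segint_ge0 (h : R -> R) a b : (forall x, 0 <= h x) -> 0 <= segint h a b.
Proof. by move=> h0; apply: Rintegral_ge0. Qed.

Lemma segint_mean_bound (h k : R -> R) (a b K A : R) : a <= b ->
  cont_on h a b -> cont_on k a b ->
  (forall x, a <= x <= b -> h x <= K * k x - A) ->
  segint h a b <= K * segint k a b - A * (b - a).
Proof.
move=> ab ch ck hk.
have cK : cont_on (fun x => K * k x) a b.
  by move=> x xab; apply: (@continuousM R R^o (fun=> K) k); [exact: cvg_cst|exact: ck].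
have -> : K * segint k a b = segint (fun x => K * k x) a b.
  by rewrite /segint RintegralZl//; exact: cont_on_integrable.
rewrite -(segint_cst A ab) -segintB//; last exact: cont_on_cst.
by apply: le_segint => //; apply: cont_onB => //; exact: cont_on_cst.
Qed.

Definition boundary_int (h : C -> R) (a1 b1 a2 b2 : R) : R :=
  segint (fun x => h (x +i* a2)%C) a1 b1 + segint (fun x => h (x +i* b2)%C) a1 b1 +
  (segint (fun y => h (a1 +i* y)%C) a2 b2 + segint (fun y => h (b1 +i* y)%C) a2 b2).

Lemma inv_bound (r : R) (w : C) : 0 < r ->
  r / 2 <= `|complex.Re w| \/ r / 2 <= `|complex.Im w| ->
  (cabs w)^-1 <= 2 / r.
Proof.
move=> r0 h; have hw : r / 2 <= cabs w.
  by case: h => h; apply: (le_trans h); [exact: ler_Re_cabs|exact: ler_Im_cabs].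
have r20 : 0 < r / 2 by rewrite divr_gt0.
by rewrite -[2 / r]invf_div lef_pV2 ?posrE// (lt_le_trans r20).
Qed.

(** On a side whose distance to the center is between r / 2 and r, |F / w| is at most 2 |F| / r,
    while A / w contributes at least A (r / 2) / (2 r^2) = A / (4 r). The four cases are the right,
    left, lower and upper sides, with the signs that Im (h dz) has in the counterclockwise
    circulation. *)
Lemma quot_bound (r A : R) (F w : C) : 0 < r -> 0 <= A ->
  `|complex.Re w| <= r -> `|complex.Im w| <= r ->
  [/\ r / 2 <= complex.Re w -> complex.Re ((F - A%:C%C) / w) <= 2 / r * cabs F - A / (4 * r),
      r / 2 <= - complex.Re w -> - complex.Re ((F - A%:C%C) / w) <= 2 / r * cabs F - A / (4 * r),
      r / 2 <= - complex.Im w -> complex.Im ((F - A%:C%C) / w) <= 2 / r * cabs F - A / (4 * r) &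
      r / 2 <= complex.Im w -> - complex.Im ((F - A%:C%C) / w) <= 2 / r * cabs F - A / (4 * r)].
Proof.
move=> r0 A0 hu hv.
have FR : r / 2 <= `|complex.Re w| \/ r / 2 <= `|complex.Im w| -> cabs (F / w) <= 2 / r * cabs F.
  move=> h; rewrite cabsM cabsV mulrC ler_wpM2r ?cabs_ge0//; exact: inv_bound.
have E (t : R) : r / 2 <= t -> `|complex.Re w| = t \/ `|complex.Im w| = t ->
    A / (4 * r) <= A * (t / (complex.Re w ^+ 2 + complex.Im w ^+ 2)).
  move=> rt ht; rewrite ler_wpM2l//.
  have t0 : 0 < t by rewrite (lt_le_trans _ rt)// divr_gt0.
  have D0 : 0 < complex.Re w ^+ 2 + complex.Im w ^+ 2.
    rewrite -(real_normK (num_real (complex.Re w))) -(real_normK (num_real (complex.Im w))).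
    by case: ht => ->; [rewrite ltr_pwDl|rewrite ltr_wpDl]; rewrite ?exprn_gt0 ?sqr_ge0 ?exprn_ge0.
  rewrite ler_pdivlMr// mulrC ler_pdivrMr ?mulr_gt0//.
  have su : complex.Re w ^+ 2 <= r ^+ 2.
    by rewrite -(real_normK (num_real (complex.Re w))) ler_pXn2r// nnegrE ltW.
  have sv : complex.Im w ^+ 2 <= r ^+ 2.
    by rewrite -(real_normK (num_real (complex.Im w))) ler_pXn2r// nnegrE ltW.
  apply: (@le_trans _ _ (r ^+ 2 + r ^+ 2)); first exact: lerD.
  have : r * (r / 2) <= r * t by rewrite ler_pM2l.
  lra.
have RA : complex.Re (A%:C%C / w) = A * (complex.Re w / (complex.Re w ^+ 2 + complex.Im w ^+ 2)).
  by case: (w) => u v /=; ring.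
have IA : complex.Im (A%:C%C / w) = - (A * (complex.Im w / (complex.Re w ^+ 2 + complex.Im w ^+ 2))).
  by case: (w) => u v /=; ring.
rewrite mulrBl ReB ImB RA IA.
have r20 : 0 < r / 2 by rewrite divr_gt0.
split=> ht.
- have nt : `|complex.Re w| = complex.Re w by rewrite ger0_norm// (le_trans _ ht)// ltW.
  have b := FR (or_introl _); have := E _ ht (or_introl nt); rewrite nt in b.
  have := le_trans (ler_norm _) (ler_Re_cabs (F / w)); have := b ht; lra.
- have nt : `|complex.Re w| = - complex.Re w.
    by rewrite ler0_norm// -oppr_ge0 (le_trans _ ht)// ltW.
  have b := FR (or_introl _); have := E _ ht (or_introl nt); rewrite nt in b.
  rewrite mulNr mulrN.
  have := ler_Re_cabs (F / w); rewrite ler_norml => /andP[]; have := b ht; lra.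
- have nt : `|complex.Im w| = - complex.Im w.
    by rewrite ler0_norm// -oppr_ge0 (le_trans _ ht)// ltW.
  have b := FR (or_intror _); have := E _ ht (or_intror nt); rewrite nt in b.
  rewrite mulNr mulrN.
  have := ler_Im_cabs (F / w); rewrite ler_norml => /andP[]; have := b ht; lra.
- have nt : `|complex.Im w| = complex.Im w by rewrite ger0_norm// (le_trans _ ht)// ltW.
  have b := FR (or_intror _); have := E _ ht (or_intror nt); rewrite nt in b.
  have := ler_Im_cabs (F / w); rewrite ler_norml => /andP[]; have := b ht; lra.
Qed.

(* Integrating the imaginary part of the closed form (f z - f c) / (z - c) dz *)
(* along the boundary; multiplying f by a unit makes f c real.                *)
Lemma rectangle_mean f (c : C) (r : R) (S : seq C) (a1 b1 a2 b2 : R) : 0 < r ->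
  (forall z, box c r z -> ccont f z) ->
  (forall z, box c r z -> z \notin S -> holo f z) -> c \notin S ->
  complex.Re c - r <= a1 <= complex.Re c - r / 2 ->
  complex.Re c + r / 2 <= b1 <= complex.Re c + r ->
  complex.Im c - r <= a2 <= complex.Im c - r / 2 ->
  complex.Im c + r / 2 <= b2 <= complex.Im c + r ->
  cabs (f c) <= 2 / r * boundary_int (fun z => cabs (f z)) a1 b1 a2 b2.
Proof.
move=> r0 cf hf cS /andP[a1l a1u] /andP[b1l b1u] /andP[a2l a2u] /andP[b2l b2u].
set A := cabs (f c).
have cc : box c r c by split; apply/andP; split; lra.
have [L dL] := holo_cdiff (hf c cc cS).
have ab1 : a1 < b1 by lra.
have ab2 : a2 < b2 by lra.
have boxP x y : a1 <= x <= b1 -> a2 <= y <= b2 -> box c r (x +i* y)%C.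
  by move=> /andP[? ?] /andP[? ?]; split; apply/andP; split => /=; lra.
have [fc0|fc0] := eqVneq (f c) 0.
  rewrite /A fc0 cabs0; apply: mulr_ge0; first by rewrite divr_ge0// ltW.
  by rewrite /boundary_int !addr_ge0//; apply: segint_ge0 => x; exact: cabs_ge0.
have A0 : 0 < A by rewrite cabs_gt0.
pose lam : C := A%:C%C / f c.
have lam1 : cabs lam = 1.
  by rewrite cabsM cabsV cabs_real ger0_norm ?cabs_ge0// divff// gt_eqF.
have lamf : lam * f c = A%:C%C by rewrite divfK.
pose h z := lam * dquot f c L z.
have ch z : box c r z -> ccont h z.
  move=> zb; apply: ccontM; first by apply: holo_ccont; exact: holo_cst.
  have [->|zc] := eqVneq z c; first exact: dquot_ccont.
  by apply: dquot_ccont' => //; exact: cf.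
have hE z : z != c -> h z = (lam * f z - A%:C%C) / (z - c).
  by move=> zc; rewrite /h /dquot (negbTE zc) mulrA mulrBr lamf.
pose P x y := complex.Im (h (x +i* y)%C); pose Q x y := complex.Re (h (x +i* y)%C).
(* The center is exceptional too: the divided difference is only known to be continuous there. *)
pose S' := [seq (complex.Re z, complex.Im z) | z <- c :: S].
have : circulation P Q a1 b1 a2 b2 = 0.
  apply: (@green R P Q a1 b1 a2 b2 S') => //.
  - by move=> x y xm ym; apply: cont2_Im; apply: ch; exact: boxP.
  - by move=> x y xm ym; apply: cont2_Re; apply: ch; exact: boxP.
  - move=> x y xm ym xyS.
    have zS : (x +i* y)%C \notin c :: S.
      apply: contra xyS => zS; apply/mapP; by exists (x +i* y)%C.
    rewrite inE negb_or in zS; case/andP: zS => zc zS.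
    have [L' dL'] : exists L', cdiff h (x +i* y)%C L'.
      apply: holo_cdiff; apply: holoM; first exact: holo_cst.
      by apply: dquot_holo => //; apply: hf => //; exact: boxP.
    have [dI dR] := cauchy_riemann dL'.
    by exists (complex.Im L'), (complex.Re L'), (- complex.Im L').
have lamF z : cabs (lam * f z) = cabs (f z) by rewrite cabsM lam1 mul1r.
have x0m : a1 <= complex.Re c <= b1 by apply/andP; split; lra.
have y0m : a2 <= complex.Im c <= b2 by apply/andP; split; lra.
have cfx y : a2 <= y <= b2 -> cont_on (fun x => cabs (f (x +i* y)%C)) a1 b1.
  move=> ym x xm; apply: (@cont2_slicex R (fun x y => cabs (f (x +i* y)%C))).
  by apply: cont2_cabs; apply: cf; exact: boxP.
have cfy x : a1 <= x <= b1 -> cont_on (fun y => cabs (f (x +i* y)%C)) a2 b2.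
  move=> xm y ym; apply: (@cont2_slicey R (fun x y => cabs (f (x +i* y)%C))).
  by apply: cont2_cabs; apply: cf; exact: boxP.
have cPx y : a2 <= y <= b2 -> cont_on (P^~ y) a1 b1.
  move=> ym x xm; apply: cont2_slicex.
  by apply: cont2_Im; apply: ch; exact: boxP.
have cQy x : a1 <= x <= b1 -> cont_on (Q x) a2 b2.
  move=> xm y ym; apply: cont2_slicey.
  by apply: cont2_Re; apply: ch; exact: boxP.
have cN (k : R -> R) u v : cont_on k u v -> cont_on (fun x => - k x) u v.
  by move=> ck x xm; apply: (@continuousN R R^o R^o k); exact: ck.
have sN (k : R -> R) u v : cont_on k u v -> segint (fun x => - k x) u v = - segint k u v.
  move=> ck; rewrite -[RHS]sub0r -[X in X - _](_ : segint (fun=> 0) u v = 0).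
    rewrite -segintB//; last exact: cont_on_cst.
    by congr segint; apply/funext => x; rewrite sub0r.
  by rewrite /segint Rintegral_cst//= mul0r.
have a2m : a2 <= a2 <= b2 by rewrite lexx ltW.
have b2m : a2 <= b2 <= b2 by rewrite lexx ltW.
have a1m : a1 <= a1 <= b1 by rewrite lexx ltW.
have b1m : a1 <= b1 <= b1 by rewrite lexx ltW.
have dw x y : a1 <= x <= b1 -> a2 <= y <= b2 ->
    `|complex.Re ((x +i* y)%C - c)| <= r /\ `|complex.Im ((x +i* y)%C - c)| <= r.
  move=> /andP[x1 x2] /andP[y1 y2]; rewrite ReB ImB /=.
  by rewrite !ler_norml; clear -a1l b1u a2l b2u x1 x2 y1 y2; split; apply/andP; split; lra.
have B1 : segint (P^~ a2) a1 b1 <=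
    2 / r * segint (fun x => cabs (f (x +i* a2)%C)) a1 b1 - A / (4 * r) * (b1 - a1).
  apply: segint_mean_bound; [exact: ltW|exact: cPx|exact: cfx|].
  move=> x xm; have [d1 d2] := dw x a2 xm a2m.
  have [_ _ + _] := @quot_bound r A (lam * f (x +i* a2)%C) _ r0 (ltW A0) d1 d2.
  rewrite lamF /P hE; first by apply; rewrite ImB /=; lra.
  by apply/eqP => E; move: a2u; rewrite -E /=; lra.
have B2 : segint (fun x => - P x b2) a1 b1 <=
    2 / r * segint (fun x => cabs (f (x +i* b2)%C)) a1 b1 - A / (4 * r) * (b1 - a1).
  apply: segint_mean_bound; [exact: ltW|by apply: cN; exact: cPx|exact: cfx|].
  move=> x xm; have [d1 d2] := dw x b2 xm b2m.
  have [_ _ _ +] := @quot_bound r A (lam * f (x +i* b2)%C) _ r0 (ltW A0) d1 d2.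
  rewrite lamF /P hE; first by apply; rewrite ImB /=; lra.
  by apply/eqP => E; move: b2l; rewrite -E /=; lra.
have B3 : segint (fun y => - Q a1 y) a2 b2 <=
    2 / r * segint (fun y => cabs (f (a1 +i* y)%C)) a2 b2 - A / (4 * r) * (b2 - a2).
  apply: segint_mean_bound; [exact: ltW|by apply: cN; exact: cQy|exact: cfy|].
  move=> y ym; have [d1 d2] := dw a1 y a1m ym.
  have [_ + _ _] := @quot_bound r A (lam * f (a1 +i* y)%C) _ r0 (ltW A0) d1 d2.
  rewrite lamF /Q hE; first by apply; rewrite ReB /=; lra.
  by apply/eqP => E; move: a1u; rewrite -E /=; lra.
have B4 : segint (Q b1) a2 b2 <=
    2 / r * segint (fun y => cabs (f (b1 +i* y)%C)) a2 b2 - A / (4 * r) * (b2 - a2).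
  apply: segint_mean_bound; [exact: ltW|exact: cQy|exact: cfy|].
  move=> y ym; have [d1 d2] := dw b1 y b1m ym.
  have [+ _ _ _] := @quot_bound r A (lam * f (b1 +i* y)%C) _ r0 (ltW A0) d1 d2.
  rewrite lamF /Q hE; first by apply; rewrite ReB /=; lra.
  by apply/eqP => E; move: b1l; rewrite -E /=; lra.
move: B2 B3; rewrite sN; last exact: cPx.
move=> B2; rewrite sN; last exact: cQy.
move=> B3; rewrite /circulation => circ0.
(* Each side has length at least r, so the four contributions A / (4 r) * r add up to A. *)
have AA : A <= A / (4 * r) * (b1 - a1) + A / (4 * r) * (b1 - a1) +
    (A / (4 * r) * (b2 - a2) + A / (4 * r) * (b2 - a2)).
  rewrite -!mulrDr mulrAC ler_pdivlMr ?mulr_gt0// ler_pM2l//.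
  by move: a1u b1l a2u b2l; clear; lra.
apply: (le_trans AA); rewrite /boundary_int !mulrDr.
move: B1 B2 B3 B4 circ0; clear; lra.
Qed.

End CauchyRectangle.

Section Liouville.
Variable R : realType.
Local Notation C := R[i].
Implicit Types (z w : C) (f : C -> C).

(** The mean value estimate on a large square around [c]: on its boundary |f| <= e / 16, the
    perimeter is 8 r, and 2 / r * 8 r * e / 16 = e. *)
Lemma decay_eq0 f (S : seq C) (K rho : R) :
  (forall z, ccont f z) -> (forall z, z \notin S -> holo f z) ->
  (forall z, rho <= cabs z -> cabs z * cabs (f z) <= K) ->
  forall c, c \notin S -> f c = 0.
Proof.
move=> cf hf gf c cS; apply/eqP; rewrite -cabs_eq0 eq_le cabs_ge0 andbT.
apply/ler_addgt0Pl => e e0; rewrite addr0.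
have K0 : 0 <= `|K| by [].
(* On the boundary |z| >= r - |c|. The first bound makes this at least [rho], the second at least 16
   (|K| + 1) / e. *)
pose r := Num.max (`|rho| + cabs c + 1) (cabs c + 16 * (`|K| + 1) / e).
have c0 := cabs_ge0 c.
have r1 : `|rho| + cabs c + 1 <= r by rewrite /r le_max lexx.
have r2 : cabs c + 16 * (`|K| + 1) / e <= r by rewrite /r le_max lexx orbT.
have r0 : 0 < r by apply: (lt_le_trans _ r1); rewrite ltr_wpDl// addr_ge0.
have rrho : rho <= r - cabs c.
  by rewrite (le_trans (ler_norm rho))//; move: r1; clear; lra.
have rc : 0 < r - cabs c by have := normr_ge0 rho; lra.
have Kr : 16 * (`|K| + 1) / e <= r - cabs c by lra.
have small z : r - cabs c <= cabs z -> cabs (f z) <= e / 16.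
  move=> hz; have z0 : 0 < cabs z by rewrite (lt_le_trans rc).
  have h1 := gf z (le_trans rrho hz).
  rewrite -(ler_pM2l z0) (le_trans h1)// (le_trans (ler_norm K))//.
  have h2 : 16 * (`|K| + 1) / e <= cabs z by exact: le_trans hz.
  rewrite ler_pdivrMr// in h2; lra.
have [q1 q2 q3 q4] : [/\ complex.Re c - r <= complex.Re c - r <= complex.Re c - r / 2,
    complex.Re c + r / 2 <= complex.Re c + r <= complex.Re c + r,
    complex.Im c - r <= complex.Im c - r <= complex.Im c - r / 2 &
    complex.Im c + r / 2 <= complex.Im c + r <= complex.Im c + r].
  by move: r0; clear; split; apply/andP; split; lra.
have rm := @rectangle_mean R f c r S _ _ _ _ r0 (fun z _ => cf z) (fun z _ => hf z)
  cS q1 q2 q3 q4.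
apply: (le_trans rm).
have seg (k : R -> C) u v : u <= v -> cont_on (fun x => cabs (f (k x))) u v ->
    (forall x, r - cabs c <= cabs (k x)) ->
    segint (fun x => cabs (f (k x))) u v <= e / 16 * (v - u).
  move=> uv ck hk; rewrite -(segint_cst _ uv); apply: le_segint => //.
    exact: cont_on_cst.
  by move=> x _; exact: small.
have big z : `|complex.Re (z - c)| = r \/ `|complex.Im (z - c)| = r -> r - cabs c <= cabs z.
  move=> h; have hr : r <= cabs (z - c).
    by case: h => <-; [exact: ler_Re_cabs|exact: ler_Im_cabs].
  by rewrite lerBlDr (le_trans hr)// ler_cabsB.
have cx y u v : cont_on (fun x => cabs (f (x +i* y)%C)) u v.
  by move=> x xm; apply: (@cont2_slicex R (fun x y => cabs (f (x +i* y)%C))); apply: cont2_cabs.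
have cy x u v : cont_on (fun y => cabs (f (x +i* y)%C)) u v.
  by move=> y ym; apply: (@cont2_slicey R (fun x y => cabs (f (x +i* y)%C))); apply: cont2_cabs.
have l1 : complex.Re c - r <= complex.Re c + r by lra.
have l2 : complex.Im c - r <= complex.Im c + r by lra.
have nr : `|r| = r by rewrite ger0_norm// ltW.
have k1 x : r - cabs c <= cabs (x +i* (complex.Im c - r))%C.
  by apply: big; right; rewrite ImB /= addrAC subrr sub0r normrN.
have k2 x : r - cabs c <= cabs (x +i* (complex.Im c + r))%C.
  by apply: big; right; rewrite ImB /= addrAC subrr add0r.
have k3 y : r - cabs c <= cabs ((complex.Re c - r) +i* y)%C.
  by apply: big; left; rewrite ReB /= addrAC subrr sub0r normrN.
have k4 y : r - cabs c <= cabs ((complex.Re c + r) +i* y)%C.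
  by apply: big; left; rewrite ReB /= addrAC subrr add0r.
have s1 := seg (fun x => (x +i* (complex.Im c - r))%C) _ _ l1 (cx _ _ _) k1.
have s2 := seg (fun x => (x +i* (complex.Im c + r))%C) _ _ l1 (cx _ _ _) k2.
have s3 := seg (fun y => ((complex.Re c - r) +i* y)%C) _ _ l2 (cy _ _ _) k3.
have s4 := seg (fun y => ((complex.Re c + r) +i* y)%C) _ _ l2 (cy _ _ _) k4.
rewrite mulrC mulrA ler_pdivrMr//; rewrite /boundary_int; move: s1 s2 s3 s4; clear; lra.
Qed.

(* Dividing out the zeros reduces to a function that decays at infinity. *)
Lemma zeros_growth_eq0 (s : seq C) f (S : seq C) (K rho : R) :
  (forall z, ccont f z) -> (forall z, z \notin S -> holo f z) ->
  (forall z, rho <= cabs z -> cabs z * cabs (f z) <= K * cabs z ^+ size s) ->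
  uniq s -> (forall a, a \in s -> a \notin S /\ f a = 0) ->
  forall c, c \notin S -> f c = 0.
Proof.
elim: s f S K rho => [|a s IH] f S K rho cf hf gf us fs.
  by apply: (@decay_eq0 f S K rho) => // z hz; rewrite -[K]mulr1; exact: gf.
have /andP[as_ us'] := us.
have [aS fa0] := fs a (mem_head _ _).
have [L dL] := holo_cdiff (hf a aS).
pose f1 := dquot f a L.
have f1E z : (z - a) * f1 z = f z by rewrite dquotE fa0 subr0.
have cf1 z : ccont f1 z.
  by have [->|za] := eqVneq z a; [exact: dquot_ccont|exact: dquot_ccont'].
have hf1 z : z \notin a :: S -> holo f1 z.
  rewrite inE negb_or => /andP[za zS]; apply: dquot_holo => //; exact: hf.
have f1s z : z \in s -> z \notin a :: S /\ f1 z = 0.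
  move=> zs; have [zS fz] := fs z (mem_behead (s := a :: s) zs).
  have za : z != a by apply: contraNneq as_ => <-.
  split; first by rewrite inE negb_or za.
  by have := f1E z; rewrite fz => /eqP; rewrite mulf_eq0 subr_eq0 (negbTE za) => /eqP.
(* From |z| >= 2 |a| + 1 follows |z - a| >= |z| / 2, whence the doubled constant. *)
have gf1 z : Num.max rho (2 * cabs a + 1) <= cabs z ->
    cabs z * cabs (f1 z) <= (2 * `|K|) * cabs z ^+ size s.
  rewrite ge_max => /andP[hz ha].
  have z0 : 0 < cabs z by have := cabs_ge0 a; lra.
  have dz : cabs z / 2 <= cabs (z - a).
    have := ler_cabsD (z - a) a; rewrite subrK; lra.
  have h := gf z hz; rewrite -f1E cabsM /= exprS in h.
  have h' : cabs (z - a) * cabs (f1 z) <= `|K| * cabs z ^+ size s.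
    rewrite -(ler_pM2l z0) (le_trans h)// mulrCA ler_pM2l//.
    by rewrite ler_wpM2r ?ler_norm ?exprn_ge0 ?cabs_ge0.
  have h2 : cabs z / 2 * cabs (f1 z) <= cabs (z - a) * cabs (f1 z).
    by rewrite ler_wpM2r// cabs_ge0.
  by move: (le_trans h2 h'); lra.
have f10 := IH f1 (a :: S) _ _ cf1 hf1 gf1 us' f1s.
move=> c cS; have [->//|ca] := eqVneq c a.
by rewrite -f1E f10 ?mulr0// inE negb_or ca.
Qed.

End Liouville.

(** * Mean value inequalities in L^2 *)

Section L2Mean.
Variable R : realType.
Local Notation C := R[i].
Local Notation MR := (measurableTypeR R).
Local Notation mu := (@lebesgue_measure R).
Local Notation mu2 := (@lebesgue_measure R \x @lebesgue_measure R)%E.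

(* The library has no sigma-finite structure that applies to this product. *)
Definition leb2 : set (MR * MR) -> \bar R := (mu \x mu)%E.
HB.instance Definition _ := Measure.on leb2.
Lemma leb2_sigma_finite : sigma_finite setT leb2.
Proof.
have /sigma_finiteP[F [TF ndF Foo]] := sigma_finiteT mu.
exists (fun n => F n `*` F n).
  rewrite -setXTT TF predeqE => -[x y]; split.
    move=> [/= [n _ Fnx] [k _ Gky]]; exists (maxn n k) => //; split.
    - by move: x Fnx; exact/subsetPset/ndF/leq_maxl.
    - by move: y Gky; exact/subsetPset/ndF/leq_maxr.
  by move=> [n _ []/= ? ?]; split; exists n.
move=> k; have [? ?] := Foo k.
split; first exact: measurableX.
by rewrite /leb2 product_measure1E// lte_mul_pinfty// ge0_fin_numE.
Qed.
HB.instance Definition _ := Measure_isSigmaFinite.Build _ _ _ leb2 leb2_sigma_finite.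

Lemma tonelli_square d (T : measurableType d)
    (m : {sigma_finite_measure set T -> \bar R}) (F : T * T -> \bar R) :
  measurable_fun setT F -> (forall p, 0 <= F p)%E ->
  measurable_fun setT (fubini_F m F) /\
  (\int[m \x m]_p F p = \int[m]_x fubini_F m F x)%E.
Proof.
move=> mF F0; split; first exact: measurable_fun_fubini_tonelli_F.
exact: fubini_tonelli1.
Qed.

(** Convertible to [leb4], but built from the sigma-finite [leb2] so that Tonelli's theorem
    applies. *)
Definition leb4m := [the {measure set ((MR * MR) * (MR * MR))%type -> \bar R} of (leb2 \x leb2)%E].

Lemma leb4E (D : set ((MR * MR) * (MR * MR))%type) (f : ((MR * MR) * (MR * MR))%type -> \bar R) :
  (\int[@leb4 R]_(w in D) f w = \int[leb4m]_(w in D) f w)%E.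
Proof. by []. Qed.

Lemma leb4_tonelli (F : (MR * MR) * (MR * MR) -> \bar R) :
  measurable_fun setT F -> (forall p, 0 <= F p)%E ->
  measurable_fun setT (fubini_F leb2 F) /\
  (\int[leb4m]_p F p = \int[leb2]_x fubini_F leb2 F x)%E.
Proof. by move=> mF F0; have := @tonelli_square _ _ leb2 F mF F0; exact. Qed.

Lemma exists_below_average (H : MR -> \bar R) (u v t : R) : u < v -> 0 <= t ->
  measurable_fun setT H -> (forall x, 0 <= H x)%E ->
  (\int[mu]_x H x < (t * (v - u))%:E)%E ->
  exists2 x, u <= x <= v & (H x <= t%:E)%E.
Proof.
move=> uv t0 mH H0 Ht; apply: contrapT => nex.
have ab x : u <= x <= v -> (t%:E < H x)%E.
  by move=> xuv; rewrite ltNge; apply/negP => hx; apply: nex; exists x.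
suff : ((t * (v - u))%:E <= \int[mu]_x H x)%E by rewrite leNgt Ht.
apply: (@le_trans _ _ (\int[mu]_(x in `[u, v]) H x)%E); last first.
  by apply: ge0_subset_integral.
have -> : ((t * (v - u))%:E = \int[mu]_(x in `[u, v]) (cst t%:E) x)%E.
  by rewrite integral_cst//= lebesgue_measure_itv/= lte_fin uv -EFinD EFinM.
apply: ge0_le_integral => //.
- exact: measurable_funS mH.
- by move=> x; rewrite /= in_itv /= => /ab/ltW.
Qed.

Lemma segint_le_integral (k : R -> R) (h : MR -> \bar R) (a b : R) :
  cont_on k a b -> (forall x, a <= x <= b -> 0 <= k x) ->
  measurable_fun setT h -> (forall x, 0 <= h x)%E ->
  (forall x, a <= x <= b -> ((k x)%:E <= h x)%E) ->
  ((segint k a b)%:E <= \int[mu]_x h x)%E.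
Proof.
move=> ck k0 mh h0 kh; have ik := cont_on_integrable ck.
rewrite /segint /Rintegral fineK; last exact: integrable_fin_num.
apply: (@le_trans _ _ (\int[mu]_(x in `[a, b]) h x)%E); last first.
  by apply: ge0_subset_integral.
apply: ge0_le_integral => //.
- exact: measurable_int ik.
- exact: measurable_funS mh.
Qed.

(** This is [rectangle_mean] for f^2 on a rectangle whose sides are chosen by averaging: each of
    four strips of width r / 2 contains a slice on which the integral of [h] is at most about 2 / r
    times the total. The majorant [h] is measurable on the whole plane, whereas nothing is known of
    [f] outside the box. *)
Lemma L2_mean (f : C -> C) (c : C) (r : R) (h : MR * MR -> \bar R) : 0 < r ->
  (forall z, box c r z -> holo f z) ->
  measurable_fun setT h -> (forall p, 0 <= h p)%E ->
  (forall x y, box c r (x +i* y)%C -> ((abs2 (f (x +i* y)%C))%:E <= h (x, y))%E) ->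
  ((abs2 (f c))%:E <= (16 / r ^+ 2)%:E * \int[mu2]_p h p)%E.
Proof.
move=> r0 hf mh h0 fh.
have k0 : 0 < 16 / r ^+ 2 by rewrite divr_gt0// exprn_gt0.
have [jE|Jfin] := boolP (\int[mu2]_p h p == +oo)%E.
  by rewrite (eqP jE) gt0_muley ?leey// lte_fin.
have J0 : (0 <= \int[mu2]_p h p)%E by apply: integral_ge0.
set J := (\int[mu2]_p h p)%E in J0 Jfin *.
have [j jE] : exists j, J = j%:E.
  by exists (fine J); rewrite fineK// ge0_fin_numE// lt_neqAle Jfin leey.
rewrite jE -EFinM lee_fin; rewrite jE lee_fin in J0.
have hF : (\int[mu]_x fubini_F mu h x = j%:E)%E by rewrite -jE /J fubini_tonelli1.
have hG : (\int[mu]_y fubini_G mu h y = j%:E)%E by rewrite -jE /J fubini_tonelli2.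
have mF : measurable_fun setT (fubini_F mu h) by exact: measurable_fun_fubini_tonelli_F.
have mG : measurable_fun setT (fubini_G mu h) by exact: measurable_fun_fubini_tonelli_G.
have F0 x : (0 <= fubini_F mu h x)%E by exact: integral_ge0.
have G0 x : (0 <= fubini_G mu h x)%E by exact: integral_ge0.
apply/ler_addgt0Pl => e e0.
(* The slack makes the averaging inequality strict. Since 2 / r * 4 t = 16 (j + d) / r^2, it costs
   exactly e. *)
pose d := e * r ^+ 2 / 16.
have d0 : 0 < d by rewrite divr_gt0// mulr_gt0// exprn_gt0.
pose t := (j + d) / (r / 2).
have t0 : 0 <= t.
  by apply: divr_ge0; [apply: addr_ge0 => //; exact: ltW|apply: divr_ge0 => //; exact: ltW].
have jt u v : v - u = r / 2 -> (j%:E < (t * (v - u))%:E)%E.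
  by move=> ->; rewrite lte_fin divfK ?ltrDl// gt_eqF// divr_gt0.
have r2 : r / 2 < r by rewrite ltr_pdivrMr// ltr_pMr// ltrDl.
have l1 (u : R) : u - r < u - r / 2 by rewrite ltrD2l ltrN2.
have l2 (u : R) : u + r / 2 < u + r by rewrite ltrD2l.
have e1 (u : R) : u - r / 2 - (u - r) = r / 2 by lra.
have e2 (u : R) : u + r - (u + r / 2) = r / 2 by lra.
have [a1 a1m Ha1] := exists_below_average (l1 (complex.Re c)) t0 mF F0
  ltac:(rewrite hF; exact: jt).
have [b1 b1m Hb1] := exists_below_average (l2 (complex.Re c)) t0 mF F0
  ltac:(rewrite hF; exact: jt).
have [a2 a2m Ha2] := exists_below_average (l1 (complex.Im c)) t0 mG G0
  ltac:(rewrite hG; exact: jt).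
have [b2 b2m Hb2] := exists_below_average (l2 (complex.Im c)) t0 mG G0
  ltac:(rewrite hG; exact: jt).
have cc : box c r c.
  by move: r0; clear; split; apply/andP; split; lra.
have hf2 z : box c r z -> holo (fun z => f z * f z) z.
  by move=> zb; apply: holoM; exact: hf.
have := @rectangle_mean R (fun z => f z * f z) c r [::] a1 b1 a2 b2 r0
  (fun z zb => holo_ccont (hf2 z zb)) (fun z zb _ => hf2 z zb) isT a1m b1m a2m b2m.
have f2E z : cabs (f z * f z) = abs2 (f z) by rewrite cabsM abs2E expr2.
rewrite f2E => /le_trans; apply.
rewrite /boundary_int.
have bx x y : a1 <= x <= b1 -> a2 <= y <= b2 -> box c r (x +i* y)%C.
  move: a1m b1m a2m b2m; clear.
  by do 6 move=> /andP[? ?]; split => /=; apply/andP; split; lra.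
have [a1b1 a2b2] : a1 <= b1 /\ a2 <= b2.
  by move: r0 a1m b1m a2m b2m; clear; move=> ?; do 4 move=> /andP[? ?]; split; lra.
have mh1 x : measurable_fun setT (fun y => h (x, y)).
  exact: measurableT_comp mh (measurable_pair1 x).
have mh2 y : measurable_fun setT (fun x => h (x, y)).
  exact: measurableT_comp mh (measurable_pair2 y).
have side1 y : a2 <= y <= b2 -> (fubini_G mu h y <= t%:E)%E ->
    segint (fun x => cabs (f (x +i* y)%C * f (x +i* y)%C)) a1 b1 <= t.
  move=> ym Hy; rewrite -lee_fin; apply: le_trans Hy; apply: segint_le_integral => //.
  - move=> x xm; apply: (@cont2_slicex R (fun x y => cabs (f (x +i* y)%C * f (x +i* y)%C))).
    apply: (@cont2_cabs R (fun z => f z * f z)); apply: holo_ccont; apply: hf2; exact: bx.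
  - by move=> x _; exact: cabs_ge0.
  - by move=> x xm; rewrite f2E; apply: fh; exact: bx.
have side2 x : a1 <= x <= b1 -> (fubini_F mu h x <= t%:E)%E ->
    segint (fun y => cabs (f (x +i* y)%C * f (x +i* y)%C)) a2 b2 <= t.
  move=> xm Hx; rewrite -lee_fin; apply: le_trans Hx; apply: segint_le_integral => //.
  - move=> y ym; apply: (@cont2_slicey R (fun x y => cabs (f (x +i* y)%C * f (x +i* y)%C))).
    apply: (@cont2_cabs R (fun z => f z * f z)); apply: holo_ccont; apply: hf2; exact: bx.
  - by move=> y _; exact: cabs_ge0.
  - by move=> y ym; rewrite f2E; apply: fh; exact: bx.
have s1 := side1 a2 ltac:(by rewrite lexx) Ha2.
have s2 := side1 b2 ltac:(by rewrite lexx andbT) Hb2.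
have s3 := side2 a1 ltac:(by rewrite lexx) Ha1.
have s4 := side2 b1 ltac:(by rewrite lexx andbT) Hb1.
have s := lerD (lerD s1 s2) (lerD s3 s4).
have r20 : 0 <= 2 / r by rewrite divr_ge0// ltW.
apply: (le_trans (ler_wpM2l r20 s)).
rewrite le_eqVlt; apply/orP; left; apply/eqP; rewrite /t /d.
by field; rewrite gt_eqF.
Qed.

(** One variable at a time: [L2_mean] in the second variable bounds |g(z1, c2)|^2 by a multiple of
    the slice integral of [F], and this multiple is the majorant for [L2_mean] in the first
    variable. *)
Lemma L2_mean2 (g : C -> C -> C) (c1 c2 : C) (r : R)
    (F : (MR * MR) * (MR * MR) -> \bar R) : 0 < r ->
  (forall z1 z2, box c1 r z1 -> box c2 r z2 ->
     holo (g^~ z2) z1 /\ holo (g z1) z2) ->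
  measurable_fun setT F -> (forall p, 0 <= F p)%E ->
  (forall x1 y1 x2 y2, box c1 r (x1 +i* y1)%C -> box c2 r (x2 +i* y2)%C ->
    ((abs2 (g (x1 +i* y1)%C (x2 +i* y2)%C))%:E <= F ((x1, y1), (x2, y2)))%E) ->
  ((abs2 (g c1 c2))%:E <= ((16 / r ^+ 2) ^+ 2)%:E * \int[leb4m]_p F p)%E.
Proof.
move=> r0 hg mF F0 gF.
have k0 : 0 <= 16 / r ^+ 2 by rewrite divr_ge0// exprn_ge0// ltW.
have cc c : box c r c by move: r0; clear; split; apply/andP; split; lra.
have [mH HE] := leb4_tonelli mF F0.
have H0 p : (0 <= fubini_F leb2 F p)%E by exact: integral_ge0.
have := @L2_mean (g^~ c2) c1 r (fun p => (16 / r ^+ 2)%:E * fubini_F leb2 F p)%E r0.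
set k := 16 / r ^+ 2 in k0 *.
rewrite HE (expr2 k) (EFinM k k) -muleA.
have EZ : (\int[leb2]_p (k%:E * fubini_F leb2 F p) =
    k%:E * \int[leb2]_x fubini_F leb2 F x)%E.
  by apply: ge0_integralZl => //; rewrite lee_fin.
rewrite -[(\int[mu2]_p _)%E]/(\int[leb2]_p (k%:E * fubini_F leb2 F p))%E EZ; apply.
- by move=> z zb; have [] := hg z c2 zb (cc c2).
- exact: measurable_funeM.
- by move=> p; rewrite mule_ge0// lee_fin.
- move=> x y xyb; apply: (@L2_mean (g (x +i* y)%C) c2 r (fun p => F ((x, y), p)) r0).
  + by move=> z zb; have [] := hg _ z xyb zb.
  + exact: measurableT_comp mF (measurable_pair1 (x, y)).
  + by move=> p.
  + by move=> x2 y2 b2; exact: gF.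
Qed.

End L2Mean.

(** * The projective plane and the multiplier ideals *)

Section ProjectiveTopology.
Variables (R : realType) (n : nat).
Local Notation C := R[i].
Local Notation vec := 'rV[C^o]_n.+1.
Local Notation P := (projspace R n).
Local Open Scope quotient_scope.
Implicit Types (x y : P) (v w : vec) (U : set P).

Lemma hcoord_neq0 x : hcoord x != 0.
Proof. exact: set_mem (valP (repr x)). Qed.

Lemma represents_hcoord x : represents x (hcoord x).
Proof. by exists 1; rewrite oner_neq0 scale1r. Qed.

Lemma represents_neq0 x v : represents x v -> v != 0.
Proof. by case=> a [a0 ->]; rewrite scaler_eq0 (negbTE a0) (negbTE (hcoord_neq0 x)). Qed.

Lemma representsZ x v (a : C) : a != 0 -> represents x v -> represents x (a *: v).
Proof.
by move=> a0 [b [b0 ->]]; exists (a * b); rewrite mulf_neq0// scalerA.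
Qed.

Definition mkpoint v (v0 : v != 0) : P :=
  \pi_(quotient_topology {eq_quot (proj_rel R n)})
    (exist _ v (mem_set v0) : @nonzero_vec R n).

Lemma represents_mkpoint v (v0 : v != 0) : represents (mkpoint v0) v.
Proof.
set u : @nonzero_vec R n := exist _ v (mem_set v0).
have /eqmodP/asboolP[a [a0 ua]] : repr (mkpoint v0) = u %[mod {eq_quot (proj_rel R n)}].
  exact: (@reprK _ (quotient_topology {eq_quot (proj_rel R n)}) (mkpoint v0)).
by exists a; split.
Qed.

Lemma const1_neq0 : const_mx 1 != 0 :> vec.
Proof. by apply/eqP => /rowP/(_ 0); rewrite !mxE => /eqP; rewrite oner_eq0. Qed.

(* Junk if v = 0. *)
Definition pt v : P :=
  if pselect (v != 0) is left v0 then mkpoint v0 else mkpoint const1_neq0.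

Lemma represents_pt v : v != 0 -> represents (pt v) v.
Proof. by rewrite /pt; case: pselect => // v0 _; exact: represents_mkpoint. Qed.

Lemma represents_inj x y v : represents x v -> represents y v -> x = y.
Proof.
move=> [a [a0 va]] [b [b0 vb]].
rewrite -[x](@reprK _ (quotient_topology {eq_quot (proj_rel R n)})).
rewrite -[y](@reprK _ (quotient_topology {eq_quot (proj_rel R n)})).
apply/eqmodP/asboolP; exists (b^-1 * a); rewrite mulf_neq0 ?invr_neq0//; split=> //.
by rewrite -scalerA -[val (repr x)]/(hcoord x) -va vb scalerA mulVf// scale1r.
Qed.

Lemma represents_exists v : v != 0 -> exists x, represents x v.
Proof. by move=> v0; exists (mkpoint v0); exact: represents_mkpoint. Qed.

Lemma cone_represents U x v : represents x v -> cone U v -> U x.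
Proof. by move=> xv [y Uy yv]; rewrite (represents_inj xv yv). Qed.

Lemma cone_hcoord U x : cone U (hcoord x) <-> U x.
Proof.
split; first exact: cone_represents (represents_hcoord x).
by exists x => //; exact: represents_hcoord.
Qed.

Lemma cone_neq0 U v : cone U v -> v != 0.
Proof. by case=> x _; exact: represents_neq0. Qed.

Lemma coneZ U v (a : C) : a != 0 -> cone U v -> cone U (a *: v).
Proof. by move=> a0 [x Ux xv]; exists x => //; exact: representsZ. Qed.

Lemma coneS U V : U `<=` V -> cone U `<=` cone V.
Proof. by move=> UV v [x Ux xv]; exists x => //; exact: UV. Qed.

Lemma coneI U V : cone (U `&` V) = cone U `&` cone V.
Proof.
apply/seteqP; split=> v; first by case=> x [Ux Vx] xv; split; exists x.
by move=> [[x Ux xv] Vv]; exists x => //; split => //; exact: cone_represents xv Vv.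
Qed.

Lemma open_nonzero : open [set v : vec | v != 0].
Proof.
have -> : [set v : vec | v != 0] = ~` [set 0].
  by apply/seteqP; split=> v /=; [move/eqP|move=> ?; apply/eqP].
by apply: closed_openC; apply: accessible_closed_set1; apply: hausdorff_accessible; exact: norm_hausdorff.
Qed.

(** The quotient topology comes from the subspace of nonzero vectors, so the cone is an open set of
    vectors intersected with the nonzero ones, which are open themselves. *)
Lemma open_cone U : open U -> open (cone U).
Proof.
rewrite {1}/open/= /quotient_open.
case=> O oO OU; have -> : cone U = O `&` [set v | v != 0].
  apply/seteqP; split=> v.
    move=> Uv; have v0 := cone_neq0 Uv; split => //.
    pose u : @nonzero_vec R n := exist _ v (mem_set v0).
    have Ou : U (mkpoint v0) by exact: cone_represents (represents_mkpoint v0) Uv.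
    by have := congr1 (fun A => A u) OU => /= OUu; have : O (set_val u) by rewrite OUu.
  move=> [Ov nz]; have v0 : v != 0 := nz; exists (mkpoint v0); last exact: represents_mkpoint.
  pose u : @nonzero_vec R n := exist _ v (mem_set v0).
  have := congr1 (fun A => A u) OU => /= OUu.
  have Ou : O (set_val u) by [].
  have -> : U (mkpoint v0) = O (set_val u) by rewrite OUu.
  exact: Ou.
by apply: openI => //; exact: open_nonzero.
Qed.

Lemma open_invariant (W : set vec) : open W ->
  (forall v (a : C), a != 0 -> W v -> W (a *: v)) ->
  open [set x : P | W (hcoord x)].
Proof.
move=> oW hW; rewrite /open/= /quotient_open; exists W => //.
apply/seteqP; split=> u /=.
  move=> Wu; have u0 : val u != 0 := set_mem (valP u).
  have [a [a0 ua]] := represents_mkpoint u0.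
  have -> : \pi_(quotient_topology {eq_quot (proj_rel R n)}) u = mkpoint u0.
    by congr (\pi_(_) _); apply: val_inj.
  move: ua; set h := hcoord _ => ua.
  have -> : h = a^-1 *: val u by rewrite ua scalerA mulVf// scale1r.
  by apply: hW => //; exact: invr_neq0.
move=> Wu; have u0 : val u != 0 := set_mem (valP u).
have [a [a0 E]] := represents_mkpoint u0.
suff : W (val u) by []. 
rewrite E; apply: hW => //.
suff <- : \pi_(quotient_topology {eq_quot (proj_rel R n)}) u = mkpoint u0 by [].
by congr (\pi_(_) _); apply: val_inj.
Qed.

Lemma near_cone U x v : open U -> U x -> represents x v -> \forall w \near v, cone U w.
Proof. by move=> oU Ux xv; apply: open_nbhs_nbhs; split; [exact: open_cone|exists x]. Qed.

End ProjectiveTopology.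

(** * Measurability of open sets and continuous functions on R^4 *)

Section EuclideanMeasurability.
Variable R : realType.
Local Notation C := R[i].
Local Notation MR := (measurableTypeR R).
Local Notation T4 := ((MR * MR) * (MR * MR))%type.

Definition close4 (w w' : T4) (d : R) : Prop :=
  [/\ `|w'.1.1 - w.1.1| < d, `|w'.1.2 - w.1.2| < d,
      `|w'.2.1 - w.2.1| < d & `|w'.2.2 - w.2.2| < d].

Definition open4 (U : set T4) : Prop :=
  forall w, U w -> exists2 d : R, 0 < d & forall w', close4 w w' d -> U w'.

Definition cont4 (F : T4 -> R) (w : T4) : Prop :=
  forall e, 0 < e -> exists2 d : R, 0 < d &
    forall w', close4 w w' d -> `|F w' - F w| <= e.

Lemma measurable_dist_lt (q d : R) : measurable ([set x | `|x - q| < d] : set MR).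
Proof.
rewrite (_ : [set _ | _] = `]q - d, q + d[%classic) ?measurable_itv//.
apply/seteqP; split=> x /=; rewrite in_itv /= ltr_distl//.
Qed.

(** An open set is the union of the countably many cubes with rational centers and radii 1 / (n + 1)
    that it contains. *)
Lemma open4_measurable U : open4 U -> measurable U.
Proof.
move=> oU.
pose B (i : (rat * rat) * (rat * rat) * nat) : set T4 :=
  ([set x | `|x - ratr i.1.1.1| < i.2.+1%:R^-1] `*`
   [set x | `|x - ratr i.1.1.2| < i.2.+1%:R^-1]) `*`
  ([set x | `|x - ratr i.1.2.1| < i.2.+1%:R^-1] `*`
   [set x | `|x - ratr i.1.2.2| < i.2.+1%:R^-1]).
have mB i : measurable (B i).
  by apply: measurableX; apply: measurableX; exact: measurable_dist_lt.
pose D i := [set w | B i `<=` U /\ B i w].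
have -> : U = \bigcup_i D i.
  apply/seteqP; split; last first.
    by move=> w [i _ [BU]]; exact: BU.
  move=> w Uw; have [d d0 hd] := oU w Uw.
  (* Two radii must fit into d: [w] and [w'] both lie within 1 / (n + 1) of the rational center. *)
  pose n := Num.bound (2 / d).
  have dn : 2 / n.+1%:R <= d.
    rewrite ler_pdivrMr// mulrC -ler_pdivrMr//.
    apply: ltW; apply: (lt_le_trans (archi_boundP _)); first by rewrite divr_ge0// ltW.
    by rewrite ler_nat.
  have n0 : 0 < n.+1%:R^-1 :> R by rewrite invr_gt0.
  have rx (x : R) : exists q : rat, `|x - ratr q| < n.+1%:R^-1.
    have [|q] := @rat_in_itvoo R (x - n.+1%:R^-1) (x + n.+1%:R^-1).
      by rewrite ltrD2l gtrN.
    by rewrite in_itv /= => qi; exists q; rewrite distrC ltr_distl.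
  have [q1 h1] := rx w.1.1; have [q2 h2] := rx w.1.2.
  have [q3 h3] := rx w.2.1; have [q4 h4] := rx w.2.2.
  have tri (x y z : R) : `|x - z| < n.+1%:R^-1 -> `|y - z| < n.+1%:R^-1 -> `|y - x| < d.
    move=> xz yz; apply: lt_le_trans dn.
    have -> : y - x = (y - z) - (x - z) by ring.
    by apply: (le_lt_trans (ler_normB _ _)); rewrite mulrDl !mul1r ltrD.
  exists (((q1, q2), (q3, q4)), n) => //; split; last by split; split.
  move=> w' [] [/= ? ?] [/= ? ?]; apply: hd; split; apply: tri; eassumption.
apply: countable_bigcupT_measurable; first exact: countableP.
move=> i; have [BU|BU] := pselect (B i `<=` U).
  by rewrite (_ : D i = B i)//; apply/seteqP; split=> w //= [].
by rewrite (_ : D i = set0)//; apply/seteqP; split=> w //= [].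
Qed.

Lemma cont4_measurable (D : set T4) (F : T4 -> R) : open4 D ->
  (forall w, D w -> cont4 F w) -> measurable_fun D F.
Proof.
move=> oD cF; apply: (measurability (@RGenOInfty.G R) (RGenOInfty.measurableE R)).
move=> _ [_ [y ->] <-]; apply: open4_measurable => w [Dw].
rewrite /= in_itv /= andbT => yF; have [d1 d10 h1] := oD w Dw.
have e0 : 0 < (F w - y) / 2 by rewrite divr_gt0// subr_gt0.
have [d2 d20 h2] := cF w Dw _ e0.
exists (Num.min d1 d2); first by rewrite lt_min d10.
move=> w' [].
rewrite !lt_min => /andP[? ?] /andP[? ?] /andP[? ?] /andP[? ?]; split.
  by apply: h1.
rewrite /= in_itv /= andbT.
have : `|F w' - F w| <= (F w - y) / 2 by apply: h2.
rewrite ler_norml; lra.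
Qed.

Lemma continuous_abs2 : continuous (@abs2 R : C^o -> R).
Proof.
move=> z; have -> : (@abs2 R : C^o -> R) = (fun z => cabs z * cabs z).
  by apply/funext => w; rewrite abs2E expr2.
suff c : {for z, continuous (@cabs R : C^o -> R)} by exact: continuousM.
apply/(@cvgrPdist_le R R^o C^o (nbhs (z : C^o)) _ (@cabs R) (cabs z)) => e e0.
apply/nbhs_ballP; exists (e%:C%C : C) => /=.
  by rewrite ltcR.
move=> w; rewrite -ball_normE /= cabsE ltcR => zw.
by rewrite (le_trans (ler_dist_cabs _ _))// ltW.
Qed.

End EuclideanMeasurability.

Section Charts.
Variable R : realType.
Local Notation C := R[i].
Local Notation vec := 'rV[C^o]_3.
Local Notation MR := (measurableTypeR R).
Local Notation T4 := ((MR * MR) * (MR * MR))%type.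

Lemma near_vecP n (v : 'rV[C^o]_n.+1) (Q : set 'rV[C^o]_n.+1) :
  nbhs v Q <-> exists2 e : R, 0 < e &
    forall w : 'rV[C^o]_n.+1, (forall i, cabs (w 0 i - v 0 i) < e) -> Q w.
Proof.
split=> [/nbhs_ballP[e /= /ltc_pos_real[r r0 ->] h]|[e e0 h]].
  exists r => // w wv; apply: h; split=> [|i j]; first by rewrite ltcR.
  rewrite ord1 -ball_normE /= distrC cabsE ltcR.
  exact: wv.
apply/nbhs_ballP; exists (e%:C%C : C) => /=; first by rewrite ltcR.
move=> w [_ wv]; apply: h => i; have := wv 0 i.
by rewrite -ball_normE /= distrC cabsE ltcR.
Qed.

Lemma holo_line n (g : 'rV[C^o]_n.+1 -> C^o) (v w : 'rV[C^o]_n.+1) (t0 : C) :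
  differentiable g (v + t0 *: w) -> holo (fun t => g (v + t *: w)) t0.
Proof.
move=> dg; apply: (@differentiable_comp C C^o 'rV[C^o]_n.+1 C^o (fun t : C^o => v + t *: w) g) => //.
Qed.

Lemma continuous_line n (g : 'rV[C^o]_n.+1 -> C^o) (v w : 'rV[C^o]_n.+1) (t0 : C) :
  {for v + t0 *: w, continuous g} -> ccont (fun t => g (v + t *: w)) t0.
Proof.
move=> cg; apply/continuous_ccont.
apply: (@continuous_comp C^o 'rV[C^o]_n.+1 C^o (fun t : C^o => v + t *: w) g) => //.
by apply: (@differentiable_continuous C C^o 'rV[C^o]_n.+1); exact: ex_diff.
Qed.

Lemma chart_close (i : 'I_3) (w w' : T4) (d : R) : 0 < d -> close4 w w' (d / 2) ->
  forall j, cabs (chart i w' 0 j - chart i w 0 j) < d.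
Proof.
move=> d0 [h1 h2 h3 h4] j; rewrite /chart !mxE; case: unlift => [k|].
  by case: ifP => _; rewrite (le_lt_trans (cabs_le_ReIm _))//=; lra.
by rewrite subrr cabs0.
Qed.

Lemma chart_nbhs (i : 'I_3) (w : T4) (Q : set vec) : nbhs (chart i w) Q ->
  exists2 d : R, 0 < d & forall w', close4 w w' d -> Q (chart i w').
Proof.
move=> /near_vecP[e e0 h]; exists (e / 2); first by rewrite divr_gt0.
by move=> w' ww'; apply: h => j; exact: chart_close.
Qed.

Lemma open4_chart (i : 'I_3) (O : set vec) : open O -> open4 (chart i @^-1` O).
Proof. by move=> oO w Ow; apply: chart_nbhs; exact: open_nbhs_nbhs. Qed.

Lemma cont4_chart (i : 'I_3) (g : vec -> R) (w : T4) :
  {for chart i w, continuous g} -> cont4 (fun w => g (chart i w)) w.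
Proof.
move=> /cvgrPdist_le cg e e0; have [d d0 h] := chart_nbhs (cg e e0).
by exists d => // w' ww'; rewrite distrC; exact: h.
Qed.

Lemma continuous_coord (i : 'I_3) : continuous (fun v : vec => v 0 i : C^o).
Proof. by move=> v; apply: differentiable_continuous; exact: differentiable_coord. Qed.

Lemma continuous_abs2_comp (g : vec -> C^o) (v : vec) :
  {for v, continuous g} -> {for v, continuous (fun v => abs2 (g v))}.
Proof.
move=> cg; apply: (@continuous_comp vec C^o R g (@abs2 R)) => //.
exact: continuous_abs2.
Qed.

(** On the chart z_0 = 1, the squared distance to the center (1 : 0 : 0). *)
Definition dist2 (v : vec) : R := abs2 (v 0 1) + abs2 (v 0 2).

Lemma abs2_ge0 (z : C) : 0 <= abs2 z. Proof. by rewrite abs2E sqr_ge0. Qed.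

Lemma dist2_ge0 v : 0 <= dist2 v.
Proof. by rewrite addr_ge0 ?abs2_ge0. Qed.

Lemma continuous_dist2 : continuous dist2.
Proof.
move=> v; apply: (@continuousD R R^o vec (fun v : vec => abs2 (v 0 1)) (fun v : vec => abs2 (v 0 2)));
  by apply: continuous_abs2_comp; exact: continuous_coord.
Qed.

(** The density e^(-2 m phi), that is (|z_1|^2 + |z_2|^2)^(-m); for m > 0 it is +oo over the
    center. *)
Definition hweight (m : nat) (v : vec) : \bar R :=
  expeR (- (2 * m)%:R%:E * lines_weight v).

Lemma hweightE m v : (0 < m)%N -> hweight m v =
  if dist2 v == 0 then +oo%E else ((dist2 v ^+ m)^-1)%:E.
Proof.
move=> m0; rewrite /hweight /lines_weight -/(dist2 v).
have [->|s0] := eqVneq (dist2 v) 0.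
  rewrite le0_lneNy// gt0_muleNy ?lte_fin ?invr_gt0//.
  by rewrite lt0_muleNy// lte_fin oppr_lt0 ltr0n muln_gt0.
have sp : 0 < dist2 v by rewrite lt_def s0 dist2_ge0.
rewrite lne_EFin// -!EFinM /=; congr EFin.
have -> : - (2 * m)%:R * (2^-1 * ln (dist2 v)) = - (m%:R * ln (dist2 v)).
  by rewrite natrM; field.
by rewrite expRN expRM_natl lnK// posrE.
Qed.

Lemma hweight_ge0 m v : (0 <= hweight m v)%E.
Proof. exact: expeR_ge0. Qed.

Lemma hweight_le1 m v (G : C) : (0 < m)%N -> abs2 G <= dist2 v ^+ m ->
  ((abs2 G)%:E * hweight m v <= 1)%E.
Proof.
move=> m0 h; rewrite hweightE//; case: eqVneq => [s0|s0].
  (* At the center the weight is +oo, but |G|^2 <= 0 there and 0 * +oo = 0. *)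
  rewrite s0 expr0n eqn0Ngt m0 /= in h.
  have -> : abs2 G = 0 by apply/eqP; rewrite eq_le h abs2_ge0.
  by rewrite mul0e.
have sp : 0 < dist2 v by rewrite lt_def s0 dist2_ge0.
by rewrite -EFinM lee_fin ler_pdivrMr ?exprn_gt0// mul1r.
Qed.

Lemma hweight_ge m v (K : R) : (0 < m)%N -> 0 < K -> dist2 v <= K ->
  (((K ^+ m)^-1)%:E <= hweight m v)%E.
Proof.
move=> m0 K0 h; rewrite hweightE//; case: eqVneq => [s0|s0]; first exact: leey.
have sp : 0 < dist2 v by rewrite lt_def s0 dist2_ge0.
by rewrite lee_fin lef_pV2 ?posrE ?exprn_gt0// ler_pXn2r// nnegrE ltW.
Qed.

Lemma open_ne0 : open [set x : R | x != 0].
Proof.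
have -> : [set x : R | x != 0] = ~` [set 0].
  by apply/seteqP; split=> x /= /eqP.
by apply: closed_openC; apply: accessible_closed_set1; apply: hausdorff_accessible; exact: norm_hausdorff.
Qed.

Lemma measurable_hweight (i : 'I_3) m : (0 < m)%N ->
  measurable_fun setT (fun w : T4 => hweight m (chart i w)).
Proof.
move=> m0; under eq_fun do rewrite hweightE//.
have ms : measurable_fun setT (fun w : T4 => dist2 (chart i w)).
  apply: cont4_measurable; first by move=> w _; exists 1.
  by move=> w _; apply: cont4_chart; exact: continuous_dist2.
pose phi (s : MR) : \bar R := if s == 0 then +oo%E else ((s ^+ m)^-1)%:E.
apply: (@measurableT_comp _ _ _ _ _ _ phi) => //.
apply: measurable_fun_if => //.
- by apply: (measurable_fun_bool true); rewrite setTI (_ : _ @^-1` _ = [set 0])//;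
    apply/seteqP; split=> x /= /eqP.
- apply/measurable_EFinP.
  rewrite (_ : _ `&` _ = [set x : R | x != 0]); last first.
    by apply/seteqP; split=> x /=; [case=> _ /negbT|move=> /negbTE].
  apply: open_continuous_measurable_fun; first exact: open_ne0.
  move=> x; rewrite inE /= => x0.
  apply: (@continuous_comp R R R (fun x => x ^+ m) (fun x => x^-1)).
    exact: exprn_continuous.
  by apply: inv_continuous; rewrite expf_neq0.
Qed.

End Charts.

(** * Order of vanishing at the center *)

Section VanishingOrder.
Variable R : realType.
Local Notation C := R[i].
Local Notation vec := 'rV[C^o]_3.
Local Notation P2 := (projspace R 2).
Local Notation MR := (measurableTypeR R).
Local Notation T4 := ((MR * MR) * (MR * MR))%type.

(* The integrals of the library are lower integrals, so that monotonicity does *)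
(* not require measurability.                                                  *)
Lemma le_lower_integral d (T : measurableType d) (mu : {measure set T -> \bar R})
    (A B : set T) (f g : T -> \bar R) : (forall x, 0 <= f x)%E ->
  (forall x, 0 <= g x)%E -> (forall x, A x -> B x /\ (f x <= g x)%E) ->
  (\int[mu]_(x in A) f x <= \int[mu]_(x in B) g x)%E.
Proof.
move=> f0 g0 AB; rewrite !ge0_integralE//; apply: le_ereal_sup => _ [h hf <-].
exists h => // x; apply: (le_trans (hf x)); rewrite !patchE.
case: ifPn => [xA|_]; last by case: ifP.
by rewrite inE in xA; have [Bx fg] := AB x xA; rewrite ifT// inE.
Qed.

Lemma integral_subset_le d (T : measurableType d) (mu : {measure set T -> \bar R})
    (A B : set T) (f : T -> \bar R) : (forall x, 0 <= f x)%E -> A `<=` B ->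
  (\int[mu]_(x in A) f x <= \int[mu]_(x in B) f x)%E.
Proof. by move=> f0 AB; apply: le_lower_integral => // x /AB. Qed.

Definition vec3 (a b c : C) : vec := \row_j [:: a; b; c]`_j.

Lemma vec3E (v : vec) : v = vec3 (v 0 0) (v 0 1) (v 0 2).
Proof.
apply/rowP => -[[|[|[|//]]] h]; rewrite mxE /=; congr (v 0 _); exact: val_inj.
Qed.

Lemma vec3D a b c a' b' c' :
  vec3 a b c + vec3 a' b' c' = vec3 (a + a') (b + b') (c + c').
Proof. by apply/rowP => -[[|[|[|//]]] h]; rewrite !mxE. Qed.

Lemma vec3Z k a b c : k *: vec3 a b c = vec3 (k * a) (k * b) (k * c).
Proof. by apply/rowP => -[[|[|[|//]]] h]; rewrite !mxE. Qed.

Lemma vec30 a b c : (vec3 a b c) 0 0 = a. Proof. by rewrite mxE. Qed.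
Lemma vec31 a b c : (vec3 a b c) 0 1 = b. Proof. by rewrite mxE. Qed.
Lemma vec32 a b c : (vec3 a b c) 0 2 = c. Proof. by rewrite mxE. Qed.

Lemma vec3_neq0 a b c : a != 0 \/ b != 0 \/ c != 0 -> vec3 a b c != 0.
Proof.
move=> h; apply/eqP => e; move: h.
have := congr1 (fun v : vec => v 0 0) e; have := congr1 (fun v : vec => v 0 1) e.
have := congr1 (fun v : vec => v 0 2) e; rewrite /= vec30 vec31 vec32 !mxE => -> -> ->.
by rewrite eqxx => -[|[|]].
Qed.

Lemma chart0E (w : T4) :
  chart ord0 w = vec3 1 (w.1.1 +i* w.1.2)%C (w.2.1 +i* w.2.2)%C.
Proof.
apply/rowP => -[[|[|[|//]]] h]; rewrite !mxE; case: unliftP => [k|] /(congr1 val) //=.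
  by rewrite /fintype.bump /= add1n => -[k0]; rewrite ifT//; apply/eqP/val_inj.
rewrite /fintype.bump /= add1n => -[k1]; rewrite ifF//; apply/eqP => k0.
by rewrite k0 in k1.
Qed.

Lemma measurable_L2 (g : vec -> C^o) (i : 'I_3) (m : nat) (U : set P2) :
  (0 < m)%N -> open U -> (forall v, cone U v -> differentiable g v) ->
  measurable_fun (chart i @^-1` cone U : set T4)
    (fun w => (abs2 (g (chart i w)))%:E * hweight m (chart i w))%E.
Proof.
move=> m0 oU dg; apply: emeasurable_funM; last first.
  by apply: measurable_funS (measurable_hweight i m0).
apply/measurable_EFinP; apply: cont4_measurable.
  by apply: open4_chart; exact: open_cone.
move=> w Uw; apply: (@cont4_chart R i (fun v => abs2 (g v))).
by apply: continuous_abs2_comp; apply: differentiable_continuous; exact: dg.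
Qed.

Lemma measurable_cone (i : 'I_3) (U : set P2) : open U ->
  measurable (chart i @^-1` cone U : set T4).
Proof. by move=> oU; apply: open4_measurable; apply: open4_chart; exact: open_cone. Qed.

(** On the product of the boxes of radius r = |t| around t b and t c the weight is at least a
    constant times r^(-2m). The finite weighted norm thus bounds the L^2 norm there by a constant
    times r^m, and the mean value inequality in two variables divides this by r^2. *)
Lemma L2_vanishing (m : nat) (g : vec -> C^o) (U U' : set P2) (p : P2) (b c : C) :
  (0 < m)%N -> open U -> open U' -> U p -> U' p -> represents p (vec3 1 0 0) ->
  (forall v, cone U v -> differentiable g v) ->
  (\int[@leb4 R]_(w in chart ord0 @^-1` cone U')
     ((abs2 (g (chart ord0 w)))%:E * hweight m (chart ord0 w)) < +oo)%E ->
  exists K d : R, 0 < d /\ forall t : C, t != 0 -> cabs t < d ->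
    abs2 (g (vec3 1 (t * b) (t * c))) * cabs t ^+ 4 <= K * (cabs t ^+ 2) ^+ m.
Proof.
move=> m0 oU oU' Up U'p rp dg; rewrite leb4E => fin.
pose V := U `&` U'; have oV : open V by exact: openI.
have Vp : V p by [].
pose I w := ((abs2 (g (chart ord0 w)))%:E * hweight m (chart ord0 w))%E.
have I0 (w : T4) : (0 <= I w)%E by rewrite mule_ge0 ?lee_fin ?abs2_ge0 ?hweight_ge0.
have finV : (\int[@leb4m R]_(w in chart ord0 @^-1` cone V) I w < +oo)%E.
  apply: le_lt_trans fin; apply: integral_subset_le => // w; apply: coneS.
  exact: subIsetr.
set A := (\int[@leb4m R]_(w in chart ord0 @^-1` cone V) I w)%E in finV.
have A0 : (0 <= A)%E by apply: integral_ge0 => w _.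
have [a a0 Aa] : exists2 a : R, 0 <= a & A = a%:E.
  have fA : A \is a fin_num by rewrite ge0_fin_numE.
  by exists (fine A); [exact: fine_ge0|rewrite fineK].
have dgV v : cone V v -> differentiable g v.
  by move=> Vv; apply: dg; apply: coneS Vv; exact: subIsetl.
have [d d0 hd] : exists2 d : R, 0 < d & forall w' : T4,
    close4 (((0 : R), (0 : R)), ((0 : R), (0 : R))) w' d -> cone V (chart ord0 w').
  apply: chart_nbhs; rewrite chart0E /=.
  exact: near_cone oV Vp rp.
pose Q := cabs b + cabs c; have Q0 : 0 <= Q by rewrite addr_ge0 ?cabs_ge0.
have Q1 : 0 < 1 + Q by rewrite ltr_pwDl.
(* The number 256 is 16^2 from [L2_mean2], and the m-th power comes from the bound 4 (1 + Q)^2 r^2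
   for [dist2] on the boxes. The second witness keeps the boxes inside the cone of [V]. *)
exists (256 * (4 * (1 + Q) ^+ 2) ^+ m * a), (d / (1 + Q)); split; first by rewrite divr_gt0.
move=> t t0; rewrite ltr_pdivlMr//; set r := cabs t => rd.
have r0 : 0 < r by rewrite cabs_gt0.
have box_bound (u : C) (x y : R) : u = b \/ u = c -> box (t * u) r (x +i* y)%C ->
    `|x| <= r * (1 + Q) /\ `|y| <= r * (1 + Q).
  move=> ubc; have uQ : cabs u <= Q.
    by rewrite /Q; case: ubc => ->; rewrite ?lerDl ?lerDr cabs_ge0.
  have tu : cabs (t * u) <= r * Q by rewrite cabsM ler_pM2l.
  have := le_trans (ler_Re_cabs _) tu; have := le_trans (ler_Im_cabs _) tu.
  rewrite /box /= (mulrDr r 1 Q) (mulr1 r) !ler_norml; move: (complex.Re (t * u)) (complex.Im (t * u)).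
  clear; move=> p q /andP[? ?] /andP[? ?] [/andP[? ?] /andP[? ?]].
  by split; apply/andP; split; lra.
pose K1 := 4 * (1 + Q) ^+ 2 * r ^+ 2.
have K10 : 0 < K1 by rewrite !mulr_gt0 ?exprn_gt0.
pose B : set T4 := [set w | box (t * b) r (w.1.1 +i* w.1.2)%C /\ box (t * c) r (w.2.1 +i* w.2.2)%C].
have BV w : B w -> cone V (chart ord0 w).
  move=> [B1 B2]; apply: hd.
  have [h1 h2] := box_bound b _ _ (or_introl erefl) B1.
  have [h3 h4] := box_bound c _ _ (or_intror erefl) B2.
  by split => /=; rewrite subr0 (le_lt_trans _ rd).
have Bd w : B w -> dist2 (chart ord0 w) <= K1.
  move=> [B1 B2]; rewrite chart0E /dist2 vec31 vec32 /abs2 /=.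
  have [h1 h2] := box_bound b _ _ (or_introl erefl) B1.
  have [h3 h4] := box_bound c _ _ (or_intror erefl) B2.
  have sq (x : R) : `|x| <= r * (1 + Q) -> x ^+ 2 <= (r * (1 + Q)) ^+ 2.
    by move=> hx; rewrite -(real_normK (num_real x)) ler_pXn2r// nnegrE ?mulr_ge0 ?ltW.
  have -> : K1 = (r * (1 + Q)) ^+ 2 + (r * (1 + Q)) ^+ 2 +
      ((r * (1 + Q)) ^+ 2 + (r * (1 + Q)) ^+ 2) by rewrite /K1; ring.
  by rewrite !lerD ?sq.
have mB : measurable B.
  have mI (u s : R) : measurable ([set x : R | u - s <= x <= u + s] : set MR).
    rewrite (_ : [set _ | _] = `[u - s, u + s]%classic) ?measurable_itv//.
  rewrite (_ : B = ([set x | complex.Re (t * b) - r <= x <= complex.Re (t * b) + r] `*`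
    [set x | complex.Im (t * b) - r <= x <= complex.Im (t * b) + r]) `*`
    ([set x | complex.Re (t * c) - r <= x <= complex.Re (t * c) + r] `*`
    [set x | complex.Im (t * c) - r <= x <= complex.Im (t * c) + r])).
    by apply: measurableX; apply: measurableX; exact: mI.
  by apply/seteqP; split.
have mIB : measurable_fun B I.
  have mV := @measurable_L2 g ord0 m V m0 oV dgV.
  have mD := measurable_cone ord0 oV.
  exact: (measurable_funS mD BV mV).
(* The factor [K1 ^+ m] compensates for the lower bound of the weight, so that [F] dominates |g|^2
   on the boxes. *)
pose F (w : T4) := ((K1 ^+ m)%:E * (I \_ B) w)%E.
have IB0 w : (0 <= (I \_ B) w)%E by rewrite patchE; case: ifP.
have mIT : measurable_fun setT (I \_ B) := (measurable_restrictT I mB).1 mIB.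
have mF : measurable_fun setT F by exact: measurable_funeM.
have F0 w : (0 <= F w)%E by rewrite mule_ge0// lee_fin exprn_ge0// ltW.
pose G (z1 z2 : C) : C := g (vec3 1 z1 z2).
have boxV z1 z2 : box (t * b) r z1 -> box (t * c) r z2 -> cone V (vec3 1 z1 z2).
  case: z1 => x1 y1; case: z2 => x2 y2 B1 B2.
  by have := BV ((x1, y1), (x2, y2)) (conj B1 B2); rewrite chart0E.
have holoG z1 z2 : box (t * b) r z1 -> box (t * c) r z2 ->
    holo (G^~ z2) z1 /\ holo (G z1) z2.
  move=> B1 B2; have dV := dgV _ (boxV _ _ B1 B2); split.
    have -> : G^~ z2 = (fun z => g (vec3 1 0 z2 + z *: vec3 0 1 0)).
      by apply/funext => z; rewrite /G vec3Z vec3D !mulr0 mulr1 !addr0 add0r.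
    by apply: holo_line; rewrite vec3Z vec3D !mulr0 mulr1 !addr0 add0r.
  have -> : G z1 = (fun z => g (vec3 1 z1 0 + z *: vec3 0 0 1)).
    by apply/funext => z; rewrite /G vec3Z vec3D !mulr0 mulr1 !addr0 add0r.
  by apply: holo_line; rewrite vec3Z vec3D !mulr0 mulr1 !addr0 add0r.
have GF x1 y1 x2 y2 : box (t * b) r (x1 +i* y1)%C -> box (t * c) r (x2 +i* y2)%C ->
    ((abs2 (G (x1 +i* y1)%C (x2 +i* y2)%C))%:E <= F ((x1, y1), (x2, y2)))%E.
  move=> B1 B2; have Bw : B ((x1, y1), (x2, y2)) by [].
  rewrite /F patchE ifT ?inE// /I muleCA chart0E /= -/(G _ _).
  rewrite -[X in (X <= _)%E]mule1 lee_pmul ?lee_fin ?abs2_ge0//.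
  have := hweight_ge m0 K10 (Bd _ Bw); rewrite chart0E /= => hw.
  apply: le_trans (lee_wpmul2l _ hw); last by rewrite lee_fin exprn_ge0// ltW.
  by rewrite -EFinM mulfV// expf_neq0// gt_eqF.
have := L2_mean2 r0 holoG mF F0 GF.
have intF : (\int[@leb4m R]_w F w <= (K1 ^+ m * a)%:E)%E.
  rewrite /F ge0_integralZl//; last first.
  - by rewrite lee_fin exprn_ge0// ltW.
  rewrite EFinM; apply: lee_wpmul2l; first by rewrite lee_fin exprn_ge0// ltW.
  rewrite -Aa -integral_mkcond; apply: integral_subset_le => //; exact: BV.
have r40 : 0 < r ^+ 4 by rewrite exprn_gt0.
move=> /le_trans/(_ (lee_wpmul2l _ intF)); rewrite lee_fin => /(_ (exprn_ge0 _ _)).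
have r2 : 0 <= 16 / r ^+ 2 by rewrite divr_ge0// exprn_ge0// ltW.
move=> /(_ r2); rewrite -EFinM lee_fin /G -(ler_pM2r r40) => /le_trans; apply.
rewrite le_eqVlt; apply/orP; left; apply/eqP; rewrite /K1 [(_ * r ^+ 2) ^+ m]exprMn.
set X := (4 * (1 + Q) ^+ 2) ^+ m; set Y := (r ^+ 2) ^+ m.
by field; rewrite gt_eqF.
Qed.

End VanishingOrder.

Section MultiplierIdeal.
Variable R : realType.
Local Notation C := R[i].
Local Notation vec := 'rV[C^o]_3.
Local Notation P2 := (projspace R 2).
Local Notation MR := (measurableTypeR R).
Local Notation T4 := ((MR * MR) * (MR * MR))%type.
Local Notation phi := (@lines_weight R).

Lemma open_coord_neq0 (j : 'I_3) : open [set v : vec | v 0 j != 0].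
Proof.
have -> : [set v : vec | v 0 j != 0] = (fun v : vec => v 0 j : C^o) @^-1` (~` [set (0 : C^o)]).
  by apply/seteqP; split=> v /= /eqP.
apply: open_comp; first by move=> v _; exact: continuous_coord.
by apply: closed_openC; apply: accessible_closed_set1; apply: hausdorff_accessible; exact: norm_hausdorff.
Qed.

Lemma open_affine (j : 'I_3) : open [set x : P2 | hcoord x 0 j != 0].
Proof.
apply: (@open_invariant R 2 [set v | v 0 j != 0]); first exact: open_coord_neq0.
by move=> v a a0 vj; rewrite /= mxE mulf_neq0.
Qed.

Lemma cone_affine (j : 'I_3) v : cone [set x : P2 | hcoord x 0 j != 0] v -> v 0 j != 0.
Proof. by case=> x /= xj [a [a0 ->]]; rewrite mxE mulf_neq0. Qed.

Lemma exists_coord_neq0 (x : P2) : exists j : 'I_3, hcoord x 0 j != 0.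
Proof.
apply: contrapT => h; have := hcoord_neq0 x; rewrite (_ : hcoord x = 0) ?eqxx//.
by apply/rowP => j; rewrite mxE; apply/eqP; apply: contrapT => /negP hj; apply: h; exists j.
Qed.

Lemma differentiable_coordX (i : 'I_3) (m : nat) (v : vec) :
  differentiable (fun v : vec => v 0 i ^+ m : C^o) v.
Proof.
apply: (@differentiable_comp C vec C^o C^o (fun v : vec => v 0 i) (fun z : C^o => z ^+ m)).
  exact: differentiable_coord.
by apply: holoX; exact: holo_id.
Qed.

Lemma O_section_coordX (i : 'I_3) (m : nat) :
  O_section m setT (fun v : vec => v 0 i ^+ m : C^o).
Proof.
split; first exact: openT.
- by move=> v _; exact: differentiable_coordX.
- by move=> v a _ _; rewrite mxE exprMn.
Qed.

Lemma O_section_div k U g (j : 'I_3) : O_section k U g ->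
  O_section 0 (U `&` [set x : P2 | hcoord x 0 j != 0]) (fun v : vec => g v / v 0 j ^+ k).
Proof.
move=> [oU dg hg]; split; first by apply: openI => //; exact: open_affine.
- move=> v; rewrite coneI => -[Uv /cone_affine vj].
  apply: (@differentiableM C vec g (fun v => (v 0 j ^+ k)^-1)); first exact: dg.
  apply: (@differentiableV C vec (fun v => v 0 j ^+ k)); first exact: differentiable_coordX.
  by rewrite expf_neq0.
- move=> v a; rewrite coneI => -[Uv /cone_affine vj] a0.
  by rewrite hg// mxE exprMn invfM mulrACA divff ?expf_neq0// expr0.
Qed.

Lemma O_germ_div k x g (j : 'I_3) : O_germ k x g -> hcoord x 0 j != 0 ->
  @O_germ R 0 x (fun v : vec => g v / v 0 j ^+ k).
Proof. by case=> U Ux Og xj; exists (U `&` [set x : P2 | hcoord x 0 j != 0]); [by split|exact: O_section_div]. Qed.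

Lemma O_germM k1 k2 x (f g : vec -> C^o) : O_germ k1 x f -> O_germ k2 x g ->
  O_germ (k1 + k2) x (fun v => f v * g v).
Proof.
move=> [U Ux [oU df hf]] [V Vx [oV dg hg]]; exists (U `&` V); first by split.
split; first exact: openI.
- move=> v; rewrite coneI => -[Uv Vv]; apply: (@differentiableM C vec f g).
    exact: df.
  exact: dg.
- by move=> v a; rewrite coneI => -[Uv Vv] a0; rewrite hf// hg// exprD mulrACA.
Qed.

Lemma O_section_lin k (U V : set P2) (f g : vec -> C^o) (a : C) :
  O_section k U f -> O_section k V g ->
  O_section k (U `&` V) (fun v => a * f v + g v).
Proof.
move=> [oU df hf] [oV dg hg]; split; first exact: openI.
- move=> v; rewrite coneI => -[Uv Vv].
  apply: (@differentiableD C vec C^o (fun v => a * f v) g); last exact: dg.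
  by apply: (@differentiableZ C vec C^o f a); exact: df.
- by move=> v b; rewrite coneI => -[Uv Vv] b0; rewrite hf// hg// mulrDr mulrCA.
Qed.

Lemma hweight_measure_ge0 (g : vec -> C^o) (i : 'I_3) m (w : T4) :
  (0 <= (abs2 (g (chart i w)))%:E * hweight m (chart i w))%E.
Proof. by rewrite mule_ge0 ?lee_fin ?abs2_ge0 ?hweight_ge0. Qed.

Lemma abs2M (z w : C) : abs2 (z * w) = abs2 z * abs2 w.
Proof. by rewrite !abs2E cabsM exprMn. Qed.

Lemma abs2D_le (z w : C) : abs2 (z + w) <= 2 * abs2 z + 2 * abs2 w.
Proof.
rewrite !abs2E; have h := ler_cabsD z w; have z0 := cabs_ge0 z; have w0 := cabs_ge0 w.
apply: (@le_trans _ _ ((cabs z + cabs w) ^+ 2)).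
  by rewrite ler_pXn2r// nnegrE ?cabs_ge0// addr_ge0.
have := sqr_ge0 (cabs z - cabs w); move: (cabs z) (cabs w); clear.
by move=> x y h; nra.
Qed.

(** From |a f + g|^2 <= 2 |a|^2 |f|^2 + 2 |g|^2. All integrals are restricted to a common open set
    on which both integrands are measurable, as additivity requires. *)
Lemma OI_section_lin m (U V : set P2) (f g : vec -> C^o) (a : C) : (0 < m)%N ->
  OI_section phi m U f -> OI_section phi m V g ->
  OI_section phi m (U `&` V) (fun v => a * f v + g v).
Proof.
move=> m0 [Of Lf] [Og Lg]; split; first exact: O_section_lin.
move=> x [Ux Vx] i xi.
have [U' [oU' U'x fU]] := Lf x Ux i xi; have [V' [oV' V'x gV]] := Lg x Vx i xi.
have [oU df _] := Of; have [oV dg _] := Og.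
pose W := (U `&` V) `&` (U' `&` V').
have oW : open W by do 2 apply: openI => //; exact: openI.
exists W; split=> //.
have mW : measurable (chart i @^-1` cone W : set T4) by exact: measurable_cone.
have WU : cone W `<=` cone U by apply: coneS => y [[]].
have WV : cone W `<=` cone V by apply: coneS => y [[]].
have mf := @measurable_L2 R f i m W m0 oW (fun v Wv => df v (WU v Wv)).
have mg := @measurable_L2 R g i m W m0 oW (fun v Wv => dg v (WV v Wv)).
pose F (w : T4) := ((abs2 (f (chart i w)))%:E * hweight m (chart i w))%E.
pose G (w : T4) := ((abs2 (g (chart i w)))%:E * hweight m (chart i w))%E.
have F0 w : (0 <= F w)%E by exact: hweight_measure_ge0.
have G0 w : (0 <= G w)%E by exact: hweight_measure_ge0.
rewrite leb4E in fU; rewrite leb4E in gV; rewrite leb4E.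
have fW : (\int[@leb4m R]_(w in chart i @^-1` cone W) F w < +oo)%E.
  apply: le_lt_trans fU; apply: integral_subset_le => // w; apply: coneS.
  by move=> y [_ []].
have gW : (\int[@leb4m R]_(w in chart i @^-1` cone W) G w < +oo)%E.
  apply: le_lt_trans gV; apply: integral_subset_le => // w; apply: coneS.
  by move=> y [_ []].
apply: (@le_lt_trans _ _ (\int[@leb4m R]_(w in chart i @^-1` cone W)
  ((2 * abs2 a)%:E * F w + 2%:E * G w))%E).
  apply: le_lower_integral.
  - by move=> w; exact: (hweight_measure_ge0 (fun v => a * f v + g v)).
  - by move=> w; rewrite adde_ge0// mule_ge0// lee_fin ?mulr_ge0 ?abs2_ge0.
  - move=> w Ww; split=> //; rewrite -/(hweight m (chart i w)) /F /G.
    set H := hweight m (chart i w).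
    have H0 : (0 <= H)%E by exact: hweight_ge0.
    rewrite !muleA -ge0_muleDl; last 2 first.
    + by rewrite -EFinM lee_fin !mulr_ge0 ?abs2_ge0.
    + by rewrite -EFinM lee_fin !mulr_ge0 ?abs2_ge0.
    apply: lee_wpmul2r => //.
    by rewrite -!EFinM -EFinD lee_fin (le_trans (abs2D_le _ _))// abs2M mulrA.
rewrite ge0_integralD//; last 4 first.
- by move=> w _; rewrite mule_ge0// lee_fin mulr_ge0 ?abs2_ge0.
- exact: measurable_funeM.
- by move=> w _; rewrite mule_ge0// lee_fin.
- exact: measurable_funeM.
rewrite !ge0_integralZl//; last by rewrite lee_fin mulr_ge0 ?abs2_ge0.
by rewrite lte_add_pinfty// lte_mul_pinfty// ?lee_fin ?mulr_ge0 ?abs2_ge0 ?integral_ge0.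
Qed.

Lemma OI_germ_lin m x (f g : vec -> C^o) (a : C) : (0 < m)%N ->
  OI_germ phi m x f -> OI_germ phi m x g ->
  OI_germ phi m x (fun v => a * f v + g v).
Proof.
move=> m0 [U Ux Of] [V Vx Og]; exists (U `&` V); [by split|exact: OI_section_lin].
Qed.

Lemma OI_germ_O m x (g : vec -> C^o) : OI_germ phi m x g -> O_germ m x g.
Proof. by case=> U Ux [Og _]; exists U. Qed.

(** In chart [i] its points have coordinates of modulus less than [K]. Written with homogeneous
    coordinates on both sides, the condition is invariant under scaling. *)
Definition bounded_chart (i : 'I_3) (K : R) : set P2 :=
  [set x | forall j, cabs (hcoord x 0 j) < K * cabs (hcoord x 0 i)].

Lemma open_bounded_chart i K : open (bounded_chart i K).
Proof.
apply: (@open_invariant R 2 [set v | forall j, cabs (v 0 j) < K * cabs (v 0 i)]).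
  rewrite openE => v vK; rewrite /interior; near=> w; rewrite /=.
  near: w; apply: filter_forall => j.
  have cj k : {for v, continuous (fun w : vec => cabs (w 0 k))}.
    apply: (@continuous_comp vec C^o R (fun w => w 0 k) (@cabs R)).
      exact: continuous_coord.
    apply/(@cvgrPdist_le R R^o C^o (nbhs (v 0 k : C^o)) _ (@cabs R)) => e e0.
    apply/nbhs_ballP; exists (e%:C%C : C) => /=; first by rewrite ltcR.
    move=> z; rewrite -ball_normE /= cabsE ltcR => hz.
    by rewrite (le_trans (ler_dist_cabs _ _))// ltW.
  have cK : {for v, continuous (fun w : vec => K * cabs (w 0 i) - cabs (w 0 j))}.
    apply: (@continuousB R R^o vec (fun w : vec => K * cabs (w 0 i)) (fun w => cabs (w 0 j))) => //.
    by apply: (@continuousM R vec (fun=> K)); [exact: (@cst_continuous vec R K v)|exact: cj].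
  have d0 : 0 < K * cabs (v 0 i) - cabs (v 0 j) by rewrite subr_gt0.
  have near_gt : nbhs v (fun t : vec => 0 < K * cabs (t 0 i) - cabs (t 0 j)).
    exact: (@cvgr_gt R vec (nbhs v) _ _ _ cK _ d0).
  by apply: filterS near_gt => w; rewrite subr_gt0.
move=> v a a0 h j; rewrite !mxE !cabsM mulrCA ltr_pM2l ?cabs_gt0//; exact: h.
Unshelve. all: by end_near. Qed.

(** The weighted integrand is at most 1, and a bounded part of a chart has finite volume. *)
Lemma OI_section_bounded m (g : vec -> C^o) : (0 < m)%N -> O_section m setT g ->
  (forall v, abs2 (g v) <= dist2 v ^+ m) -> OI_section phi m setT g.
Proof.
move=> m0 Og bg; split=> // x _ i xi.
pose K := 1 + \sum_j cabs (hcoord x 0 j) / cabs (hcoord x 0 i).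
have x0 : 0 < cabs (hcoord x 0 i) by rewrite cabs_gt0.
exists (bounded_chart i K); split; first exact: open_bounded_chart.
  move=> j; rewrite -ltr_pdivrMr//; apply: (@le_lt_trans _ _ (\sum_j cabs (hcoord x 0 j) / cabs (hcoord x 0 i))).
    rewrite (bigD1 j)//= lerDl sumr_ge0// => k _.
    by rewrite divr_ge0 ?cabs_ge0.
  by rewrite ltrDr.
pose I1 : set MR := `[- K, K]%classic.
rewrite leb4E; apply: (@le_lt_trans _ _ (\int[@leb4m R]_(w in (I1 `*` I1) `*` (I1 `*` I1)) cst 1 w)%E).
  apply: le_lower_integral => //.
  - by move=> w; exact: hweight_measure_ge0.
  - move=> w Ww; split; last exact: hweight_le1.
    have hK j : cabs (chart i w 0 j) <= K.
      case: Ww => y yK [a [a0 cE]].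
      have ci : chart i w 0 i = 1 by rewrite mxE; case: unliftP => // k /eqP; rewrite (negbTE (neq_lift _ _)).
      have := yK j; rewrite -(ltr_pM2l (_ : 0 < cabs a)) ?cabs_gt0//.
      rewrite mulrCA -!cabsM.
      have -> : a * hcoord y 0 j = chart i w 0 j by rewrite cE mxE.
      have -> : a * hcoord y 0 i = chart i w 0 i by rewrite cE mxE.
      by rewrite ci cabs1 mulr1 => /ltW.
    have h0 : chart i w 0 (lift i (0 : 'I_2)) = (w.1.1 +i* w.1.2)%C.
      by rewrite mxE liftK eqxx.
    have h1 : chart i w 0 (lift i (1 : 'I_2)) = (w.2.1 +i* w.2.2)%C.
      by rewrite mxE liftK.
    have := hK (lift i (0 : 'I_2)); rewrite h0 => k0.
    have := hK (lift i (1 : 'I_2)); rewrite h1 => k1.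
    have bnd (z : C) : cabs z <= K -> (complex.Re z \in `[- K, K]) /\ (complex.Im z \in `[- K, K]).
      move=> zK; rewrite !in_itv /= -!ler_norml.
      by rewrite (le_trans (ler_Re_cabs z)) ?(le_trans (ler_Im_cabs z)).
    by have [? ?] := bnd _ k0; have [? ?] := bnd _ k1; split; split.
rewrite integral_cst//; last by apply: measurableX; apply: measurableX; exact: measurable_itv.
have mI : measurable I1 by exact: measurable_itv.
have fI : (@lebesgue_measure R I1 < +oo)%E.
  by rewrite lebesgue_measure_itv /=; case: ifP => _; rewrite ?ltry.
have f2 : (@leb2 R (I1 `*` I1) < +oo)%E.
  by rewrite /leb2 product_measure1E// lte_mul_pinfty// ge0_fin_numE.
rewrite mul1e /leb4m /= product_measure1E//; [|exact: measurableX..].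
by rewrite lte_mul_pinfty// ge0_fin_numE.
Qed.

Lemma OI_coordX m (i : 'I_3) : (0 < m)%N -> i != 0 ->
  OI_section phi m setT (fun v : vec => v 0 i ^+ m : C^o).
Proof.
move=> m0 i0; apply: OI_section_bounded => //; first exact: O_section_coordX.
move=> v; rewrite abs2E cabsX -exprM mulnC exprM -abs2E.
rewrite ler_pXn2r ?nnegrE ?abs2_ge0 ?dist2_ge0//.
have [->|->] : i = 1 \/ i = 2.
  by case: i i0 => -[|[|[|//]]] h // _; [left|right]; exact: val_inj.
- by rewrite /dist2 lerDl abs2_ge0.
- by rewrite /dist2 lerDr abs2_ge0.
Qed.

End MultiplierIdeal.

(** * Germs on a curve modulo torsion *)

Section TorsionFree.
Variable R : realType.
Local Notation C := R[i].
Local Notation vec := 'rV[C^o]_3.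
Local Notation P2 := (projspace R 2).
Local Notation phi := (@lines_weight R).
Variable D : set P2.

(* g represents the zero section of O_D near x. *)
Definition null_near (x : P2) (g : vec -> C^o) : Prop :=
  exists U : set P2, [/\ open U, U x & forall v, cone (U `&` D) v -> g v = 0].

Lemma null_near_sum (k : nat) (x : P2) (u : 'I_k -> vec -> C^o) :
  (forall j, null_near x (u j)) ->
  exists U : set P2, [/\ open U, U x & forall j v, cone (U `&` D) v -> u j v = 0].
Proof.
elim: k u => [|k IH] u hu.
  by exists setT; split; [exact: openT| |case].
have [U [oU Ux hU]] := IH (fun j => u (lift ord0 j)) (fun j => hu _).
have [V [oV Vx hV]] := hu ord0.
exists (U `&` V); split; [exact: openI|by split|].
move=> j v Uv; case: (unliftP ord0 j) => [j'|] ->.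
  by apply: hU; apply: coneS Uv => y [[]].
by apply: hV; apply: coneS Uv => y [[]].
Qed.

Lemma ideal_germ_null x u : ideal_germ D x u -> null_near x u.
Proof. by case. Qed.

(** Divided by z_j^m, the germ g becomes a germ of functions. Its product with the nonzerodivisor a
    vanishes on [D], because a g is a combination of germs in the ideal; so the quotient itself lies
    in the ideal. *)
Lemma torsion_null m x g : torsion_germ phi D m x g -> null_near x g.
Proof.
move=> [Og [a [[Oa nz] [k [u [s [us [U [oU Ux ag]]]]]]]]].
have [j xj] := exists_coord_neq0 x.
have [V [oV Vx hV]] := null_near_sum (fun j => ideal_germ_null (us j).1).
have Ob : O_germ 0 x (fun v : vec => g v / v 0 j ^+ m).
  by apply: O_germ_div => //; exact: OI_germ_O Og.
have : ideal_germ D x (fun v : vec => g v / v 0 j ^+ m).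
  apply: (nz _ Ob); split; first exact: (O_germM Oa Ob).
  exists (U `&` V); split; [exact: openI|by split|] => v Uv.
  rewrite mulrA ag ?big1 ?mul0r//.
    by move=> i _; rewrite (hV i) ?mul0r//; apply: coneS Uv => y [[]].
  by apply: coneS Uv => y [[]].
case=> _ [W [oW Wx hW]].
exists (W `&` [set x : P2 | hcoord x 0 j != 0]); split.
- by apply: openI => //; exact: open_affine.
- by split.
- move=> v Wv; have vj : v 0 j != 0.
    by apply: cone_affine; apply: coneS Wv => y [[]].
  have /eqP : g v / v 0 j ^+ m = 0 by apply: hW; apply: coneS Wv => y [[]].
  by rewrite mulf_eq0 invr_eq0 expf_eq0 (negbTE vj) andbF orbF => /eqP.
Qed.

(* The part of the definition of a global section that is stable under linear *)
(* combinations for a reason visible on representatives.                      *)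
Definition weak_section (m : nat) (s : P2 -> vec -> C^o) : Prop :=
  forall x, D x -> exists U g, [/\ U x, OI_section phi m U g &
    forall y, U y -> D y -> OI_germ phi m y (fun v => s y v - g v) /\
      null_near y (fun v => s y v - g v)].

Lemma global_weak m s : global_section phi D m s -> weak_section m s.
Proof.
move=> gs x Dx; have [U [g [Ux OU h]]] := gs x Dx; exists U, g; split=> // y Uy Dy.
have t := h y Uy Dy; split; first by case: t.
exact: torsion_null t.
Qed.

Lemma weak_section_lin m s1 s2 (a : C) : (0 < m)%N -> weak_section m s1 -> weak_section m s2 ->
  weak_section m (fun x v => a * s1 x v + s2 x v).
Proof.
move=> m0 h1 h2 x Dx; have [U [f [Ux Of hf]]] := h1 x Dx.
have [V [g [Vx Og hg]]] := h2 x Dx.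
exists (U `&` V), (fun v => a * f v + g v); split; [by split|exact: OI_section_lin|].
move=> y [Uy Vy] Dy; have [If [U1 [oU1 U1y z1]]] := hf y Uy Dy.
have [Ig [U2 [oU2 U2y z2]]] := hg y Vy Dy.
have -> : (fun v : vec => a * s1 y v + s2 y v - (a * f v + g v)) =
    (fun v => a * (s1 y v - f v) + (s2 y v - g v)).
  by apply/funext => v; ring.
split; first exact: OI_germ_lin.
exists (U1 `&` U2); split; [exact: openI|by split|] => v Uv.
rewrite z1 ?z2 ?mulr0 ?addr0//; first by apply: coneS Uv => z [[]].
by apply: coneS Uv => z [[]].
Qed.

Lemma OI_section0 m : (0 < m)%N -> OI_section phi m setT (fun=> 0).
Proof.
move=> m0; apply: OI_section_bounded => //.
  split; [exact: openT|by move=> v _; exact: differentiable_cst|].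
  by move=> v a _ _; rewrite mulr0.
by move=> v; rewrite abs2E cabs0 expr0n exprn_ge0// dist2_ge0.
Qed.

Lemma weak_section_sum m (k : nat) (s : 'I_k -> P2 -> vec -> C^o) (c : 'I_k -> C) :
  (0 < m)%N -> (forall j, weak_section m (s j)) ->
  weak_section m (fun x v => \sum_(j < k) c j * s j x v).
Proof.
move=> m0; elim: k s c => [|k IH] s c hs.
  move=> x Dx; exists setT, (fun=> 0); split=> //; first exact: OI_section0.
  move=> y _ _; have -> : (fun v : vec => \sum_(j < 0) c j * s j y v - 0) = (fun=> 0).
    by apply/funext => v; rewrite big_ord0 subr0.
  split; first by exists setT => //; exact: OI_section0.
  by exists setT; split; first exact: openT.
have := weak_section_lin (c ord0) m0 (hs ord0)
  (IH (fun j => s (lift ord0 j)) (fun j => c (lift ord0 j)) (fun j => hs _)).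
congr (weak_section m _).
by apply/funext => x; apply/funext => v; rewrite big_ord_recl.
Qed.

Lemma weak_section_germ m s x : (0 < m)%N -> weak_section m s -> D x -> OI_germ phi m x (s x).
Proof.
move=> m0 ws Dx; have [U [g [Ux Og h]]] := ws x Dx.
have [h1 _] := h x Ux Dx; have h2 : OI_germ phi m x g by exists U.
have := OI_germ_lin 1 m0 h1 h2; congr (OI_germ _ _ _ _).
by apply/funext => v; rewrite mul1r subrK.
Qed.

End TorsionFree.

(** * Lines through the center and the line at infinity *)

Section LineThroughCenter.
Variable R : realType.
Local Notation C := R[i].
Local Notation vec := 'rV[C^o]_3.
Local Notation P2 := (projspace R 2).
Local Notation phi := (@lines_weight R).
Variables b c : C.
Hypothesis bc0 : b != 0 \/ c != 0.

Definition center_line : set P2 := [set x | hcoord x 0 1 * c = hcoord x 0 2 * b].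

Lemma cone_center_line v : v != 0 -> cone center_line v <-> v 0 1 * c = v 0 2 * b.
Proof.
move=> v0; have [x xv] := represents_exists v0; split.
  by case=> y yl [a [_ ->]]; rewrite !mxE -!mulrA; congr (a * _).
move=> vl; exists x => //; case: xv vl => a [a0 ->]; rewrite !mxE -!mulrA.
exact: mulfI.
Qed.

Lemma center_line_coord v : cone center_line v ->
  exists al be : C, v = vec3 al (be * b) (be * c).
Proof.
move=> Lv; have vl := (cone_center_line (cone_neq0 Lv)).1 Lv.
case: bc0 => [b0|c0].
  exists (v 0 0), (v 0 1 / b); rewrite {1}[v]vec3E; congr vec3; first by rewrite divfK.
  by rewrite mulrAC vl mulfK.
exists (v 0 0), (v 0 2 / c); rewrite {1}[v]vec3E; congr vec3; last by rewrite divfK.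
by rewrite mulrAC -vl mulfK.
Qed.

Lemma line_vec_neq0 al be : al != 0 \/ be != 0 -> vec3 al (be * b) (be * c) != 0.
Proof.
case=> h; apply: vec3_neq0; first by left.
by right; case: bc0 => h'; [left|right]; rewrite mulf_neq0.
Qed.

Lemma cone_line_vec al be : al != 0 \/ be != 0 ->
  cone center_line (vec3 al (be * b) (be * c)).
Proof.
move=> h; apply/cone_center_line; first exact: line_vec_neq0.
by rewrite vec31 vec32 mulrAC.
Qed.

(** The germs of [s] at the points of the line near x all agree on the line with one [g]. So v -> s
    (pt v) v is a function on the cone over the line, locally the restriction of a holomorphic
    function. *)
Lemma weak_section_local m s x : weak_section center_line m s -> center_line x ->
  exists U g, [/\ open U, U x, OI_section phi m U g,
    (forall v, cone (U `&` center_line) v -> s (pt v) v = g v) &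
    null_near center_line x (fun v => s x v - g v)].
Proof.
move=> ws Dx; have [U [g [Ux Og h]]] := ws x Dx; exists U, g; split=> //.
- by case: Og => -[].
- move=> v Uv; have v0 := cone_neq0 Uv; have rv := represents_pt v0.
  have [Uy Dy] : (U `&` center_line) (pt v) by exact: cone_represents rv Uv.
  have [_ [W [oW Wy hW]]] := h _ Uy Dy.
  by apply/eqP; rewrite -subr_eq0; apply/eqP; apply: hW; exists (pt v).
- by have [] := h x Ux Dx.
Qed.

(** The two excluded points of the line, the center and the point on z_0 = 0, are limits of the
    others. At the center the multiplier used for torsion vanishes, and the other point is not
    reached by the affine parameter t = be / al. *)
Lemma center_line_density (U : set P2) (g : vec -> C^o) : open U ->
  (forall v, cone U v -> differentiable g v) ->
  (forall al be : C, al != 0 -> be != 0 -> cone U (vec3 al (be * b) (be * c)) ->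
     g (vec3 al (be * b) (be * c)) = 0) ->
  forall v, cone (U `&` center_line) v -> g v = 0.
Proof.
move=> oU dg main v; rewrite coneI => -[Uv Lv].
have [al [be vE]] := center_line_coord Lv.
have ab0 : al != 0 \/ be != 0.
  have [a0|] := eqVneq al 0; last by left.
  right; apply/eqP => b0; have := cone_neq0 Lv.
  by rewrite vE a0 b0 !mul0r (_ : vec3 0 0 0 = 0) ?eqxx//; apply/rowP => -[[|[|[|//]]] h]; rewrite !mxE.
have [/andP[a0 b0]|ab1] := boolP ((al != 0) && (be != 0)).
  by rewrite vE main// -vE.
pose w := vec3 1 b c.
have cg : ccont (fun z => g (v + z *: w)) 0.
  apply: continuous_line; rewrite scale0r addr0.
  by apply: differentiable_continuous; exact: dg.
have := ccont_eq0 cg; rewrite scale0r addr0; apply => d d0.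
have rv := represents_pt (cone_neq0 Uv).
have /near_vecP[e ee he] := near_cone oU (cone_represents rv Uv) rv.
pose M := 1 + cabs b + cabs c.
have M1 : 1 <= M by rewrite /M -addrA lerDl addr_ge0 ?cabs_ge0.
(* Exactly one of [al], [be] is zero, and |z| = k / 2 is less than the modulus of the other one, so
   [al + z] and [be + z] are both nonzero. The other bounds keep z within d and the moved vector in
   the cone. *)
pose k := Num.min (Num.min d (e / M)) (cabs al + cabs be).
have k0 : 0 < k.
  rewrite /k !lt_min d0 divr_gt0 ?(lt_le_trans _ M1)//=.
  by case: ab0 => h; [rewrite ltr_pwDl|rewrite ltr_wpDl]; rewrite ?cabs_gt0 ?cabs_ge0.
pose z : C := (k / 2)%:C%C.
have zk : cabs z = k / 2 by rewrite cabs_real ger0_norm// divr_ge0// ltW.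
have k2 : k / 2 < k by rewrite ltr_pdivrMr// ltr_pMr// ltrDl.
exists z.
  by rewrite subr0 zk (lt_le_trans k2)// /k !ge_min lexx.
have UE : cone U (v + z *: w).
  apply: he => i.
  have -> : (v + z *: w) 0 i - v 0 i = z * w 0 i by rewrite !mxE; ring.
  rewrite cabsM zk.
  have kM : k * M <= e.
    rewrite -ler_pdivlMr ?(lt_le_trans _ M1)// /k !ge_min lexx orbT //.
  apply: lt_le_trans kM; apply: (@le_lt_trans _ _ (k / 2 * M)); last first.
    by rewrite ltr_pM2r// (lt_le_trans _ M1).
  rewrite ler_pM2l ?divr_gt0//.
  have bg := cabs_ge0 b; have cg' := cabs_ge0 c.
  by rewrite [w 0 i]mxE /M; case: i => -[|[|[|//]]] _ /=; rewrite ?cabs1; lra.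
have vw : v + z *: w = vec3 (al + z) ((be + z) * b) ((be + z) * c).
  by rewrite vE vec3Z vec3D mulr1 !mulrDl.
rewrite vw in UE *.
have ksum : k <= cabs al + cabs be by rewrite /k ge_min lexx orbT.
have z0 : z != 0 by rewrite -cabs_gt0 zk divr_gt0.
suff [a1 b1] : al + z != 0 /\ be + z != 0 by exact: main.
have nz u : cabs u = cabs al + cabs be -> u + z != 0.
  move=> uE; apply/eqP => uz; have uz' : u = - z by apply/eqP; rewrite -addr_eq0 uz.
  by move: ksum; rewrite -uE uz' cabsN zk leNgt k2.
have [a0|a0] := eqVneq al 0.
  by rewrite {1}a0 add0r; split => //; apply: nz; rewrite a0 cabs0 add0r.
have [b0|b0] := eqVneq be 0; last by rewrite a0 b0 in ab1.
by rewrite b0 add0r; split => //; apply: nz; rewrite b0 cabs0 addr0.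
Qed.

Section Vanishing.
Variables (n : nat) (s : P2 -> vec -> C^o).
(** Then m - 3 is the positive number [n.+1], without truncated subtraction. *)
Let m := n.+4.
Hypothesis ws : weak_section center_line m s.
Let V (t : C) : vec := vec3 1 (t * b) (t * c).
Let tau (t : C) : C := s (pt (V t)) (V t).

Let VE (t : C) : V t = vec3 1 0 0 + t *: vec3 0 b c.
Proof. by rewrite vec3Z vec3D mulr0 addr0 !add0r. Qed.

Let V_line (t : C) : cone center_line (V t).
Proof. by apply: cone_line_vec; left; exact: oner_neq0. Qed.

Let tau_holo (t0 : C) : holo tau t0.
Proof.
have V0 : V t0 != 0 by exact: cone_neq0 (V_line t0).
have Dx : center_line (pt (V t0)) by exact: cone_represents (represents_pt V0) (V_line t0).
have [U [g [oU Ux [[_ dg _] _] sg _]]] := weak_section_local ws Dx.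
have UV : cone U (V t0) by exists (pt (V t0)) => //; exact: represents_pt.
have hg : holo (fun t => g (vec3 1 0 0 + t *: vec3 0 b c)) t0.
  by apply: holo_line; rewrite -VE; exact: dg.
have /near_vecP[e e0 he] := near_cone oU Ux (represents_pt V0).
have bc : 0 < 1 + cabs b + cabs c by rewrite -addrA ltr_pwDl// addr_ge0 ?cabs_ge0.
apply: (holo_near (r := e / (1 + cabs b + cabs c))) hg; first by rewrite divr_gt0.
move=> t; rewrite ltr_pdivlMr// => tt; rewrite -VE; symmetry; apply: sg; rewrite coneI.
split; last exact: V_line.
apply: he => i.
have -> : V t 0 i - V t0 0 i = (t - t0) * (vec3 0 b c) 0 i.
  by rewrite !VE !mxE; ring.
rewrite cabsM (le_lt_trans _ tt)// ler_wpM2l ?cabs_ge0//.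
have bg := cabs_ge0 b; have cg := cabs_ge0 c.
rewrite [vec3 0 b c 0 i]mxE; case: i => -[|[|[|//]]] _ /=; rewrite ?cabs0; lra.
Qed.

(** The bound |tau| = O(|t|^(m-2)) divided by |t|^(m-3) and squared: 2 m - 4 - 2 (n + 1) = 2. *)
Let tau_small : exists K d : R, 0 < d /\ forall t : C, t != 0 -> cabs t < d ->
  (cabs (tau t) / cabs t ^+ n.+1) ^+ 2 <= K * cabs t ^+ 2.
Proof.
have e0n : vec3 1 0 0 != 0 :> vec by apply: vec3_neq0; left; exact: oner_neq0.
have Dp : center_line (pt (vec3 1 0 0)).
  apply: cone_represents (represents_pt e0n) _.
  by have := V_line 0; rewrite /V !mul0r.
have [U [g [oU Up [Og Lg] sg _]]] := weak_section_local ws Dp.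
have [_ dg _] := Og; have rp := represents_pt e0n.
have p0 : hcoord (pt (vec3 1 0 0) : P2) 0 ord0 != 0.
  case: rp => a [a0 /(congr1 (fun v : vec => v 0 0))]; rewrite vec30 mxE => /eqP.
  by rewrite eq_sym; apply: contraTneq => ->; rewrite mulr0 eq_sym oner_neq0.
have [U' [oU' U'p fin]] := Lg _ Up ord0 p0.
have [K [d [d0 h]]] := L2_vanishing b c (isT : (0 < m)%N) oU oU' Up U'p rp dg fin.
have /near_vecP[e ee he] := near_cone oU Up rp.
have bc : 0 < 1 + cabs b + cabs c by rewrite -addrA ltr_pwDl// addr_ge0 ?cabs_ge0.
exists K, (Num.min d (e / (1 + cabs b + cabs c))).
split; first by rewrite lt_min d0 divr_gt0.
move=> t t0; rewrite lt_min => /andP[td]; rewrite ltr_pdivlMr// => te.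
have tg : tau t = g (V t).
  apply: sg; rewrite coneI; split; last exact: V_line.
  apply: he => i; rewrite VE !mxE.
  have -> : [:: 1; 0; 0]`_i + t * [:: 0; b; c]`_i - [:: 1; 0; 0]`_i = t * [:: 0; b; c]`_i.
    by ring.
  rewrite cabsM (le_lt_trans _ te)// ler_wpM2l ?cabs_ge0//.
  have bg := cabs_ge0 b; have cg := cabs_ge0 c.
  case: i => -[|[|[|//]]] _ /=; rewrite ?cabs0; lra.
have := h t t0 td; rewrite -tg abs2E; set r := cabs t.
have r0 : 0 < r by rewrite cabs_gt0.
rewrite expr_div_n ler_pdivrMr ?exprn_gt0//.
move=> hh; rewrite -(ler_pM2r (exprn_gt0 4 r0)); apply: (le_trans hh).
rewrite le_eqVlt; apply/orP; left; apply/eqP.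
have -> : r ^+ 2 ^+ m = r ^+ n.+1 ^+ 2 * r ^+ 6.
  by rewrite -!exprM -exprD; congr (_ ^+ _); rewrite /m -(addn3 n.+1) mulnC mulnDl.
ring.
Qed.

(** By homogeneity, (1, t b, t c) = t (1 / t, b, c) contributes the factor t^m, and the vector (1 /
    t, b, c) stays near (0, b, c), where the local section is bounded. *)
Let tau_growth : exists M rho : R, 0 < rho /\ forall t : C, rho <= cabs t ->
  cabs (tau t) <= M * cabs t ^+ m.
Proof.
have q0 : vec3 0 b c != 0 by have := line_vec_neq0 (or_intror (oner_neq0 C) : (0 : C) != 0 \/ _); rewrite !mul1r.
have Dq : center_line (pt (vec3 0 b c)).
  apply: cone_represents (represents_pt q0) _.
  by have := cone_line_vec (or_intror (oner_neq0 C) : (0 : C) != 0 \/ _); rewrite !mul1r.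
have [U [g [oU Uq [[_ dg hg] _] sg _]]] := weak_section_local ws Dq.
have rq := represents_pt q0.
have Uc : cone U (vec3 0 b c) by exists (pt (vec3 0 b c)).
have cg : ccont (fun t => g (vec3 0 b c + t *: vec3 1 0 0)) 0.
  apply: continuous_line; rewrite scale0r addr0.
  by apply: differentiable_continuous; exact: dg.
have [d1 d10 h1] := cg 1 ltr01.
have /near_vecP[e ee he] := near_cone oU Uq rq.
pose d := Num.min d1 e; have d0 : 0 < d by rewrite lt_min d10.
exists (1 + cabs (g (vec3 0 b c))), (2 / d); split; first by rewrite divr_gt0.
move=> t ht; have t0 : 0 < cabs t by rewrite (lt_le_trans _ ht)// divr_gt0.
have tn : t != 0 by rewrite -cabs_gt0.
have it : cabs t^-1 < d.
  rewrite cabsV -[d]invrK ltf_pV2 ?posrE ?invr_gt0// (lt_le_trans _ ht)//.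
  by rewrite -[X in X < _]mul1r ltr_pM2r ?invr_gt0// ltrDl.
have wE : vec3 0 b c + t^-1 *: vec3 1 0 0 = vec3 t^-1 (1 * b) (1 * c).
  by rewrite vec3Z vec3D !mulr0 !addr0 add0r mulr1 !mul1r.
have wU : cone (U `&` center_line) (vec3 t^-1 (1 * b) (1 * c)).
  rewrite coneI; split; last by apply: cone_line_vec; left; rewrite invr_eq0.
  rewrite -wE; apply: he => i; rewrite !mxE.
  have -> : [:: 0; b; c]`_i + t^-1 * [:: 1; 0; 0]`_i - [:: 0; b; c]`_i = t^-1 * [:: 1; 0; 0]`_i.
    by ring.
  case: i => -[|[|[|//]]] _ /=; rewrite ?mulr1 ?mulr0 ?cabs0//.
  by rewrite (lt_le_trans it)// /d ge_min lexx orbT.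
have Vt : V t = t *: vec3 t^-1 (1 * b) (1 * c).
  by rewrite vec3Z !mul1r divff.
have tg : tau t = t ^+ m * g (vec3 t^-1 (1 * b) (1 * c)).
  rewrite /tau sg; last by rewrite Vt; exact: coneZ.
  by rewrite Vt hg//; apply: coneS wU; exact: subIsetl.
rewrite tg cabsM cabsX mulrC ler_wpM2r ?exprn_ge0 ?cabs_ge0//.
rewrite -wE -[X in cabs X](subrK (g (vec3 0 b c))) (le_trans (ler_cabsD _ _))// lerD2r.
have := h1 t^-1; rewrite subr0 scale0r addr0; apply.
by rewrite (lt_le_trans it)// /d ge_min lexx.
Qed.

Let four : seq C := [:: 1; 2; 3; 4].

Lemma weak_section_eq0 :
  (forall a, a \in four -> s (pt (V a)) (V a) = 0) ->
  forall t, t != 0 -> s (pt (V t)) (V t) = 0.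
Proof.
move=> zs; pose f t := tau t / t ^+ n.+1.
have fz t : t != 0 -> f t = 0 -> tau t = 0.
  move=> t0 /eqP; rewrite mulf_eq0 invr_eq0 expf_eq0 /= (negbTE t0) orbF.
  by move/eqP.
(* The convention that 0 is its own inverse gives [f] at 0 the value that makes it continuous
   there. *)
have f00 : f 0 = 0 by rewrite /f expr0n /= invr0 mulr0.
have hf z : z \notin [:: 0] -> holo f z.
  rewrite inE => z0; apply: holoM; first exact: tau_holo.
  apply: (@holoV R (fun w => w ^+ n.+1)); first by rewrite expf_neq0.
  by apply: holoX; exact: holo_id.
have cf z : ccont f z.
  have [->|z0] := eqVneq z 0; last by apply: holo_ccont; apply: hf; rewrite inE.
  have [K [d [d0 h]]] := tau_small => e e0.
  have K1 : 0 < 1 + `|K| by rewrite ltr_pwDl.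
  exists (Num.min d (e / (1 + `|K|))); first by rewrite lt_min d0 divr_gt0.
  move=> w; rewrite subr0 f00 subr0 lt_min => /andP[wd we].
  have [->|w0] := eqVneq w 0; first by rewrite f00 cabs0 ltW.
  have := h w w0 wd; rewrite /f cabsM cabsV cabsX => h'.
  have c0 := cabs_ge0 w.
  rewrite -(@ler_pXn2r _ 2)// ?nnegrE ?divr_ge0 ?exprn_ge0 ?cabs_ge0 ?(ltW e0)//.
  apply: (le_trans h'); rewrite ltr_pdivlMr// in we.
  apply: (@le_trans _ _ ((cabs w * (1 + `|K|)) ^+ 2)); last first.
    by rewrite ler_pXn2r// ?nnegrE ?mulr_ge0 ?(ltW e0) ?(ltW K1)// ltW.
  rewrite exprMn mulrC ler_wpM2l ?exprn_ge0//.
  have K2 := sqr_ge0 `|K|; have Kn := ler_norm K; have Ka := normr_ge0 K.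
  by rewrite sqrrD expr1n mul1r -mulr_natr; lra.
have [M [rho [rho0 hM]]] := tau_growth.
(* The quotient is O(|z|^3); the fourth power includes the factor |z| of the decay condition. *)
have gf z : rho <= cabs z -> cabs z * cabs (f z) <= M * cabs z ^+ size four.
  move=> hz; have z0 : 0 < cabs z by exact: lt_le_trans hz.
  rewrite /f cabsM cabsV cabsX mulrA ler_pdivrMr ?exprn_gt0//.
  have := hM z hz; rewrite -(ler_pM2l z0) => /le_trans; apply.
  rewrite le_eqVlt; apply/orP; left; apply/eqP.
  by rewrite -[RHS]mulrA mulrCA; congr (M * _); rewrite -exprS -exprD; congr (_ ^+ _).
have u4 : uniq four.
  have nz (k l : nat) : k != l -> k%:R != l%:R :> C by rewrite eqr_nat.
  by rewrite /= !inE !negb_or !(nz 1%N) ?(nz 2%N) ?(nz 3%N).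
have nz4 a : a \in four -> a \notin [:: 0] /\ f a = 0.
  move=> a4; split; last by rewrite /f /tau zs// mul0r.
  move: a4; rewrite !inE => /or4P[] /eqP ->; rewrite ?oner_neq0 ?pnatr_eq0//.
have f0 := zeros_growth_eq0 cf hf gf u4 nz4.
by move=> t t0; apply: fz => //; apply: f0; rewrite inE.
Qed.

Hypothesis zeros : forall a, a \in four -> s (pt (V a)) (V a) = 0.

Let local_zero x : center_line x -> null_near center_line x (s x).
Proof.
move=> Dx; have [U [g [oU Ux Og sg [W [oW Wx hW]]]]] := weak_section_local ws Dx.
have [[_ dg hg] _] := Og.
have g0 : forall v, cone (U `&` center_line) v -> g v = 0.
  apply: center_line_density => // al be al0 be0 Uv; set t := be / al.
  have t0 : t != 0 by rewrite mulf_neq0 ?invr_eq0.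
  have E : vec3 al (be * b) (be * c) = al *: V t.
    by rewrite vec3Z mulr1 /t !mulrA (mulrC al be) mulfK.
  have UV : cone U (V t).
    have := coneZ (_ : al^-1 != 0) Uv; rewrite E scalerA mulVf// scale1r; apply.
    by rewrite invr_eq0.
  rewrite E hg// -sg ?weak_section_eq0 ?mulr0//.
  by rewrite coneI; split => //; exact: V_line.
exists (W `&` U); split; [exact: openI|by split|] => v Wv.
have h : s x v - g v = 0 by apply: hW; apply: coneS Wv => y [[]].
have -> : s x v = g v by apply/eqP; rewrite -subr_eq0 h.
by apply: g0; apply: coneS Wv => y [[]].
Qed.

(** The multiplier is a = (z_i / z_j)^m, where i is 1 or 2 and z_i vanishes on the line only at the
    center. Then a s = (s / z_j^m) z_i^m, with the first factor in the ideal of the line and z_i^m a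
    section of the multiplier ideal. By density, a is a nonzerodivisor. *)
Lemma weak_section_zero : zero_section phi center_line m s.
Proof.
move=> x Dx; have Og := weak_section_germ (isT : (0 < m)%N) ws Dx.
split=> //; have [i [i0 qi]] : exists i : 'I_3, i != 0 /\
    forall al be, be != 0 -> (vec3 al (be * b) (be * c)) 0 i != 0.
  case: bc0 => h; [exists 1|exists 2]; split=> // al be be0.
    by rewrite vec31 mulf_neq0.
  by rewrite vec32 mulf_neq0.
have [j xj] := exists_coord_neq0 x.
pose a (v : vec) : C^o := v 0 i ^+ m / v 0 j ^+ m.
have Oa : O_germ 0 x a.
  by apply: O_germ_div => //; exists setT; [by []|exact: O_section_coordX].
exists a; split; last first.
  exists 1%N, (fun=> (fun v => s x v / v 0 j ^+ m)), (fun=> (fun v => v 0 i ^+ m)).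
  split.
    move=> _; split; last by exists setT; [by []|exact: OI_coordX].
    split; first by apply: O_germ_div => //; exact: OI_germ_O Og.
    have [W [oW Wx hW]] := local_zero Dx; exists W; split=> // v Wv.
    by rewrite hW// mul0r.
  exists setT; split; [exact: openT|by []|] => v _.
  by rewrite big_ord1 /a mulrAC [RHS]mulrAC; congr (_ / _); exact: mulrC.
split=> // b' Ob' [_ [U [oU Ux ab]]]; split=> //.
have [W Wx [oW dW _]] := Ob'.
exists (U `&` W `&` [set y : P2 | hcoord y 0 j != 0]); split.
- by apply: openI; [exact: openI|exact: open_affine].
- by [].
- have oX : open (U `&` W `&` [set y : P2 | hcoord y 0 j != 0]).
    by apply: openI; [exact: openI|exact: open_affine].
  apply: center_line_density => //.
    by move=> v Xv; apply: dW; apply: coneS Xv => y [[]].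
  move=> al be al0 be0 Xv; set v := vec3 _ _ _.
  have ab0 : a v * b' v = 0.
    apply: ab; rewrite coneI; split; last by apply: cone_line_vec; left.
    by apply: coneS Xv => y [[]].
  have vj : v 0 j != 0 by apply: cone_affine; apply: coneS Xv => y [].
  have av : (a v : C) != 0.
    by apply: mulf_neq0; rewrite ?invr_eq0 expf_neq0//; exact: qi.
  by apply: (mulfI av); rewrite mulr0.
Qed.

End Vanishing.
End LineThroughCenter.

Section CenterLineNumber.
Variable R : realType.
Local Notation C := R[i].
Local Notation vec := 'rV[C^o]_3.
Local Notation phi := (@lines_weight R).
Variables b c : C.
Hypothesis bc0 : b != 0 \/ c != 0.
Local Notation line := (center_line b c).

(** Among more than four sections some nontrivial combination vanishes at the parameters 1, 2, 3 and
    4, and is then torsion. *)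
Lemma h0_center_line n : (h0 phi line n.+4 <= 4%:E)%E.
Proof.
apply: ge_ereal_sup => _ [k [s [gs ind]] <-]; rewrite lee_fin ler_nat leqNgt.
apply/negP => k4.
pose v (i : 'I_4) : vec := vec3 1 (i.+1%:R * b) (i.+1%:R * c).
pose M : 'M[C]_(k, 4) := \matrix_(j, i) s j (pt (v i)) (v i).
have : kermx M != 0.
  rewrite -mxrank_eq0 mxrank_ker subn_eq0 -ltnNge.
  by apply: leq_ltn_trans k4; exact: rank_leq_col.
case/rowV0Pn => a /sub_kermxP aM a0.
case/negP: a0; apply/eqP/rowP => j; rewrite mxE; apply: (ind (a 0)).
apply: weak_section_zero bc0 _ _ _ _.
  by apply: weak_section_sum => // i; apply: global_weak.
have H (i : 'I_4) : \sum_(j < k) a 0 j * s j (pt (v i)) (v i) = 0.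
  have := congr1 (fun A : 'rV_4 => A 0 i) aM; rewrite mxE [RHS]mxE => aM0.
  by rewrite -[RHS]aM0; apply: eq_bigr => l _; rewrite mxE.
move=> t; rewrite !inE => /or4P[] /eqP ->.
- exact: (H (Ordinal (isT : (0 < 4)%N))).
- exact: (H (Ordinal (isT : (1 < 4)%N))).
- exact: (H (Ordinal (isT : (2 < 4)%N))).
- exact: (H (Ordinal (isT : (3 < 4)%N))).
Qed.

Lemma center_line_number : ~ (0 < intersection_number phi line)%E.
Proof.
apply/negP; rewrite -leNgt; apply/lee_addgt0Pr => e e0; rewrite add0r.
have [k ke] : exists k : nat, 4 / e <= k%:R.
  by exists (Num.truncn (4 / e)).+1; rewrite ltW// truncnS_gt.
pose n := maxn k 4.
apply: (@le_trans _ _ (ereal_sup [set (h0 phi line m * (m%:R^-1)%:E)%E | m in [set m | (n <= m)%N]])).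
  apply: ereal_inf_lbound; exists [set m | (n <= m)%N] => //.
  by exists n.
apply: ge_ereal_sup => _ [m nm <-].
have m4 : (4 <= m)%N by apply: leq_trans nm; exact: leq_maxr.
have m0 : 0 < m%:R :> R by rewrite ltr0n (leq_trans _ m4).
have := h0_center_line (m - 4); rewrite -addn4 subnK// => h.
apply: (@le_trans _ _ (4%:E * (m%:R^-1)%:E)%E).
  by apply: lee_wpmul2r => //; rewrite lee_fin invr_ge0 ltW.
rewrite -EFinM lee_fin ler_pdivrMr// mulrC -ler_pdivrMr//.
apply: (le_trans ke); rewrite ler_nat (leq_trans _ nm)//; exact: leq_maxl.
Qed.

End CenterLineNumber.

Section LineAtInfinity.
Variable R : realType.
Local Notation C := R[i].
Local Notation vec := 'rV[C^o]_3.
Local Notation P2 := (projspace R 2).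
Local Notation phi := (@lines_weight R).

Definition line_at_infinity : set P2 := [set x | hcoord x 0 0 = 0].
Local Notation line := line_at_infinity.

Lemma cone_line_at_infinity v : v != 0 -> cone line v <-> v 0 0 = 0.
Proof.
move=> v0; have [x xv] := represents_exists v0; split.
  by case=> y yl [a [_ ->]]; rewrite mxE yl mulr0.
move=> vl; exists x => //; case: xv vl => a [a0 ->] /eqP; rewrite mxE mulf_eq0.
by rewrite (negbTE a0) => /eqP.
Qed.

Definition monom (m j : nat) : vec -> C^o := fun v => v 0 1 ^+ j * v 0 2 ^+ (m - j).

Lemma OI_monom m j : (0 < m)%N -> (j <= m)%N -> OI_section phi m setT (monom m j).
Proof.
move=> m0 jm; apply: OI_section_bounded => //.
  split; first exact: openT.
  - by move=> v _; apply: differentiableM; exact: differentiable_coordX.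
  - move=> v a _ _; rewrite /monom !mxE !exprMn mulrACA -exprD subnKC//.
move=> v; rewrite /monom abs2M !abs2E !cabsX -!exprM ![(_ * 2)%N]mulnC !exprM -!abs2E.
rewrite -[in leRHS](subnKC jm) exprD ler_pM ?exprn_ge0 ?abs2_ge0//;
  apply: lerXn2r; rewrite ?nnegrE ?abs2_ge0 ?dist2_ge0// /dist2.
  by rewrite lerDl abs2_ge0.
by rewrite lerDr abs2_ge0.
Qed.

Lemma torsion_germ0 (D : set P2) m x : (0 < m)%N -> torsion_germ phi D m x (fun=> 0).
Proof.
move=> m0; split; first by exists setT => //; exact: OI_section0.
exists (fun=> 1); split.
  split; first (exists setT => //; split; first exact: openT).
  - by move=> v _; exact: differentiable_cst.
  - by move=> v a _ _; rewrite expr0 mulr1.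
  by move=> b _; congr ideal_germ; apply/funext => v; rewrite mul1r.
exists 0%N, (fun _ _ => 0), (fun _ _ => 0); split; first by case.
exists setT; split; [exact: openT|by []|] => v _.
by rewrite big_ord0 mulr0.
Qed.

(** At (0 : t : 1) a combination of the monomials with exponents j < m is a polynomial in t with the
    same coefficients. If the combination is torsion, this polynomial vanishes at every t. *)
Lemma h0_line_at_infinity m : (0 < m)%N -> (m%:R%:E <= h0 phi line m)%E.
Proof.
move=> m0; apply: ereal_sup_ubound; exists m => //.
exists (fun j _ => monom m j); split.
  move=> j x Dx; exists setT, (monom m j); split=> //.
    by apply: OI_monom => //; rewrite ltnW.
  move=> y _ _; rewrite (_ : (fun _ => _) = (fun=> 0)); first exact: torsion_germ0.
  by apply/funext => v; rewrite subrr.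
move=> c zs.
(* [insubd] turns an index below m into an ordinal; its default is never reached. *)
pose p : {poly C} := \poly_(j < m) c (insubd (Ordinal m0) j).
have pE (t : C) : p.[t] = 0.
  pose v : vec := vec3 0 t 1.
  have v0 : v != 0 by apply: vec3_neq0; right; right; exact: oner_neq0.
  have [x xv] := represents_exists v0.
  have lv : cone line v by apply/cone_line_at_infinity => //; rewrite vec30.
  have lx : line x by exact: cone_represents xv lv.
  have [U [_ Ux h]] := torsion_null (zs x lx).
  have := h v; rewrite coneI => /(_ (conj _ lv)) <-; last by exists x.
  rewrite horner_poly; apply: eq_bigr => j _.
  by rewrite /monom vec31 vec32 expr1n mulr1 valKd.
have p0 : p = 0.
  apply/eqP; apply: contraT => p0.
  have := max_poly_roots p0 (rs := [seq i%:R | i <- iota 0 (size p)]).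
  rewrite size_map size_iota ltnn; apply.
    by apply/allP => z _; rewrite /root pE.
  by rewrite map_inj_uniq ?iota_uniq// => i j /eqP; rewrite eqr_nat => /eqP.
move=> j; have := congr1 (fun q : {poly C} => q`_j) p0.
by rewrite coef_poly ltn_ord coef0 valKd.
Qed.

Lemma line_at_infinity_number : intersection_number phi line <> 0%E.
Proof.
suff h : (1 <= intersection_number phi line)%E.
  by move=> n0; move: h; rewrite n0 lee_fin ler10.
apply: le_ereal_inf_tmp => _ [V [N _ NV] <-].
apply: (@le_trans _ _ (h0 phi line N.+1 * (N.+1%:R^-1)%:E)%E); last first.
  by apply: ereal_sup_ubound; exists N.+1 => //; apply: NV => /=.
apply: (@le_trans _ _ (N.+1%:R%:E * (N.+1%:R^-1)%:E)%E).
  by rewrite -EFinM divff// pnatr_eq0.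
apply: lee_wpmul2r; last exact: h0_line_at_infinity.
by rewrite lee_fin invr_ge0.
Qed.

End LineAtInfinity.

(** * Zariski topology of linear subspaces *)

Section PolynomialFunctions.
Variables (R : realType) (n : nat).
Local Notation C := R[i].
Local Notation vec := 'rV[C^o]_n.+1.
Local Notation P := (projspace R n).

Lemma poly_roots (q : {poly C}) : q != 0 ->
  exists r : seq C, forall z, root q z -> z \in r.
Proof.
move=> q0; have [r qE] := closed_field_poly_normal q; exists r => z.
by rewrite qE rootZ ?lead_coef_eq0// root_prod_XsubC.
Qed.

(** The real roots of countably many polynomials form a countable set, which cannot contain
    [0, 1]. *)
Lemma avoid_roots (q : nat -> {poly C}) : (forall i, q i != 0) ->
  exists t : C, forall i, (q i).[t] != 0.
Proof.
move=> q0; apply: contrapT => /forallNP nt.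
pose A (i : nat) : set R := [set x | root (q i) (x%:C)%C].
have cA : countable (\bigcup_i A i).
  apply: bigcup_countable => // i _; have [r hr] := poly_roots (q0 i).
  apply: (@sub_countable _ _ _ [set` map (@complex.Re R) r]).
    by apply: subset_card_le => x /hr xr; apply/mapP; exists (x%:C)%C.
  exact/finite_set_countable/finite_seq.
have cI : countable [set` `[0%R : R, 1%R]].
  apply: sub_countable cA; apply: subset_card_le => x _.
  have /existsNP[i /negP] := nt (x%:C)%C.
  by rewrite negbK => h; exists i.
have := countable_lebesgue_measure0 cI.
by rewrite lebesgue_measure_itv/= lte_fin ltr01 sube0 => /eqP; rewrite eqe oner_eq0.
Qed.

(** The numbers d / (k + 2) are small and distinct, and more of them are listed than [q] can have
    roots. *)
Lemma root_near0 (q : {poly C}) (d : R) : q != 0 -> 0 < d ->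
  exists t : C, cabs t < d /\ q.[t] != 0.
Proof.
move=> q0 d0.
pose r := [seq ((d / k.+2%:R)%:C)%C | k <- iota 0 (size q)].
have ur : uniq r.
  rewrite map_inj_uniq ?iota_uniq// => i j [] /(mulfI (lt0r_neq0 d0)) /invr_inj /eqP.
  by rewrite eqr_nat => /eqP [].
have [/allP ar|/allPn[z zr qz]] := boolP (all (root q) r).
  by have := max_poly_roots q0 (introT allP ar) ur; rewrite size_map size_iota ltnn.
exists z; split; last by [].
case/mapP: zr => k _ ->; rewrite cabs_real ger0_norm ?divr_ge0 ?(ltW d0)//.
by rewrite ltr_pdivrMr// ltr_pMr// (ltr_nat _ 1).
Qed.

(** Polynomial along every affine line. This is easily seen to be stable under products, shifts and
    composition with polynomials, and the density and irreducibility arguments only use restrictions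
    to lines. *)
Definition polyfun (h : vec -> C) : Prop :=
  forall v w, exists q : {poly C}, forall t : C, q.[t] = h (v + t *: w).

Lemma polyfunM h k : polyfun h -> polyfun k -> polyfun (fun v => h v * k v).
Proof.
move=> hh hk v w; have [p pE] := hh v w; have [q qE] := hk v w.
by exists (p * q) => t; rewrite hornerM pE qE.
Qed.

Lemma polyfunB h k : polyfun h -> polyfun k -> polyfun (fun v => h v - k v).
Proof.
move=> hh hk v w; have [p pE] := hh v w; have [q qE] := hk v w.
by exists (p - q) => t; rewrite hornerD hornerN pE qE.
Qed.

Lemma polyfun_shift h a : polyfun h -> polyfun (fun v => h (v + a)).
Proof.
by move=> hh v w; have [p pE] := hh (v + a) w; exists p => t; rewrite pE addrAC.
Qed.

Lemma polyfun_coord i : polyfun (fun v => v 0 i).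
Proof.
move=> v w; exists ((v 0 i)%:P + (w 0 i)%:P * 'X) => t.
by rewrite hornerD hornerC hornerM hornerC hornerX !mxE [RHS]/= mulrC.
Qed.

Definition peval (p : mpoly n.+1 C) (v : vec) : C := meval (fun i => v 0 i) p.

Lemma polyfun_peval_comp k (p : mpoly k.+1 C) (h : 'I_k.+1 -> vec -> C) :
  (forall j, polyfun (h j)) -> polyfun (fun v => meval (fun j => h j v) p).
Proof.
move=> hh v w; have /choice[q qE] : forall j, exists q : {poly C},
    forall t, q.[t] = h j (v + t *: w) by move=> j; exact: hh.
exists (\sum_(m <- msupp p) (mcoeff m p)%:P * \prod_j q j ^+ m j)%R => t.
rewrite mevalE horner_sum; apply: eq_bigr => m _.
rewrite hornerM hornerC horner_prod; congr (_ * _); apply: eq_bigr => j _.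
by rewrite horner_exp qE.
Qed.

Lemma polyfun_peval p : polyfun (peval p).
Proof. by apply: polyfun_peval_comp; exact: polyfun_coord. Qed.

(** On the line from [v] to [w] the restrictions are nonzero polynomials, by their values at 0 and
    at 1; so their product has a nonroot. *)
Lemma polyfun_common f g v w : polyfun f -> polyfun g -> f v != 0 -> g w != 0 ->
  exists t : C, f (v + t *: (w - v)) != 0 /\ g (v + t *: (w - v)) != 0.
Proof.
move=> hf hg fv gw; have [p pE] := hf v (w - v); have [q qE] := hg v (w - v).
have p0 : p != 0.
  by apply: contraNneq fv => p0; rewrite -[v]addr0 -(scale0r (w - v)) -pE p0 horner0.
have q0 : q != 0.
  apply: contraNneq gw => q0; rewrite -[w](subrK v) addrC -(scale1r (w - v)) -qE q0.
  by rewrite horner0.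
have [t [_]] := root_near0 (mulf_neq0 p0 q0) ltr01.
by rewrite hornerM mulf_eq0 negb_or pE qE => /andP[]; exists t.
Qed.

Lemma peval_homog d p (a : C) v : homog d p -> peval p (a *: v) = a ^+ d * peval p v.
Proof.
move=> /dhomogP hp; rewrite /peval !mevalE mulr_sumr; apply: eq_big_seq => m mp.
rewrite mulrCA; congr (_ * _).
have <- : mdeg m = d by exact: hp.
by rewrite mdegE -prodrXr -big_split/=; apply: eq_bigr => i _; rewrite mxE exprMn.
Qed.

Lemma peval_represents d p x v : homog d p -> represents x v ->
  (pval p x == 0) = (peval p v == 0).
Proof.
move=> hp [a [a0 ->]]; rewrite (peval_homog _ _ hp) mulf_eq0 expf_eq0 (negbTE a0).
by rewrite andbF.
Qed.

Lemma differentiable_peval p v : differentiable (peval p : vec -> C^o) v.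
Proof.
have -> : (peval p : vec -> C^o) =
    \sum_(m <- msupp p) ((fun=> mcoeff m p : C^o) * \prod_i (fun v : vec => v 0 i ^+ m i : C^o)).
  apply/funext => w; rewrite /peval mevalE fct_sumE; apply: eq_bigr => m _.
  by rewrite fctE fct_prodE.
elim/big_ind: _ => [|f g|m _].
- exact: differentiable_cst.
- exact: differentiableD.
apply: differentiableM; first exact: differentiable_cst.
elim/big_ind: _ => [|f g|i _].
- exact: differentiable_cst.
- exact: differentiableM.
apply: (@differentiable_comp C vec C^o C^o (fun v : vec => v 0 i) (fun z : C^o => z ^+ m i)).
  exact: differentiable_coord.
by apply: holoX; exact: holo_id.
Qed.

End PolynomialFunctions.

Section Proportional.
Variables (R : realType) (n : nat).
Local Notation C := R[i].
Local Notation vec := 'rV[C^o]_n.+1.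
Implicit Types (u v w : vec) (x : projspace R n).

(** Vanishing of the 2 x 2 minors, a polynomial form of proportionality that passes to limits. The
    zero vector is parallel to every vector, so transitivity needs a nonzero middle term. *)
Definition par v w : Prop := forall j k, v 0 j * w 0 k = v 0 k * w 0 j.

Lemma par_scale v w : v != 0 -> par v w -> exists a : C, w = a *: v.
Proof.
move=> /rV0Pn[i vi] vw; exists (w 0 i / v 0 i); apply/rowP => j; rewrite mxE.
by apply: (mulfI vi); rewrite vw [RHS]mulrA [v 0 i * _]mulrCA divff// mulr1 mulrC.
Qed.

Lemma parZ (a : C) v : par v (a *: v).
Proof. by move=> j k; rewrite !mxE mulrCA mulrC [RHS]mulrCA; ring. Qed.

Lemma par_sym v w : par v w -> par w v.
Proof. by move=> vw j k; rewrite mulrC -vw mulrC. Qed.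

Lemma par_trans u v w : v != 0 -> par u v -> par v w -> par u w.
Proof.
move=> v0 /par_sym/(par_scale v0)[a ->] /(par_scale v0)[b ->] j k.
by rewrite !mxE; ring.
Qed.

Lemma par_represents x v w : represents x v -> w != 0 -> par v w -> represents x w.
Proof.
move=> xv w0 /(par_scale (represents_neq0 xv))[a wE]; rewrite wE.
by apply: representsZ => //; apply: contraNneq w0 => a0; rewrite wE a0 scale0r.
Qed.

Lemma represents_par x v w : represents x v -> represents x w -> par v w.
Proof. by move=> [a [_ ->]] [b [_ ->]] j k; rewrite !mxE; ring. Qed.

End Proportional.

(** * Zariski closed sets, irreducibility and dimension *)

Section Zariski.
Variables (R : realType) (n : nat).
Local Notation C := R[i].
Local Notation P := (projspace R n).
Implicit Types (A B D Z : set P) (x y : P).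

Lemma homogM d e (p q : mpoly n.+1 C) : homog d p -> homog e q -> homog (d + e) (p * q).
Proof. exact: dhomogM. Qed.

Lemma homogX (i : 'I_n.+1) : homog 1 (mpolyX C (mnm1 i)).
Proof. by rewrite /homog dhomogX; apply/eqP; exact: mdeg1. Qed.

Lemma pvalM p q x : pval (p * q) x = pval p x * pval q x :> C.
Proof. exact: mevalM. Qed.

Lemma zclosedP A x : zclosed A -> ~ A x ->
  exists d (p : mpoly n.+1 C), [/\ homog d p, forall y, A y -> pval p y = 0 & pval p x != 0].
Proof.
move=> [S [hS ->]] /existsNP[p /not_implyP[Sp px]]; have [d hp] := hS p Sp.
by exists d, p; split => //; [move=> y; exact|exact/eqP].
Qed.

Lemma zclosed_separated A : (forall x, ~ A x -> exists d (p : mpoly n.+1 C),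
    [/\ homog d p, forall y, A y -> pval p y = 0 & pval p x != 0]) -> zclosed A.
Proof.
move=> h; exists [set p | (exists d, homog d p) /\ forall y, A y -> pval p y = 0].
split; first by move=> p [].
apply/seteqP; split=> x /=; first by move=> Ax p [_]; exact.
move=> hx; apply: contrapT => /h[d [p [hp Ap /eqP px]]]; apply: px; apply: hx.
by split => //; exists d.
Qed.

Lemma zclosed_zclosure A : zclosed (zclosure A).
Proof.
apply: zclosed_separated => x /existsNP[B /not_implyP[[cB AB] Bx]].
have [d [p [hp Bp px]]] := zclosedP cB Bx; exists d, p; split=> // y yA; apply: Bp.
exact: yA.
Qed.

Lemma sub_zclosure A : A `<=` zclosure A.
Proof. by move=> x Ax B [_]; exact. Qed.

Lemma zclosure_sub A B : zclosed B -> A `<=` B -> zclosure A `<=` B.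
Proof. by move=> cB AB x; apply. Qed.

Lemma zclosedU A B : zclosed A -> zclosed B -> zclosed (A `|` B).
Proof.
move=> cA cB; apply: zclosed_separated => x /not_orP[nA nB].
have [d [p [hp Ap px]]] := zclosedP cA nA; have [e [q [hq Bq qx]]] := zclosedP cB nB.
exists (d + e)%N, (p * q); split; first exact: homogM.
  by move=> y [/Ap|/Bq]; rewrite pvalM => ->; rewrite ?mul0r ?mulr0.
by rewrite pvalM mulf_neq0.
Qed.

Lemma zclosed_set1 x : zclosed [set x].
Proof.
apply: zclosed_separated => y yx.
have : ~ par (hcoord x) (hcoord y).
  move=> h; apply: yx; apply: (represents_inj (represents_hcoord y)).
  exact: par_represents (represents_hcoord x) (hcoord_neq0 y) h.
move=> /existsNP[j /existsNP[k /eqP jk]].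
pose p : mpoly n.+1 C := hcoord x 0 j *: mpolyX C (mnm1 k) - hcoord x 0 k *: mpolyX C (mnm1 j).
have pE z : pval p z = hcoord x 0 j * hcoord z 0 k - hcoord x 0 k * hcoord z 0 j.
  by rewrite /pval mevalB !mevalZ !mevalXU.
exists 1%N, p; split.
- by rewrite /homog rpredB ?rpredZ//; exact: homogX.
- by move=> _ ->; rewrite pE mulrC subrr.
- by rewrite pE subr_eq0.
Qed.

Lemma zclosed_set0 : zclosed (@set0 P).
Proof.
apply: zclosed_separated => x _; exists 0%N, 1; split => //; first exact: dhomog1.
by rewrite /pval meval1 oner_neq0.
Qed.

Lemma zirreducible_set1 x : zirreducible [set x].
Proof.
split; first by exists x.
by move=> B D _ _ h; case: (h x erefl) => ?; [left|right] => _ ->.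
Qed.

Lemma zirreducible_seq Z (s : seq P) : zirreducible Z -> (forall x, Z x -> x \in s) ->
  exists x, Z `<=` [set x].
Proof.
move=> [Z0 irr]; elim: s => [|x s IH] h; first by case: Z0 => x /h.
have cs (t : seq P) : zclosed [set` t].
  elim: t => [|y t ct].
    by rewrite (_ : [set` _] = set0); [exact: zclosed_set0|apply/seteqP; split].
  rewrite (_ : [set` _] = [set y] `|` [set` t]); first exact: zclosedU (zclosed_set1 _) ct.
  apply/seteqP; split=> z /=; first by rewrite inE => /orP[/eqP|]; [left|right].
  by rewrite inE => -[->|->]; rewrite ?eqxx ?orbT.
case: (irr [set x] [set` s] (zclosed_set1 x) (cs s)) => [y /h|hx|hs]; last exact: IH.
  by rewrite inE => /orP[/eqP|]; [left|right].
by exists x.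
Qed.

Lemma zirreducible_zclosure A : zirreducible A -> zirreducible (zclosure A).
Proof.
move=> [[x Ax] irr]; split; first by exists x; exact: sub_zclosure.
move=> B D cB cD h; case: (irr B D cB cD); first by move=> y /sub_zclosure /h.
- by left; exact: zclosure_sub.
- by right; exact: zclosure_sub.
Qed.

Lemma zdim_gt0 A B x : projective_variety A -> A `<=` B -> A x -> ~ (A `<=` [set x]) ->
  (0 < zdim B)%E.
Proof.
move=> vA AB Ax Ax1; apply: (@lt_le_trans _ _ 1%:E); first by rewrite lte_fin.
apply: ereal_sup_ubound; exists 1%N => //.
exists (fun i => if i is 0%N then [set x] else A); split.
  case=> [_|i _]; last by split.
  split; last by move=> _ ->; exact: AB.
  by split; [exact: zclosed_set1|exact: zirreducible_set1].
by case=> // _; split => // _ ->.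
Qed.

End Zariski.

Section LinearImage.
Variables (R : realType) (n N : nat).
Local Notation C := R[i].
Local Notation vec := 'rV[C^o]_n.+1.
Variables (d : nat) (F : 'I_N.+1 -> mpoly n.+1 C).

Definition veval (v : vec) : 'rV[C^o]_N.+1 := \row_j peval (F j) v.

Lemma vevalZ (a : C) v : (forall j, homog d (F j)) -> veval (a *: v) = a ^+ d *: veval v.
Proof. by move=> hF; apply/rowP => j; rewrite !mxE (peval_homog _ _ (hF j)). Qed.

Definition image_of (K : set vec) : set (projspace R N) :=
  [set y | exists v, [/\ K v, v != 0 & represents y (veval v)]].

(** Image points outside B and outside D come from vectors v and w. On the line joining v and w both
    separating forms are nonzero polynomials in the parameter, so some vector on it is mapped
    outside B and D. *)
Lemma zirreducible_image (K : set vec) :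
  (forall v w (t : C), K v -> K w -> K (v + t *: (w - v))) ->
  image_of K !=set0 -> zirreducible (image_of K).
Proof.
move=> hK A0; split=> // B D cB cD ABD; apply: contrapT => /not_orP[].
move=> /existsNP[y /not_implyP[[v [Kv v0 yv]] By]].
move=> /existsNP[z /not_implyP[[w [Kw w0 zw]] Dz]].
have [e [p [hp Bp py]]] := zclosedP cB By; have [e' [q [hq Dq qz]]] := zclosedP cD Dz.
have /rV0Pn[i vi] := v0; have /rV0Pn[j vj] := represents_neq0 yv.
have comp (r : mpoly N.+1 C) : polyfun (fun u : vec => peval r (veval u)).
  have := polyfun_peval_comp r (fun k => polyfun_peval (F k)).
  by move=> h u t; have [s sE] := h u t; exists s => a; rewrite sE; apply: meval_eq => k; rewrite mxE.
(* The last two factors ensure that the vector found is nonzero and has a nonzero image. *)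
pose f (u : vec) : C := peval p (veval u) * u 0 i * peval (F j) u.
have hf : polyfun f.
  by apply: polyfunM (polyfun_peval _); apply: polyfunM (comp p) (polyfun_coord i).
have fv : f v != 0.
  apply: mulf_neq0; last by move: vj; rewrite mxE.
  by apply: mulf_neq0 vi; rewrite -(peval_represents hp yv).
have gw : peval q (veval w) != 0 by rewrite -(peval_represents hq zw).
have [t [ht1 ht2]] := polyfun_common hf (comp q) fv gw.
move: ht1 ht2; set u := v + _; rewrite /f !mulf_eq0 !negb_or => /andP[/andP[pu ui] Fu] qu.
have u0 : u != 0 by apply/rV0Pn; exists i.
have Fu0 : veval u != 0 by apply/rV0Pn; exists j; rewrite mxE.
have [x xu] := represents_exists Fu0.
have : image_of K x by exists u; split => //; exact: hK.
case/ABD => [/Bp|/Dq] /eqP.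
- by rewrite (peval_represents hp xu) (negbTE pu).
- by rewrite (peval_represents hq xu) (negbTE qu).
Qed.

End LinearImage.

Section Lines.
Variables (R : realType) (n : nat).
Local Notation C := R[i].
Local Notation vec := 'rV[C^o]_n.+1.
Local Notation P := (projspace R n).
Variables u w : vec.
Hypothesis indep : forall a b : C, a *: u + b *: w = 0 -> a = 0 /\ b = 0.

Definition span2 : set vec := [set v | exists a b : C, v = a *: u + b *: w].

Definition pline : set P := [set x | exists2 v, span2 v & represents x v].

Lemma span2_comb v v' (t : C) : span2 v -> span2 v' -> span2 (v + t *: (v' - v)).
Proof.
move=> [a [b ->]] [a' [b' ->]]; exists (a + t * (a' - a)), (b + t * (b' - b)).
by apply/rowP => j; rewrite !mxE; ring.
Qed.

Lemma pline_image : pline = image_of (fun i : 'I_n.+1 => mpolyX C (mnm1 i)) span2.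
Proof.
have vE (v : vec) : veval (fun i : 'I_n.+1 => mpolyX C (mnm1 i)) v = v.
  by apply/rowP => j; rewrite mxE /peval mevalXU.
apply/seteqP; split=> x.
  by case=> v Kv xv; exists v; split; rewrite ?vE//; exact: represents_neq0 xv.
by case=> v [Kv _ xv]; exists v => //; rewrite -[v]vE.
Qed.

Let uw_neq0 (t : C) : u + t *: w != 0.
Proof.
apply/eqP => h; have [] := indep (a := 1) (b := t); first by rewrite scale1r.
by move=> /eqP; rewrite oner_eq0.
Qed.

Let w_neq0 : w != 0.
Proof.
apply/eqP => h; have [] := indep (a := 0) (b := 1).
  by rewrite scale0r scale1r add0r.
by move=> _ /eqP; rewrite oner_eq0.
Qed.

Lemma zirreducible_pline : zirreducible pline.
Proof.
rewrite pline_image; apply: zirreducible_image; first exact: span2_comb.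
rewrite -pline_image; exists (pt w), w; last exact: represents_pt.
by exists 0, 1; rewrite scale0r scale1r add0r.
Qed.

(** A form that vanishes on [Z] but not on the line has finitely many zeros there: roots of its
    restriction to u + t w, and possibly w. A finite irreducible set is a point. *)
Lemma proper_subset_pline Z : projective_variety Z -> Z `<` pline ->
  exists x, Z `<=` [set x].
Proof.
move=> [cZ iZ] [Zl /existsNP[x /not_implyP[[v [a [b vE]] xv] Zx]]].
have [d [p [hp Zp px]]] := zclosedP cZ Zx.
have pv : peval p v != 0 by rewrite -(peval_represents hp xv).
have [q qE] := polyfun_peval p u w.
have q0 : q != 0.
  apply/eqP => q0; have z t : peval p (u + t *: w) = 0 by rewrite -qE q0 horner0.
  have [a0|a0] := eqVneq a 0; last first.
    case/negP: pv; rewrite vE (_ : _ + _ = a *: (u + (b / a) *: w)).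
      by rewrite (peval_homog _ _ hp) z mulr0.
    by rewrite scalerDr scalerA mulrCA divff// mulr1.
  have [r rE] := polyfun_peval p w u.
  have r0 : r != 0.
    apply: contraNneq pv => r0; rewrite vE a0 scale0r add0r (peval_homog _ _ hp).
    by rewrite -[w]addr0 -(scale0r u) -rE r0 horner0 mulr0.
  have [t [_]] := root_near0 (mulf_neq0 r0 (negbT (polyX_eq0 _))) ltr01.
  rewrite hornerM hornerX mulf_eq0 negb_or rE => /andP[/negP + t0]; apply.
  rewrite (_ : w + t *: u = t *: (u + t^-1 *: w)).
    by rewrite (peval_homog _ _ hp) z mulr0.
  by rewrite scalerDr scalerA divff// scale1r addrC.
have [r hr] := poly_roots q0.
apply: (@zirreducible_seq _ _ Z (pt w :: [seq pt (u + t *: w) | t <- r])) => // y Zy.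
have [_ [a' [b' ->]] yv] := Zl y Zy; rewrite inE.
have [a0|a0] := eqVneq a' 0.
  apply/orP; left; apply/eqP; move: yv; rewrite a0 scale0r add0r => yw.
  apply: (represents_inj yw); have b0 : b' != 0.
    by apply: contraTneq (represents_neq0 yw) => ->; rewrite scale0r eqxx.
  by apply: representsZ => //; exact: represents_pt.
apply/orP; right; apply/mapP; exists (b' / a').
  apply: hr; rewrite /root qE -(peval_represents hp (x := y)) ?Zp//.
  have := representsZ (_ : a'^-1 != 0) yv; rewrite invr_eq0 => /(_ a0).
  by rewrite scalerDr !scalerA mulVf// scale1r mulrC.
apply: (represents_inj yv); rewrite (_ : _ + _ = a' *: (u + (b' / a') *: w)).
  by apply: representsZ => //; exact: represents_pt.
by rewrite scalerDr scalerA mulrCA divff// mulr1.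
Qed.

(** In a chain of length two the middle term would be a proper subvariety of the line, hence a
    point, and could not properly contain the nonempty bottom term. *)
Lemma irreducible_curve_pline : zclosed pline -> irreducible_curve pline.
Proof.
move=> cl; split; first by split => //; exact: zirreducible_pline.
apply/eqP; rewrite eq_le; apply/andP; split.
  apply: ge_ereal_sup => _ [k [Z [vZ pZ]] <-]; rewrite lee_fin (ler_nat _ _ 1) leqNgt.
  apply/negP => k1; have k0 : (0 < k)%N by exact: ltnW.
  have [Z01 Z10] := pZ 0%N k0; have [Z12 Z21] := pZ 1%N k1.
  have [vZ1 Z1l] := vZ 1%N k0; have [_ Z2l] := vZ 2%N k1.
  have [|x Z1x] := @proper_subset_pline (Z 1%N) vZ1.
    by split => // lZ; apply: Z21 => y /Z2l /lZ.
  have [[_ [[y Z0y] _]] _] := vZ 0%N isT.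
  apply: Z10 => z /Z1x ->; have /Z01/Z1x := Z0y.
  by move=> <-.
apply: ereal_sup_ubound; exists 1%N => //.
exists (fun i => if i is 0%N then [set pt w] else pline).
have lw : pline (pt w).
  exists w; last exact: represents_pt.
  by exists 0, 1; rewrite scale0r scale1r add0r.
split.
  case=> [_|i _]; last by split => //; split => //; exact: zirreducible_pline.
  split; last by move=> _ ->.
  by split; [exact: zclosed_set1|exact: zirreducible_set1].
case=> // _; split; first by move=> _ ->.
have u0 : u != 0 by have := uw_neq0 0; rewrite scale0r addr0.
move=> h; have : pline (pt u).
  exists u; last exact: represents_pt.
  by exists 1, 0; rewrite scale0r scale1r addr0.
move=> /h uw; have ru := represents_pt u0; have rw := represents_pt w_neq0.
rewrite uw in ru; have [c wE] := par_scale u0 (represents_par ru rw).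
have [|_ /eqP] := indep (a := - c) (b := 1).
  by rewrite scale1r wE scaleNr addNr.
by rewrite oner_eq0.
Qed.

End Lines.

(** * Values of rational maps *)

Section Values.
Variables (R : realType) (n N : nat).
Local Notation C := R[i].
Local Notation vec := 'rV[C^o]_n.+1.
Local Notation P := (projspace R n).
Implicit Types (v w : vec) (x : P) (y : projspace R N).

Lemma ccont_root_eq0 (h : C -> C) (r : {poly C}) (d : R) :
  ccont h 0 -> r != 0 -> 0 < d ->
  (forall s, cabs s < d -> r.[s] != 0 -> h s = 0) -> h 0 = 0.
Proof.
move=> ch r0 d0 hz; apply: (ccont_eq0 ch) => e e0.
have de : 0 < Num.min d e by rewrite lt_min d0.
have [s [+ rs]] := root_near0 r0 de; rewrite lt_min => /andP[sd se].
by exists s; [rewrite subr0|exact: hz].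
Qed.

(** The point [v] is approached along the line towards [a], on which [p] has finitely many zeros. *)
Lemma polyfun_dense (h : vec -> C^o) (p : vec -> C) a v :
  differentiable h v -> polyfun p -> p a != 0 ->
  (\forall w \near v, p w != 0 -> h w = 0) -> h v = 0.
Proof.
move=> ch hp pa /near_vecP[e e0 he]; have [q qE] := hp v (a - v).
have q0 : q != 0.
  by apply: contraNneq pa => q0; rewrite -[a](subrK v) addrC -(scale1r (a - v)) -qE q0 horner0.
have := @ccont_root_eq0 (fun s => h (v + s *: (a - v))) q (e / (1 + \sum_i cabs ((a - v) 0 i))).
have S0 : 0 < 1 + \sum_i cabs ((a - v) 0 i).
  by rewrite ltr_pwDl// sumr_ge0// => i _; exact: cabs_ge0.
rewrite scale0r addr0; apply => //; last 2 first.
- by rewrite divr_gt0.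
- move=> s; rewrite ltr_pdivlMr// => se qs; apply: he; last by rewrite -qE.
  move=> i; have -> : (v + s *: (a - v)) 0 i - v 0 i = s * (a - v) 0 i by rewrite !mxE; ring.
  rewrite cabsM (le_lt_trans _ se)// ler_wpM2l ?cabs_ge0// (bigD1 i)//= addrCA lerDl.
  by rewrite addr_ge0// sumr_ge0// => j _; exact: cabs_ge0.
apply: continuous_line; rewrite scale0r addr0.
exact: differentiable_continuous.
Qed.

Variable f : rational_map R n N.
Local Notation F := (@veval R n N (rm_poly f)).

Lemma FZ (a : C) v : F (a *: v) = a ^+ rm_deg f *: F v.
Proof. by apply: vevalZ; exact: rm_homog. Qed.

Lemma F_par (a : C) v : par (F v) (F (a *: v)).
Proof. by rewrite FZ; exact: parZ. Qed.

Lemma F_neq0Z (a : C) v : a != 0 -> (F (a *: v) != 0) = (F v != 0).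
Proof. by move=> a0; rewrite FZ scaler_eq0 expf_eq0 (negbTE a0) andbF. Qed.

Lemma represents_veval x v : represents x v ->
  (F v != 0 -> F (hcoord x) != 0) /\ par (F (hcoord x)) (F v).
Proof.
move=> [a [a0 ->]]; split; last exact: F_par.
by move=> h; exact: etrans (esym (F_neq0Z (hcoord x) a0)) h.
Qed.

Lemma differentiable_veval v : differentiable F v.
Proof.
have -> : F = \sum_(j < N.+1) (fun v => peval (rm_poly f j) v *: (delta_mx 0 j : 'rV[C^o]_N.+1)).
  apply/funext => w; rewrite fct_sumE; apply/rowP => k; rewrite mxE summxE.
  rewrite (bigD1 k)//= !mxE !eqxx mulr1 big1 ?addr0// => j jk.
  by rewrite !mxE eqxx eq_sym (negbTE jk) mulr0.
apply: differentiable_sum => j; apply: differentiableZl.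
exact: differentiable_peval.
Qed.

Lemma differentiable_entry (G : vec -> 'rV[C^o]_N.+1) v j :
  differentiable G v -> differentiable (fun w => G w 0 j : C^o) v.
Proof.
move=> dG; apply: (@differentiable_comp C vec 'rV[C^o]_N.+1 C^o G (fun u => u 0 j)) => //.
exact: differentiable_coord.
Qed.

Lemma open_veval_neq0 : open [set v | F v != 0].
Proof.
apply: (@open_comp _ _ F [set w | w != 0]); last exact: open_nonzero.
by move=> w _; apply: differentiable_continuous; exact: differentiable_veval.
Qed.

Lemma rm_value_eval x v y : represents x v -> represents y (F v) -> rm_value f x y.
Proof.
move=> xv yv; exists [set z | F (hcoord z) != 0], (fun z => pt (F (hcoord z))).
have [e0 ep] := represents_veval xv; have Fv := represents_neq0 yv.
have {}e0 := e0 Fv; split; last 2 first.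
- exact: e0.
- by apply: (represents_inj _ yv); apply: (par_represents _ Fv ep); exact: represents_pt.
split; last by move=> z z0 _; exact: represents_pt.
- apply: (open_invariant open_veval_neq0) => w a a0 Fw.
  by rewrite /= (F_neq0Z _ a0).
- move=> z z0; exists F.
  have nz : \forall w \near hcoord z, F w != 0.
    by apply: open_nbhs_nbhs; split; [exact: open_veval_neq0|exact: z0].
  near=> w; split; first exact: differentiable_veval.
  move=> x' xw; have [e0' ep'] := represents_veval xw.
  have Fw : F w != 0 by near: w.
  have {}e0' := e0' Fw.
  by apply: (par_represents _ Fw ep'); exact: represents_pt.
Unshelve. all: by end_near.
Qed.

Lemma extension_lift U g x : holomorphic_extension f U g -> U x ->
  exists G : vec -> 'rV[C^o]_N.+1,
    \forall v \near hcoord x, [/\ differentiable G v,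
      (forall z, represents z v -> represents (g z) (G v)) & par (G v) (F v)].
Proof.
move=> [oU hU gU] Ux; have [G nG] := hU x Ux; exists G.
have nU := near_cone oU Ux (represents_hcoord x).
near=> v; have [dG hG] : differentiable G v /\
  forall z, represents z v -> represents (g z) (G v) by near: v.
split => //; have [z Uz zv] : cone U v by near: v.
have [F0|F0] := eqVneq (F v) 0; first by move=> j k; rewrite F0 !mxE !mulr0.
have [e0 ep] := represents_veval zv.
have rz := e0 F0.
have gz : represents (g z) (F (hcoord z)) := gU z Uz rz.
by apply: (par_trans rz _ ep); exact: represents_par (hG z zv) gz.
Unshelve. all: by end_near.
Qed.

Lemma rm_value_lift x y : rm_value f x y -> exists G : vec -> 'rV[C^o]_N.+1,
  represents y (G (hcoord x)) /\
  \forall v \near hcoord x, differentiable G v /\ par (G v) (F v).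
Proof.
move=> [U [g [eg Ux gx]]]; have [G nG] := extension_lift eg Ux; exists G; split.
  have [_ h _] := nbhs_singleton nG; rewrite -gx; apply: h.
  exact: represents_hcoord.
by apply: filterS nG => v [].
Qed.

Lemma rm_value_cst (Y0 : 'rV[C^o]_N.+1) y : represents y Y0 ->
  (forall v, par Y0 (F v)) -> forall x, rm_value f x y.
Proof.
move=> yY h x; exists setT, (fun=> y); split => //; split; first exact: openT.
  move=> z _; exists (fun=> Y0); near=> v; split; first exact: differentiable_cst.
  by move=> z' _.
by move=> z _ z0; exact: (par_represents yY z0 (h (hcoord z))).
Unshelve. all: by end_near.
Qed.

(** A lift near x is parallel to [Y0] wherever a nonzero coordinate of F does not vanish, and by
    density also at x. *)
Lemma rm_value_cst_unique (Y0 : 'rV[C^o]_N.+1) y a : represents y Y0 ->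
  (forall v, par Y0 (F v)) -> F a != 0 -> forall x z, rm_value f x z -> z = y.
Proof.
move=> yY h /rV0Pn[l al] x z /rm_value_lift[G [zG nG]].
have Y0n := represents_neq0 yY.
apply: (represents_inj zG); apply: (par_represents yY (represents_neq0 zG)) => j k.
apply/eqP; rewrite -subr_eq0; apply/eqP.
have dG i : differentiable (fun v => G v 0 i : C^o) (hcoord x).
  by apply: differentiable_entry; have [] := nbhs_singleton nG.
pose h1 v : C^o := Y0 0 j * G v 0 k - Y0 0 k * G v 0 j.
apply: (@polyfun_dense h1 (fun v => F v 0 l) a _ _ _ al).
- by apply: differentiableB; apply: differentiableM => //; exact: differentiable_cst.
- move=> v w; have [q qE] := polyfun_peval (rm_poly f l) v w.
  by exists q => t; rewrite qE mxE.
- apply: filterS nG => v [_ Gv] Fv.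
  have Fn : F v != 0 by apply/rV0Pn; exists l.
  by rewrite /h1 (par_trans Fn (h v) (par_sym Gv)) subrr.
Qed.

End Values.

(** * Constancy along the lines through the center *)

Section Pencil.
Variables (R : realType) (N : nat).
Local Notation C := R[i].
Local Notation vec := 'rV[C^o]_3.
Local Notation P2 := (projspace R 2).
Local Notation phi := (@lines_weight R).
Implicit Types (v w : vec) (x : P2) (y : projspace R N).

(* Substitute (1, t, t^(d+1)): forms of degree d have distinct monomials there. *)
Lemma mpoly_neq0_eval d (p : mpoly 3 C) : homog d p -> p != 0 -> exists v : vec, peval p v != 0.
Proof.
move=> /dhomogP hp p0; have [m0 m0p] : exists m, m \in msupp p.
  case: (msupp p) (msupp_eq0 p) => [|m s _]; first by rewrite (negbTE p0) eqxx.
  by exists m; rewrite mem_head.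
(* As m_1 <= d, division of the code by d + 1 recovers m_2 and m_1; the degree then gives m_0. *)
pose code (m : multinom 3) : nat := (m 2%R * d.+1 + m 1%R)%N.
have md m : m \in msupp p -> (m 0%R + m 1%R + m 2%R = d)%N.
  move=> /hp <-; rewrite /= mdegE !big_ord_recr big_ord0 /= add0n.
  by congr (_ + _ + _)%N; congr (m _); apply: val_inj.
have inj m : m \in msupp p -> code m = code m0 -> m = m0.
  move=> mp E.
  have lt k : k \in msupp p -> (k 1%R < d.+1)%N.
    by move=> /md <-; rewrite ltnS addnAC leq_addl.
  have [e2 e1] : (m 2%R, m 1%R) = (m0 2%R, m0 1%R).
    by rewrite -(edivn_eq (m 2%R) (lt _ mp)) -(edivn_eq (m0 2%R) (lt _ m0p)); congr edivn.
  have e0 : m 0%R = m0 0.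
    have := md _ m0p; rewrite -(md _ mp) e1 e2 => /eqP.
    by rewrite !eqn_add2r => /eqP.
  apply/mnmP => i; have : i = 0%R \/ i = 1%R \/ i = 2%R.
    by case: i => -[|[|[|//]]] ?; [left|right; left|right; right]; apply: val_inj.
  by case=> [|[]] ->.
pose q : {poly C} := \sum_(m <- msupp p) mcoeff m p *: 'X^(code m).
have q0 : q != 0.
  apply: contraTneq m0p => q0; rewrite mcoeff_msupp negbK.
  have := congr1 (fun r : {poly C} => r`_(code m0)) q0.
  rewrite coef0 /q coef_sum; have [m0i|] := boolP (m0 \in msupp p); last first.
    by rewrite mcoeff_msupp negbK.
  rewrite (bigD1_seq m0)//= coefZ coefXn eqxx mulr1 big1_seq ?addr0.
    by move=> /eqP.
  move=> m /andP[mm0 mp]; rewrite coefZ coefXn.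
  case: eqP => [/esym/(inj m mp) E|]; last by rewrite mulr0.
  by rewrite E eqxx in mm0.
have [t [_ qt]] := root_near0 q0 ltr01.
exists (vec3 1 t (t ^+ d.+1)); apply: contraNneq qt; rewrite /peval mevalE /q horner_sum => E.
rewrite -[X in _ == X]E; apply/eqP; apply: eq_bigr => m _.
rewrite hornerZ hornerXn !big_ord_recr big_ord0 /= mul1r; congr (_ * _).
rewrite !mxE /= expr1n mul1r /code exprD mulnC exprM mulrC.
by congr (_ ^+ m _ * _ ^+ m _); apply: val_inj.
Qed.

(* The coordinates of v are chosen one at a time. *)
Lemma polyfun_avoid (h : nat -> vec -> C) (a : nat -> vec) :
  (forall i, polyfun (h i)) -> (forall i, h i (a i) != 0) ->
  exists v : vec, forall i, h i v != 0.
Proof.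
move=> hh ha.
have step (b : nat -> vec) (e : vec) (u : nat -> vec) (s : nat -> C) :
    (forall i, h i (u i + s i *: e) != 0) -> exists t : C, forall i, h i (u i + t *: e) != 0.
  move=> hb; have /choice[q qE] : forall i, exists q : {poly C},
    forall t, q.[t] = h i (u i + t *: e) by move=> i; exact: hh.
  have q0 i : q i != 0 by apply: contraNneq (hb i) => q0; rewrite -qE q0 horner0.
  by have [t ht] := avoid_roots q0; exists t => i; rewrite -qE.
have [t0 h0'] : exists t : C, forall i, h i (vec3 0 (a i 0 1) (a i 0 2) + t *: vec3 1 0 0) != 0.
  apply: (step a _ _ (fun i => a i 0 0)) => i.
  by rewrite vec3Z vec3D !mulr0 !addr0 add0r mulr1 -vec3E.
have [t1 h1] : exists t : C, forall i, h i (vec3 t0 0 (a i 0 2) + t *: vec3 0 1 0) != 0.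
  apply: (step a _ _ (fun i => a i 0 1)) => i; move: (h0' i).
  by rewrite !vec3Z !vec3D !mulr0 !addr0 !add0r !mulr1.
have [t2 h2] : exists t : C, forall i, h i (vec3 t0 t1 0 + t *: vec3 0 0 1) != 0.
  apply: (step a _ _ (fun i => a i 0 2)) => i; move: (h1 i).
  by rewrite !vec3Z !vec3D !mulr0 !addr0 !add0r !mulr1.
by exists (vec3 t0 t1 0 + t2 *: vec3 0 0 1).
Qed.

Lemma zclosed_linear (l : vec) :
  zclosed [set x : P2 | \sum_(i < 3) l 0 i * hcoord x 0 i = 0].
Proof.
exists [set \sum_(i < 3) l 0 i *: mpolyX C (mnm1 i)]; split.
  by move=> _ ->; exists 1%N; apply: rpred_sum => i _; apply: rpredZ; exact: homogX.
have E (x : P2) : pval (\sum_(i < 3) l 0 i *: mpolyX C (mnm1 i)) x =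
    \sum_(i < 3) l 0 i * hcoord x 0 i.
  by rewrite /pval !big_ord_recr !big_ord0 /= !mevalD !mevalZ !mevalXU meval0.
apply/seteqP; split=> x /=; first by move=> h _ ->; rewrite E.
by move=> /(_ _ erefl); rewrite E.
Qed.

Lemma sum3 (g : 'I_3 -> C) : \sum_(i < 3) g i = g 0 + g 1 + g 2.
Proof.
rewrite !big_ord_recr big_ord0 /= add0r.
by congr (_ + _ + _); congr g; apply: val_inj.
Qed.

Lemma irreducible_center_line (b c : C) : b != 0 \/ c != 0 ->
  irreducible_curve (@center_line R b c).
Proof.
move=> bc0; have lE : center_line b c = pline (vec3 1 0 0) (vec3 0 b c).
  apply/seteqP; split=> x.
    move=> /cone_hcoord /(center_line_coord bc0)[al [be E]].
    exists (hcoord x); last exact: represents_hcoord.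
    by exists al, be; rewrite !vec3Z vec3D !mulr0 !addr0 !add0r mulr1.
  move=> [v [al [be ->]] xv]; apply: (cone_represents xv).
  apply/cone_center_line; first exact: represents_neq0 xv.
  by rewrite !vec3Z vec3D vec31 vec32 !mulr0 !add0r mulrAC.
rewrite lE; apply: irreducible_curve_pline.
  move=> al be; rewrite !vec3Z vec3D !mulr0 !addr0 !add0r mulr1 => E.
  have e0 := congr1 (fun v : vec => v 0 0) E; have e1 := congr1 (fun v : vec => v 0 1) E.
  have e2 := congr1 (fun v : vec => v 0 2) E.
  move: e0 e1 e2; rewrite vec30 vec31 vec32 !mxE => -> /eqP + /eqP.
  rewrite !mulf_eq0; case: bc0 => /negbTE ->; rewrite orbF => h1 h2; split=> //; exact/eqP.
have -> : pline (vec3 1 0 0) (vec3 0 b c) =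
    [set x : P2 | \sum_(i < 3) (vec3 0 c (- b)) 0 i * hcoord x 0 i = 0].
  rewrite -lE; apply/seteqP; split=> x; rewrite /center_line/= sum3 vec30 vec31 vec32 mul0r add0r.
    by move=> h; rewrite mulrC h mulNr [b * _]mulrC subrr.
  by move=> /eqP; rewrite mulNr subr_eq0 mulrC => /eqP ->; rewrite mulrC.
exact: zclosed_linear.
Qed.

Lemma irreducible_line_at_infinity : irreducible_curve (@line_at_infinity R).
Proof.
have E (al be : C) : al *: vec3 0 1 0 + be *: vec3 0 0 1 = vec3 0 al be.
  by rewrite !vec3Z vec3D !mulr0 !addr0 !add0r !mulr1.
have lE : @line_at_infinity R = pline (vec3 0 1 0) (vec3 0 0 1).
  apply/seteqP; split=> x.
    move=> x0; exists (hcoord x); last exact: represents_hcoord.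
    exists (hcoord x 0 1), (hcoord x 0 2); rewrite E {1}[hcoord x]vec3E.
    by congr vec3.
  move=> [v [al [be ->]] xv]; apply: (cone_represents xv).
  apply/cone_line_at_infinity; first exact: represents_neq0 xv.
  by rewrite E vec30.
rewrite lE; apply: irreducible_curve_pline.
  move=> al be; rewrite E => E0.
  have e1 := congr1 (fun v : vec => v 0 1) E0; have e2 := congr1 (fun v : vec => v 0 2) E0.
  by move: e1 e2; rewrite vec31 vec32 !mxE.
have -> : pline (vec3 0 1 0) (vec3 0 0 1) =
    [set x : P2 | \sum_(i < 3) (vec3 1 0 0) 0 i * hcoord x 0 i = 0].
  rewrite -lE; apply/seteqP; split=> x; rewrite /line_at_infinity/= sum3 vec30 vec31 vec32;
    by rewrite mul1r !mul0r !addr0.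
exact: zclosed_linear.
Qed.

Variable f : rational_map R 2 N.
Local Notation F := (@veval R 2 N (rm_poly f)).
Local Notation e0 := (vec3 1 0 0 : vec).

(* If the minors did not vanish, a very general line through the center would *)
(* have a positive dimensional image.                                         *)
Lemma pencil_par :
  very_generally [set: P2] (fun x => forall D : set P2, irreducible_curve D -> D x ->
    (0 < zdim (rm_image f D))%E -> (0 < intersection_number phi D)%E) ->
  forall v (l : C), par (F v) (F (v + l *: e0)).
Proof.
move=> [Z [hZ gen]] v0 l j k; apply/eqP; rewrite -subr_eq0; apply: contraT => h0.
pose h v : C := F v 0 j * F (v + l *: e0) 0 k - F v 0 k * F (v + l *: e0) 0 j.
have hF i : polyfun (fun v => F v 0 i).
  by move=> v w; have [q qE] := polyfun_peval (rm_poly f i) v w; exists q => t; rewrite qE mxE.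
have /choice[b hb] : forall i, exists b : (mpoly 3 C * vec)%type,
    (forall x, Z i x -> forall v, represents x v -> peval b.1 v = 0) /\ peval b.1 b.2 != 0.
  move=> i; have [cZ [_ /existsNP[x /not_implyP[_ Zx]]]] := hZ i.
  have [d [p [hp Zp px]]] := zclosedP cZ Zx; exists (p, hcoord x); split; last exact: px.
  move=> y Zy v yv; apply/eqP; rewrite -(peval_represents hp yv); apply/eqP; exact: Zp.
(* The vector has to avoid countably many hypersurfaces: the zeros of the minor, the line z_1 = 0,
   which contains the center, and for each Z_i the zeros of a form that vanishes on it. *)
pose H (i : nat) : vec -> C :=
  match i with 0 => h | 1 => fun v => v 0 1 | i.+2 => peval (b i).1 end.
pose a (i : nat) : vec :=
  match i with 0 => v0 | 1 => vec3 0 1 0 | i.+2 => (b i).2 end.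
have [v hv] : exists v, forall i, H i v != 0.
  apply: (@polyfun_avoid H a).
  - case=> [|[|i]]; [|exact: polyfun_coord|exact: polyfun_peval].
    apply: polyfunB; apply: polyfunM; [exact: hF| |exact: hF|];
      exact: (polyfun_shift (h := fun v => F v 0 _)) (hF _).
  - case=> [|[|i]]; [exact: h0|by rewrite /H /a vec31 oner_neq0|].
    exact: (hb i).2.
have v1 : v 0 1 != 0 := hv 1%N.
have vn : v != 0 by apply/rV0Pn; exists 1.
pose w := v + l *: e0.
have w1 : w 0 1 = v 0 1 by rewrite /w !mxE mulr0 addr0.
have w2 : w 0 2 = v 0 2 by rewrite /w !mxE mulr0 addr0.
have wn : w != 0 by apply/rV0Pn; exists 1; rewrite w1.
have hvw : F v 0 j * F w 0 k - F v 0 k * F w 0 j != 0 := hv 0%N.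
have Fv : F v != 0.
  by apply: contraNneq hvw => ->; rewrite [X in X * _]mxE [X in _ - X * _]mxE !mul0r subrr.
have Fw : F w != 0.
  by apply: contraNneq hvw => ->; rewrite [X in _ * X - _]mxE [X in _ - _ * X]mxE !mulr0 subrr.
have bc0 : v 0 1 != 0 \/ v 0 2 != 0 by left.
have rx := represents_pt vn; have rw := represents_pt wn.
have Dv : center_line (v 0 1) (v 0 2) (pt v).
  by apply: (cone_represents rx); apply/cone_center_line => //; rewrite mulrC.
have Dw : center_line (v 0 1) (v 0 2) (pt w).
  by apply: (cone_represents rw); apply/cone_center_line => //; rewrite w1 w2 mulrC.
have Zv i : ~ Z i (pt v).
  by move=> Zi; case/negP: (hv i.+2); rewrite /H ((hb i).1 _ Zi _ rx).
case: (center_line_number bc0).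
apply: (gen (pt v) I Zv); [exact: irreducible_center_line|exact: Dv|].
pose K : set vec := [set u | u 0 1 * v 0 2 = u 0 2 * v 0 1].
(* The closure of [A] is an irreducible subset of the image of the line and contains the two
   distinct points f(v) and f(w); this makes the dimension positive. *)
pose A := image_of (rm_poly f) K.
have Kv : K v by rewrite /K /= mulrC.
have Kw : K w by rewrite /K /= w1 w2 mulrC.
have ry := represents_pt Fv; have rz := represents_pt Fw.
have Ay : A (pt (F v)) by exists v.
have Az : A (pt (F w)) by exists w.
have vA : projective_variety (zclosure A).
  split; first exact: zclosed_zclosure.
  apply: zirreducible_zclosure; apply: zirreducible_image; last exact: (ex_intro _ _ Ay).
  move=> u u' t Ku Ku'; rewrite /K /= !mxE.
  have -> : (u 0 1 + t * (u' 0 1 - u 0 1)) * v 0 2 =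
    u 0 1 * v 0 2 + t * (u' 0 1 * v 0 2 - u 0 1 * v 0 2) by ring.
  by rewrite Ku Ku'; ring.
apply: (zdim_gt0 (x := pt (F v)) vA).
- apply: zclosure_sub; first exact: zclosed_zclosure.
  move=> y [u [Ku un yu]]; apply: sub_zclosure; exists (pt u).
    by apply: (cone_represents (represents_pt un)); apply/cone_center_line.
  exact: rm_value_eval (represents_pt un) yu.
- exact: sub_zclosure.
- move=> /(_ _ (sub_zclosure Az)) E; rewrite E in rz.
  by case/eqP: hvw; rewrite (represents_par ry rz) subrr.
Qed.

End Pencil.

(** * Shifts along the lines through the center *)

Section Shift.
Variables (R : realType) (N : nat) (f : rational_map R 2 N).
Local Notation C := R[i].
Local Notation vec := 'rV[C^o]_3.
Local Notation P2 := (projspace R 2).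
Local Notation F := (@veval R 2 N (rm_poly f)).
Local Notation e0 := (vec3 1 0 0 : vec).
Hypothesis F_shift : forall v (l : C), par (F v) (F (v + l *: e0)).
Implicit Types (v w : vec) (x z : P2) (y : projspace R N).

(** For i != 0 a linear automorphism that preserves every line through the center, so it acts on the
    projective plane. *)
Definition shift (i : 'I_3) (l : C) (v : vec) : vec := v + (l * v 0 i) *: e0.

Lemma e0_neq0 : e0 != 0.
Proof. by apply: vec3_neq0; left; exact: oner_neq0. Qed.

Lemma shift_coord i l v j : j != 0 -> shift i l v 0 j = v 0 j.
Proof.
move=> j0; have ej : e0 0 j = 0 by rewrite mxE; case: j j0 => -[|[|[|//]]].
by rewrite /shift mxE [X in _ + X]mxE ej mulr0 addr0.
Qed.

Lemma shiftK i l v : i != 0 -> shift i l (shift i (- l) v) = v.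
Proof.
move=> i0; rewrite {1}/shift shift_coord// /shift -addrA -scalerDl mulNr addNr.
by rewrite scale0r addr0.
Qed.

Lemma shiftZ i l (a : C) v : shift i l (a *: v) = a *: shift i l v.
Proof. by rewrite /shift scalerDr scalerA; congr (_ + _ *: _); rewrite mxE mulrCA. Qed.

Lemma shift_neq0 i l v : i != 0 -> v != 0 -> shift i l v != 0.
Proof.
move=> i0; apply: contraNneq => h; rewrite -(shiftK (- l) v i0) opprK h /shift.
by rewrite mxE mulr0 scale0r addr0.
Qed.

Lemma differentiable_shift i l v : differentiable (shift i l) v.
Proof.
apply: differentiableD; first exact: ex_diff.
apply: (differentiableZl (k := fun v : vec => l * v 0 i : C^o)).
apply: (differentiableM (f := fun=> l)); first exact: differentiable_cst.
exact: differentiable_coord.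
Qed.

Lemma continuous_shift i l : continuous (shift i l).
Proof. by move=> v; apply: differentiable_continuous; exact: differentiable_shift. Qed.

(** If g extends f near x, then g composed with the inverse shift extends f near z, because F is
    parallel to its composition with the shift. *)
Lemma rm_value_shift i l x z y : i != 0 -> rm_value f x y ->
  represents z (shift i l (hcoord x)) -> rm_value f z y.
Proof.
move=> i0 [U [g [eU Ux gx]]] zx; have [oU hU gU] := eU.
pose S := shift i (- l); pose tau (z : P2) := pt (S (hcoord z)).
have rS z' v : represents z' v -> represents (tau z') (S v).
  move=> [a [a0 ->]]; rewrite /S shiftZ; apply: representsZ => //.
  by apply: represents_pt; apply: shift_neq0 => //; exact: hcoord_neq0.
have SK v : S (shift i l v) = v by rewrite /S -{2}[l]opprK shiftK.
have tz : tau z = x.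
  by apply: (represents_inj (rS _ _ zx)); rewrite SK; exact: represents_hcoord.
exists [set z | cone U (S (hcoord z))], (g \o tau); split; last 2 first.
- have := rS _ _ (represents_hcoord z); rewrite tz => h; by exists x.
- by rewrite /= tz.
have Ut z' : cone U (S (hcoord z')) -> U (tau z').
  exact: cone_represents (rS _ _ (represents_hcoord z')).
split.
- apply: (@open_invariant _ _ (S @^-1` cone U)).
    by apply: open_comp => [v _|]; [exact: continuous_shift|exact: open_cone].
  by move=> v a a0 Sv; rewrite /= /S shiftZ; exact: coneZ.
- move=> z' /Ut Uz; have [G nG] := hU _ Uz.
  have [a [a0 Sa]] := rS _ _ (represents_hcoord z').
  pose q v : vec := a^-1 *: S v; exists (G \o q).
  have dq v : differentiable q v.
    by apply: differentiableZ; exact: differentiable_shift.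
  have cq : q w @[w --> hcoord z'] --> hcoord (tau z').
    have <- : q (hcoord z') = hcoord (tau z') by rewrite /q Sa scalerA mulVf// scale1r.
    exact: (differentiable_continuous (dq (hcoord z'))).
  have nGq : \forall v \near hcoord z', differentiable G (q v) /\
    (forall z0, represents z0 (q v) -> represents (g z0) (G (q v))) := cq _ nG.
  near=> v; have [dG hG] : differentiable G (q v) /\
    (forall z0, represents z0 (q v) -> represents (g z0) (G (q v))) by near: v.
  split; first exact: (differentiable_comp (dq v)).
  move=> z0 zv; apply: hG; apply: representsZ; first by rewrite invr_eq0.
  exact: rS.
- move=> z' /Ut Uz Fz; have [G nG] := extension_lift eU Uz.
  have [a [a0 Sa]] := rS _ _ (represents_hcoord z'); set x1 := tau z' in Uz nG Sa *.
  have zE : hcoord z' = a *: shift i l (hcoord x1).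
    by rewrite -shiftZ -Sa /S shiftK.
  have {}Fz : F (hcoord z') != 0 := Fz.
  have Fx : F (shift i l (hcoord x1)) != 0.
    by apply: contraNneq Fz => h; rewrite zE FZ h scaler0.
  have [dG hG _] := nbhs_singleton nG; have {}hG := hG _ (represents_hcoord x1).
  suff pG : par (G (hcoord x1)) (F (shift i l (hcoord x1))).
    have : represents (g x1) (F (hcoord z')).
      by rewrite zE FZ; apply: representsZ; [rewrite expf_neq0|exact: par_represents pG].
    exact.
  (* F may vanish at [x1], so there G cannot be compared with it directly. The minors of G and of
     the shifted F vanish nearby wherever F does not, and by density at [x1]. *)
  have /rV0Pn[k Fk] := Fz; move=> j j'; apply/eqP; rewrite -subr_eq0; apply/eqP.
  pose h1 v : C^o := G v 0 j * F (shift i l v) 0 j' - G v 0 j' * F (shift i l v) 0 j.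
  have dF m : differentiable (fun v => F (shift i l v) 0 m : C^o) (hcoord x1).
    apply: differentiable_entry; apply: differentiable_comp; first exact: differentiable_shift.
    exact: differentiable_veval.
  apply: (@polyfun_dense _ _ h1 (fun v => F v 0 k) (hcoord z') _ _ _ Fk).
  + by apply: differentiableB; apply: differentiableM => //; exact: differentiable_entry.
  + by move=> v w; have [q qE] := polyfun_peval (rm_poly f k) v w; exists q => t; rewrite qE mxE.
  + apply: filterS nG => v [_ _ Gv] Fv.
    have Fn : F v != 0 by apply/rV0Pn; exists k.
    by rewrite /h1 (par_trans Fn Gv (F_shift v (l * v 0 i))) subrr.
Unshelve. all: by end_near.
Qed.

(* The fiber is stable under shifts, which move every other point of it towards *)
(* the center, and it is covered by the complements of neighborhoods of the     *)
(* center if it does not contain the center.                                    *)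
Lemma center_in_fiber y : rm_fiber f y !=set0 -> compact (rm_fiber f y) ->
  rm_value f (pt e0) y.
Proof.
move=> [x xy] /compact_near_coveringP cov; apply: contrapT => npy.
have away z : rm_fiber f y z -> exists2 i : 'I_3, i != 0 & hcoord z 0 i != 0.
  move=> zy; apply: contrapT => nz; apply: npy.
  have h0 (i : 'I_3) : i != 0 -> hcoord z 0 i = 0.
    by move=> i0; apply/eqP; apply: contraT => hi; case: nz; exists i.
  suff -> : pt e0 = z by exact: zy.
  apply: (represents_inj (represents_pt e0_neq0)).
  apply: (par_represents (represents_hcoord z) e0_neq0).
  have -> : hcoord z = hcoord z 0 0 *: e0.
    by rewrite {1}[hcoord z]vec3E vec3Z mulr1 mulr0 (h0 1)// (h0 2).
  by apply: par_sym; exact: parZ.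
pose W (n : nat) : set vec := [set v : vec | abs2 (v 0 0) < n%:R * dist2 v].
have WZ n v (a : C) : a != 0 -> W n v -> W n (a *: v).
  move=> a0; rewrite /W /= /dist2 !mxE !abs2M -mulrDr mulrCA ltr_pM2l//.
  by rewrite abs2E exprn_gt0// cabs_gt0.
have oW n : open (W n).
  rewrite (_ : W n = (fun v => n%:R * dist2 v - abs2 (v 0 0)) @^-1` [set t | 0 < t]); last first.
    by apply/seteqP; split => v; rewrite /W /= subr_gt0.
  apply: open_comp; last exact: open_gt.
  move=> v _; apply: (@continuousB R R^o vec (fun v => n%:R * dist2 v)
    (fun v : vec => abs2 (v 0 0))); last exact: continuous_abs2_comp (@continuous_coord _ 0 v).
  apply: (@continuousM R vec (fun=> n%:R) (@dist2 R)); last exact: continuous_dist2.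
  exact: cst_continuous.
have dist_gt0 z : rm_fiber f y z -> 0 < dist2 (hcoord z).
  move=> /away[i i0 zi]; have p j : hcoord z 0 j != 0 -> 0 < abs2 (hcoord z 0 j).
    by move=> zj; rewrite abs2E exprn_gt0// cabs_gt0.
  have q j : 0 <= abs2 (hcoord z 0 j) by exact: abs2_ge0.
  rewrite /dist2; have : i = 1 \/ i = 2.
    by case: i i0 {zi} => -[|[|[|//]]] //= ? _; [left|right]; apply: val_inj.
  by case=> ii; rewrite ii in zi; [rewrite ltr_pwDl ?p|rewrite ltr_wpDl ?p].
have [n _ hn] : \forall n \near \oo, rm_fiber f y `<=` (fun z => W n (hcoord z)).
  apply: cov => z zy; have dz := dist_gt0 z zy.
  pose n0 := (Num.truncn (abs2 (hcoord z 0 0) / dist2 (hcoord z))).+1.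
  exists ([set z' | W n0 (hcoord z')], [set n | (n0 <= n)%N]).
    split; last by exists n0.
    apply: open_nbhs_nbhs; split.
      by apply: open_invariant => // v a a0; exact: WZ.
    by rewrite /W /= -ltr_pdivrMr// truncnS_gt.
  move=> [z' m] [/= Wz n0m]; rewrite /W /=; apply: (lt_le_trans Wz).
  by rewrite ler_wpM2r ?dist2_ge0// ler_nat.
have {hn}hn := hn n (leqnn n).
have [i i0 xi] := away x xy; pose v := hcoord x.
(* The shift moves x to z_0 = L and keeps z_1 and z_2. As L >= 1, L^2 >= L >= n * dist2, so the
   shifted point of the fiber is outside [W n]. *)
pose L : R := 1 + n%:R * dist2 v.
pose l := ((L%:C)%C - v 0 0) / v 0 i.
have sn : shift i l v != 0 by apply: shift_neq0 => //; exact: hcoord_neq0.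
have rz := represents_pt sn; have zy := rm_value_shift i0 xy rz.
have := hn _ zy; rewrite -/(W n _) => Wz.
have : W n (shift i l v) by case: rz => a [a0 ->]; exact: WZ.
have dv : dist2 (shift i l v) = dist2 v by rewrite /dist2 !shift_coord.
rewrite /W /= dv.
have -> : shift i l v 0 0 = (L%:C)%C.
  by rewrite /shift mxE [X in _ + X]mxE vec30 mulr1 /l divfK// addrC subrK.
have L1 : 1 <= L by rewrite lerDl mulr_ge0// dist2_ge0.
rewrite abs2E cabs_real ger0_norm ?(le_trans _ L1)// ltNge; apply/negP; rewrite negbK.
apply: (@le_trans _ _ L); first by rewrite /L lerDr.
by rewrite expr2 ler_peMr// (le_trans _ L1).
Qed.

(** For s != 0, F at p + s w is parallel to F at s w by [F_shift], hence to F at w. So is the lift G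
    at p + s w, for s near 0 off the roots of a polynomial, and s -> 0 gives G at p. *)
Lemma value_at_center_cst y : rm_value f (pt e0) y ->
  exists Y0, represents y Y0 /\ forall w, par Y0 (F w).
Proof.
move=> /rm_value_lift[G [yG nG]]; set p := pt e0 in yG nG *.
exists (G (hcoord p)); split=> // w.
have [Fw|Fw] := eqVneq (F w) 0; first by move=> j k; rewrite Fw !mxE !mulr0.
have [a [a0 pE]] : exists a : C, a != 0 /\ hcoord p = a *: e0.
  have [b [b0 bE]] := represents_pt e0_neq0; exists b^-1; rewrite invr_eq0; split=> //.
  by rewrite bE scalerA mulVf// scale1r.
have /rV0Pn[k Fk] := Fw.
have pF v u : exists q : {poly C}, forall t, q.[t] = F (v + t *: u) 0 k.
  by have [q qE] := polyfun_peval (rm_poly f k) v u; exists q => t; rewrite qE mxE.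
have [r rE] := pF (hcoord p) w.
(* The coordinate k of F at w + t p is nonzero at t = 0, hence for some nonzero t, where it is a
   multiple of its value at p + t^-1 w. *)
have r0 : r != 0.
  have [q qE] := pF w (hcoord p).
  have q0 : q != 0.
    by apply: contraNneq Fk => q0; rewrite -[w]addr0 -(scale0r (hcoord p)) -qE q0 horner0.
  have [t [_]] := root_near0 (mulf_neq0 q0 (negbT (polyX_eq0 _))) ltr01.
  rewrite hornerM hornerX mulf_eq0 negb_or qE => /andP[Ft t0].
  apply: contraNneq Ft => r0; have := rE t^-1; rewrite r0 horner0 => E.
  have -> : w + t *: hcoord p = t *: (hcoord p + t^-1 *: w).
    by rewrite scalerDr scalerA divff// scale1r addrC.
  by rewrite FZ mxE -E mulr0.
move=> j j'; apply/eqP; rewrite -subr_eq0; apply/eqP.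
have [dG _] := nbhs_singleton nG.
pose h s : C := G (hcoord p + s *: w) 0 j * F w 0 j' - G (hcoord p + s *: w) 0 j' * F w 0 j.
have /near_vecP[e ee he] := nG.
have S0 : 0 < 1 + \sum_i cabs (w 0 i).
  by rewrite ltr_pwDl// sumr_ge0// => i _; exact: cabs_ge0.
have ch : ccont h 0.
  pose h' v : C^o := G v 0 j * F w 0 j' - G v 0 j' * F w 0 j.
  apply: (@continuous_line _ _ h'); rewrite scale0r addr0.
  apply: differentiable_continuous; apply: differentiableB; apply: differentiableM;
    by [exact: differentiable_entry|exact: differentiable_cst].
have := ccont_root_eq0 ch (mulf_neq0 r0 (negbT (polyX_eq0 _))) (divr_gt0 ee S0).
rewrite /h scale0r addr0; apply => s.
rewrite ltr_pdivlMr// hornerM hornerX mulf_eq0 negb_or rE => se /andP[Fs s0].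
have [_ Gs] : differentiable G (hcoord p + s *: w) /\ par (G (hcoord p + s *: w)) (F (hcoord p + s *: w)).
  apply: he => i; have -> : (hcoord p + s *: w) 0 i - hcoord p 0 i = s * w 0 i by rewrite !mxE; ring.
  rewrite cabsM (le_lt_trans _ se)// ler_wpM2l ?cabs_ge0// (bigD1 i)//= addrCA lerDl.
  by rewrite addr_ge0// sumr_ge0// => m _; exact: cabs_ge0.
have Fn : F (hcoord p + s *: w) != 0 by apply/rV0Pn; exists k.
have pw : par (F (hcoord p + s *: w)) (F w).
  apply: par_sym; apply: (par_trans _ (F_par f s w)).
    by rewrite F_neq0Z.
  by rewrite pE addrC; exact: F_shift.
by rewrite (par_trans Fn Gs pw) subrr.
Qed.

End Shift.

Theorem mainTheorem2 (R : realType) :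
  ~ exists (N : nat) (Y : set (projspace R N)) (f : rational_map R 2 N),
      (normal_variety Y /\ dominant_onto f Y /\ connected_fibers f Y) /\
      almost_holomorphic f /\
      very_generally Y (fun y =>
        forall C : set (projspace R 2), irreducible_curve C -> C `<=` rm_fiber f y ->
          intersection_number (@lines_weight R) C = 0%E) /\
      very_generally [set: projspace R 2] (fun x =>
        forall C : set (projspace R 2), irreducible_curve C -> C x ->
          (0 < zdim (rm_image f C))%E ->
          (0 < intersection_number (@lines_weight R) C)%E).
Proof.
move=> [N [Y [f [[_ [domY _]] [[y [fib_ne fib_c]] [triv pos]]]]]].
have F_shift := pencil_par pos.
have py := center_in_fiber F_shift fib_ne fib_c.
have [Y0 [yY hY]] := value_at_center_cst F_shift py.
have all_y := rm_value_cst yY hY.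
have [j fj] := rm_neq0 f; have [a aj] := mpoly_neq0_eval (rm_homog f j) fj.
have Fa : veval (rm_poly f) a != 0 by apply/rV0Pn; exists j; rewrite mxE.
have uniq_y := rm_value_cst_unique yY hY Fa.
have [Z [hZ gen]] := triv.
have Yy : Y y.
  rewrite -domY; apply: sub_zclosure; exists (pt (vec3 1 0 0)) => //.
(* Every value of f is y, so a closed set containing y contains Y, and no proper closed subset of Y
   contains y. *)
have Zy i : ~ Z i y.
  move=> Ziy; have [cZ [_]] := hZ i; apply; rewrite -domY; apply: zclosure_sub => //.
  by move=> z [x _ /uniq_y ->].
apply: line_at_infinity_number; apply: (gen y Yy Zy); first exact: irreducible_line_at_infinity.
by move=> x _; exact: all_y.
Qed.
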